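(* Each of the problems $\mathrm{CON}(\mathrm{THT}^{2}_{1}(\mathsf F,\mathsf G))$, $\mathrm{CON}(\mathrm{THT}^{2}_{1}(\mathsf U))$ and $\mathrm{CON}(\mathrm{THT}^{2}_{1}(\mathsf R))$ is NEXPTIME-hard.
   Context: Fix a finite set $P$ of atomic propositions. THT formulas over $P$ are given by $\varphi ::= p \mid \bot \mid \varphi\vee\varphi \mid \varphi\wedge\varphi \mid \varphi\rightarrow\varphi \mid \mathsf{X}\varphi \mid \varphi\,\mathsf{U}\,\varphi \mid \varphi\,\mathsf{R}\,\varphi$. Further, $\neg\varphi:=\varphi\rightarrow\bot$ and $\top:=\neg\bot$. The modalities $\mathsf F\varphi$ and $\mathsf G\varphi$ have the meaning of $\top\,\mathsf U\,\varphi$ and $\bot\,\mathsf R\,\varphi$ respectively. An LTL interpretation is an infinite word $T$ over $2^P$. A THT interpretation is a pair $M=(H,T)$ of LTL interpretations with $H(i)\subseteq T(i)$ for all $i$; it is total if $H=T$. Satisfaction $M,i\models\varphi$ is defined by: - $M,i\not\models\bot$; - $M,i\models p$ iff $p\in H(i)$; - $\vee$ and $\wedge$ are interpreted as usual; - $M,i\models\varphi\rightarrow\psi$ iff for both $H'\in\{H,T\}$, either $(H',T),i\not\models\varphi$ or $(H',T),i\models\psi$; - $M,i\models\mathsf X\varphi$ iff $M,i+1\models\varphi$; - $M,i\models\varphi\,\mathsf U\,\psi$ iff some $j\ge i$ has $M,j\models\psi$ and $M,k\models\varphi$ for all $i\le k<j$; - $M,i\models\varphi\,\mathsf R\,\psi$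 iff for all $j\ge i$, either $M,j\models\psi$ or $M,k\models\varphi$ for some $i\le k<j$. $M\models\varphi$ means $M,0\models\varphi$. $H\sqsubset T$ means $H(i)\subseteq T(i)$ for all $i$ and $H\ne T$. An equilibrium model of $\varphi$ is a total $(T,T)\models\varphi$ with $(H,T)\not\models\varphi$ for all $H\sqsubset T$. Temporal height is the maximal nesting depth of temporal modalities ($\mathsf X,\mathsf U,\mathsf R,\mathsf F,\mathsf G$). Implication height is the maximal nesting depth of $\rightarrow$, negation counting as an implication. $\mathrm{THT}^k_m(O_1,\dots)$ is the set of formulas using only temporal modalities among $O_1,\dots$ (with $\mathsf F,\mathsf G$ treated as primitive), of temporal height at most $m$ and implication height at most $k$. $\mathrm{CON}(\mathcal L)$ is the problem of deciding whether a given $\varphi\in\mathcal L$ has an equilibrium model. *)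

(* Defs.v *)
From Stdlib Require Import Arith List Bool.
Import ListNotations.

Inductive form : Type :=
| Atom : nat -> form
| Bot  : form
| Or   : form -> form -> form
| And  : form -> form -> form
| Imp  : form -> form -> form
| Next : form -> form
| Until : form -> form -> form
| Release : form -> form -> form
| Fin  : form -> form
| Glob : form -> form.

Definition Neg (f : form) : form := Imp f Bot.
Definition Top : form := Neg Bot.

(* an LTL interpretation: time point -> atom -> truth value *)
Definition trace := nat -> nat -> bool.

Fixpoint sat (H T : trace) (i : nat) (f : form) {struct f} : Prop :=
  match f with
  | Atom p => H i p = true
  | Bot => False
  | Or a b => sat H T i a \/ sat H T i b
  | And a b => sat H T i a /\ sat H T i b
  | Imp a b => (sat H T i a -> sat H T i b) /\ (sat T T i a -> sat T T i b)
  | Next a => sat H T (S i) a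
  | Until a b => exists j, i <= j /\ sat H T j b /\
                   (forall k, i <= k -> k < j -> sat H T k a)
  | Release a b => forall j, i <= j -> sat H T j b \/
                   (exists k, i <= k /\ k < j /\ sat H T k a)
  | Fin a => exists j, i <= j /\ sat H T j a            (* = Top U a *)
  | Glob a => forall j, i <= j -> sat H T j a           (* = Bot R a *)
  end.

Definition strictly_below (H T : trace) : Prop :=
  (forall i p, H i p = true -> T i p = true) /\ (exists i p, H i p <> T i p).

Definition equilibrium_model (T : trace) (f : form) : Prop :=
  sat T T 0 f /\ forall H, strictly_below H T -> ~ sat H T 0 f.

Definition has_equilibrium_model (f : form) : Prop :=
  exists T, equilibrium_model T f.

Fixpoint temp_height (f : form) : nat :=
  match f with
  | Atom _ | Bot => 0
  | Or a b | And a b | Imp a b => Nat.max (temp_height a) (temp_height b)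
  | Next a | Fin a | Glob a => S (temp_height a)
  | Until a b | Release a b => S (Nat.max (temp_height a) (temp_height b))
  end.

Fixpoint imp_height (f : form) : nat :=
  match f with
  | Atom _ | Bot => 0
  | Imp a b => S (Nat.max (imp_height a) (imp_height b))
  | Or a b | And a b | Until a b | Release a b =>
      Nat.max (imp_height a) (imp_height b)
  | Next a | Fin a | Glob a => imp_height a
  end.

Inductive tempop := OpX | OpU | OpR | OpF | OpG.

Fixpoint uses_only (allowed : tempop -> bool) (f : form) : Prop :=
  match f with
  | Atom _ | Bot => True
  | Or a b | And a b | Imp a b => uses_only allowed a /\ uses_only allowed b
  | Next a => allowed OpX = true /\ uses_only allowed a
  | Until a b => allowed OpU = true /\ uses_only allowed a /\ uses_only allowed b
  | Release a b => allowed OpR = true /\ uses_only allowed a /\ uses_only allowed b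
  | Fin a => allowed OpF = true /\ uses_only allowed a
  | Glob a => allowed OpG = true /\ uses_only allowed a
  end.

Definition THT (k m : nat) (allowed : tempop -> bool) (f : form) : Prop :=
  uses_only allowed f /\ temp_height f <= m /\ imp_height f <= k.

Definition ops_FG (o : tempop) : bool :=
  match o with OpF | OpG => true | _ => false end.
Definition ops_U (o : tempop) : bool :=
  match o with OpU => true | _ => false end.
Definition ops_R (o : tempop) : bool :=
  match o with OpR => true | _ => false end.

Definition enc_nat (n : nat) : list bool :=
  flat_map (fun k => [true; Nat.testbit n k]) (seq 0 (S (Nat.log2 n))) ++ [false].

Fixpoint enc (f : form) : list bool :=
  match f with
  | Atom p => [false;false;false;false] ++ enc_nat p
  | Bot => [false;false;false;true]
  | Or a b => [false;false;true;false] ++ enc a ++ enc b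
  | And a b => [false;false;true;true] ++ enc a ++ enc b
  | Imp a b => [false;true;false;false] ++ enc a ++ enc b
  | Next a => [false;true;false;true] ++ enc a
  | Until a b => [false;true;true;false] ++ enc a ++ enc b
  | Release a b => [false;true;true;true] ++ enc a ++ enc b
  | Fin a => [true;false;false;false] ++ enc a
  | Glob a => [true;false;false;true] ++ enc a
  end.

Definition CON (frag : form -> Prop) (w : list bool) : Prop :=
  exists f, w = enc f /\ frag f /\ has_equilibrium_model f.

(* tape symbols: 0 = blank, 1 = bit false, 2 = bit true *)
Inductive dir := DL | DR | DS.

Record TM := mkTM {
  tm_delta : list (nat * nat * nat * nat * dir);
    (* (state, read symbol, new state, written symbol, move) *)
  tm_start : nat;
  tm_accept : nat }.

Record config := mkConfig { c_state : nat; c_head : nat; c_tape : nat -> nat }.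

Definition sym (b : bool) : nat := if b then 2 else 1.

Definition init (M : TM) (w : list bool) : config :=
  mkConfig (tm_start M) 0 (fun k => nth k (map sym w) 0).

Definition move (d : dir) (h : nat) : nat :=
  match d with DL => pred h | DR => S h | DS => h end.

Definition apply_trans (c : config) (q' a' : nat) (d : dir) : config :=
  mkConfig q' (move d (c_head c))
    (fun k => if Nat.eqb k (c_head c) then a' else c_tape c k).

Definition nstep (M : TM) (c c' : config) : Prop :=
  exists q a q' a' d, In (q, a, q', a', d) (tm_delta M) /\
    c_state c = q /\ c_tape c (c_head c) = a /\ c' = apply_trans c q' a' d.

Inductive nreach (M : TM) : nat -> config -> config -> Prop :=
| nreach0 c : nreach M 0 c c
| nreachS n c c1 c2 : nstep M c c1 -> nreach M n c1 c2 -> nreach M (S n) c c2.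

Definition accepts_within (M : TM) (w : list bool) (t : nat) : Prop :=
  exists n c, n <= t /\ nreach M n (init M w) c /\ c_state c = tm_accept M.

Definition dstep (M : TM) (c : config) : option config :=
  match find (fun tr => match tr with (q, a, _, _, _) =>
                 Nat.eqb q (c_state c) && Nat.eqb a (c_tape c (c_head c)) end)
             (tm_delta M) with
  | Some (_, _, q', a', d) => Some (apply_trans c q' a' d)
  | None => None
  end.

Fixpoint drun (M : TM) (n : nat) (c : config) : option config :=
  match dstep M c with
  | None => Some c
  | Some c' => match n with 0 => None | S n' => drun M n' c' end
  end.

Definition tape_holds (c : config) (u : list bool) : Prop :=
  (forall k, k < length u -> c_tape c k = sym (nth k u false)) /\
  c_tape c (length u) = 0.

Definition poly_time_computable (f : list bool -> list bool) : Prop :=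
  exists (M : TM) (e : nat), forall w, exists c,
    drun M (length w ^ e + e) (init M w) = Some c /\ tape_holds c (f w).

Definition NEXPTIME (L : list bool -> Prop) : Prop :=
  exists (M : TM) (e : nat), forall w,
    L w <-> accepts_within M w (2 ^ (length w ^ e + e)).

Definition NEXPTIME_hard (L : list bool -> Prop) : Prop :=
  forall L', NEXPTIME L' ->
    exists f, poly_time_computable f /\ forall w, L' w <-> L (f w).

(* Main.v *)
(** Saturation turns the minimality of an equilibrium model into a universal quantifier.  All
    "guess" atoms and an atom [tru] hold everywhere in T, and [tru] at 0 forces all of them in H;
    so a model H strictly below T contains no [tru] and, [tru] then playing the role of falsity,
    it is a consistent global guess of two records.  The formula is satisfied by such an H exactly
    when the guess exhibits a defect: no position of T carries the guessed address, or two positions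
    carry the two guessed records and these are incompatible.  Hence an equilibrium model exists iff
    some set of records covers all addresses and is pairwise compatible.

    The records describe a space-time diagram: an address is a time and a tape cell, both below 2^N,
    and compatibility of all pairs says that the contents follow the transitions of a given machine
    started on w and accepting at time 2^N.  Atoms carry numbers k + 2^(c+i) whose encoding is a
    constant, i repetitions of one block, and a constant, so that a single-tape machine can print
    the formula with loops over an array holding w and N further cells. *)
From Stdlib Require Import Arith List Bool Lia Classical FunctionalExtensionality.
Require Import Defs.
Import ListNotations.

(** * Saturated formulas *)

(** The two height bounds shape the construction. With temporal height one, no modality can look
    from one position at another; positions are compared through guesses that are constant along the
    trace and can therefore be read at position 0. With implication height two, the eventuality used
    here already spends both levels, so labels must be free of implications: every record variable
    has an atom for each polarity, and truth and falsity are positive formulas. For the same reason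
    increment carries are stored in the records, which makes a successor test positive. Implications
    into [tru] are the right connective: in T their conclusion holds, so their T-half is trivial and
    H alone decides them, classically. U cannot say always, and in the R-fragment a negated release
    speaks about T only; the atom [fin] bounds the relevant part of the trace there, and H must be
    kept from dropping it. The printing machine adds one more constraint: an input symbol belongs to
    a fixed cell address, but a loop over an array cannot print the binary digits of its index.
    Hence the one-hot flags, which are defined by shifting from each cell to its right neighbour. *)

Definition conjs (l : list form) (z : form) : form := fold_right And z l.
Definition disjs (l : list form) (z : form) : form := fold_right Or z l.

Lemma sat_conj H T i l z :
  sat H T i (conjs l z) <-> (forall f, In f l -> sat H T i f) /\ sat H T i z.
Proof.
  induction l as [|a l IH]; simpl; [tauto|].
  rewrite IH. firstorder (subst; auto).
Qed.

Lemma sat_conj_map {A} H T i (F : A -> form) l z :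
  sat H T i (conjs (map F l) z) <-> (forall x, In x l -> sat H T i (F x)) /\ sat H T i z.
Proof.
  rewrite sat_conj. split; intros [K L]; split; auto.
  - intros x Hx; apply K, in_map, Hx.
  - intros f Hf; apply in_map_iff in Hf as (x & <- & Hx); auto.
Qed.

Inductive mode := ModeFG | ModeU | ModeR.

Definition ops (md : mode) : tempop -> bool :=
  match md with ModeFG => ops_FG | ModeU => ops_U | ModeR => ops_R end.

(* [tru] is the saturation atom, whose absence from H plays the role of falsity;
   [fin] marks the end of the relevant part of the trace in the U- and R-fragments. *)
Definition tru : form := Atom 6.
Definition fin : form := Atom 7.

Definition box (md : mode) (a : form) : form :=
  match md with
  | ModeFG => Glob a
  | ModeU => Until a fin
  | ModeR => Release fin a
  end.

(* Forces "[tru] somewhere in the relevant part implies [tru] at 0", and in the R-fragment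
   also the existence of [fin] in T and its stability under shrinking. *)
Definition aux (md : mode) : form :=
  match md with
  | ModeFG => Imp (Fin tru) tru
  | ModeU => Imp (Until Top tru) tru
  | ModeR => And (Imp (Release tru (Imp fin tru)) tru)
              (And (Neg (Release Bot (Neg fin))) (Release fin (Or fin (Neg fin))))
  end.

(* Atom 8x + r is, for r = 0, 1, the record variable x or its negation; for r = 2, 3 and r = 4, 5,
   the same for its guessed value in the first and in the second copy. *)
Definition ext (b : bool) (x : nat) : form := Atom (8 * x + (if b then 0 else 1)).
Definition gs (c b : bool) (x : nat) : form :=
  Atom (8 * x + (if c then 4 else 2) + (if b then 0 else 1)).

(** A truth constant without implication, unlike [Top]: labels stand below two further implications.
    It holds because some value of [x] is always guessed. *)
Definition tt_at (x : nat) : form := Or (gs false true x) (gs false false x).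

Definition same_lit (c : bool) (x : nat) : form :=
  Or (And (ext true x) (gs c true x)) (And (ext false x) (gs c false x)).

Definition label (c : bool) (E : list nat) (x0 : nat) : form :=
  conjs (map (same_lit c) E) (tt_at x0).

Definition all_guess (x : nat) : form :=
  And (And (gs false true x) (gs false false x)) (And (gs true true x) (gs true false x)).

(** The negation excludes in T that both literals hold. The disjunction must hold in H as well,
    which keeps H from dropping the literal that T has. *)
Definition ext_total (x : nat) : form :=
  And (Or (ext true x) (ext false x)) (Neg (And (ext true x) (ext false x))).

(** Exclusion is phrased with [tru] instead of a negation, because T contains both values of every
    guess. *)
Definition guess_excl (x : nat) : form :=
  And (Imp (And (gs false true x) (gs false false x)) tru)
      (Imp (And (gs true true x) (gs true false x)) tru).

(** The disjunctions stand outside the boxes, so that a guess has one value along the whole relevant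
    trace. *)
Definition guess_total (md : mode) (x : nat) : form :=
  And (Or (box md (gs false true x)) (box md (gs false false x)))
      (Or (box md (gs true true x)) (box md (gs true false x))).

(** [Imp (box md (Imp label tru)) tru] is an eventuality by double negation relative to [tru],
    available in all three fragments. The disjunct [tru] is what T satisfies. Compatibility is
    tested at position 0, which suffices as guesses are constant. *)
Definition violation (md : mode) (E Ad : list nat) (x0 : nat) (good : form) : form :=
  Or tru
    (Or (box md (Imp (label false Ad x0) tru))
        (And (Imp (box md (Imp (label false E x0) tru)) tru)
             (And (Imp (box md (Imp (label true E x0) tru)) tru)
                  (Imp good tru)))).

(** [Neg (Neg tru)] speaks about T only: it puts [tru] at 0 of T and leaves H free to drop it.
    [Imp tru tru] is merely a true formula that closes a conjunction. *)
Definition Phi (md : mode) (E Ad : list nat) (x0 : nat) (good : form) : form :=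
  And (aux md)
  (And (Neg (Neg tru))
  (And (Imp tru (box md (conjs (map all_guess E) tru)))
  (And (box md (conjs (map ext_total E) (Imp tru tru)))
  (And (box md (conjs (map guess_excl E) (Imp tru tru)))
  (conjs (map (guess_total md) E) (violation md E Ad x0 good)))))).

(** * Classical evaluation of formulas over saturated atoms *)

Fixpoint pure (Q : nat -> Prop) (f : form) : Prop :=
  match f with
  | Atom a => Q a
  | And a b | Or a b | Imp a b => pure Q a /\ pure Q b
  | _ => False
  end.

Fixpoint pev (v : nat -> Prop) (f : form) : Prop :=
  match f with
  | Atom a => v a
  | And a b => pev v a /\ pev v b
  | Or a b => pev v a \/ pev v b
  | Imp a b => pev v a -> pev v b
  | _ => False
  end.

Lemma sat_pure_top (Q : nat -> Prop) H T i f :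
  pure Q f -> (forall a, Q a -> H i a = true) -> (forall a, Q a -> T i a = true) ->
  sat H T i f.
Proof.
  revert H. induction f; simpl; intros H P HH HT; try tauto; auto.
  - left; apply IHf1; tauto.
  - destruct P; split; auto.
  - destruct P; split; auto.
Qed.

(** A formula without [Bot] cannot fail where all its atoms hold, so saturation of T makes the
    T-half of every implication true; what remains is the classical reading in H. *)
Lemma sat_pure (Q : nat -> Prop) H T i f :
  pure Q f -> (forall a, Q a -> T i a = true) ->
  (sat H T i f <-> pev (fun a => H i a = true) f).
Proof.
  induction f; simpl; intros P HT; try tauto.
  destruct P as [P1 P2]; rewrite IHf1, IHf2 by auto.
  assert (sat T T i f2) by (eapply sat_pure_top; eauto). tauto.
Qed.

Lemma pev_ext (Q v w : nat -> Prop) f :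
  pure Q f -> (forall a, Q a -> (v a <-> w a)) -> (pev v f <-> pev w f).
Proof.
  induction f; simpl; intros P E; try tauto; auto;
    destruct P; rewrite IHf1, IHf2 by auto; tauto.
Qed.

(** * The relevant part of a trace *)

Definition region (md : mode) (T : trace) (i : nat) : Prop :=
  match md with
  | ModeFG => True
  | ModeU => forall k, k <= i -> T k 7 = false
  | ModeR => forall k, k < i -> T k 7 = false
  end.

Lemma least_true (P : nat -> bool) j :
  P j = true -> exists l, P l = true /\ forall k, k < l -> P k = false.
Proof.
  induction j as [j IH] using lt_wf_ind; intros Hj.
  destruct (classic (exists k, k < j /\ P k = true)) as [(k & Hk & Pk)|N].
  - eauto.
  - exists j; split; auto. intros k Hk. destruct (P k) eqn:E; auto.
    exfalso; apply N; eauto.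
Qed.

(** The first [fin] decides: U covers the positions strictly before it, R covers that position too.
    U in addition demands that [fin] exists, whereas [Release fin a] without any [fin] is an
    unbounded always. *)
Lemma sat_box md H T a :
  (forall i, H i 7 = T i 7) -> (md = ModeU -> exists i, T i 7 = true) ->
  (sat H T 0 (box md a) <-> forall i, region md T i -> sat H T i a).
Proof.
  intros E X. destruct md; simpl.
  - split; intros K i; auto with arith.
  - split.
    + intros (j & _ & Ej & K) i R. apply K; [lia|].
      destruct (le_lt_dec j i) as [L|L]; auto.
      rewrite E, (R j L) in Ej; discriminate.
    + intros K. destruct (X eq_refl) as [j Hj].
      destruct (least_true (fun i => T i 7) j Hj) as (l & Hl & Ml).
      exists l; repeat split; [lia|rewrite E; auto|].
      intros k _ Hk; apply K; intros; apply Ml; lia.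
  - split.
    + intros K i R. destruct (K i (Nat.le_0_l _)) as [L|(k & _ & Hk & Ek)]; auto.
      rewrite E, R in Ek by auto; discriminate.
    + intros K j _. destruct (classic (exists k, k < j /\ T k 7 = true)) as [(k & Hk & Ek)|N].
      * right; exists k; rewrite E; auto with arith.
      * left; apply K; intros k Hk. destruct (T k 7) eqn:Ek; auto. exfalso; eauto.
Qed.

Lemma fin_exists md T a :
  sat T T 0 (aux md) -> sat T T 0 (box md a) -> md <> ModeFG -> exists i, T i 7 = true.
Proof.
  destruct md; simpl; intros A B C; try congruence.
  - destruct B as (j & _ & Ej & _); eauto.
  - apply NNPP; intros N. apply (proj1 (proj1 (proj2 A))).
    intros j _; left. split; intros; apply N; eauto.
Qed.

(** * Smaller interpretations given by two guessed records *)

Definition guess (v1 v2 : nat -> bool) (a : nat) : bool :=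
  match a mod 8 with
  | 0 | 1 | 7 => true
  | 2 => v1 (a / 8)
  | 3 => negb (v1 (a / 8))
  | 4 => v2 (a / 8)
  | 5 => negb (v2 (a / 8))
  | _ => false
  end.

Definition gval (v1 v2 : nat -> bool) (a : nat) : Prop := guess v1 v2 a = true.

Lemma mod8 x r : r < 8 -> (8 * x + r) mod 8 = r.
Proof. intros. symmetry; apply Nat.mod_unique with x; lia. Qed.
Lemma div8 x r : r < 8 -> (8 * x + r) / 8 = x.
Proof. intros. symmetry; apply Nat.div_unique with r; lia. Qed.

Lemma guess_ext v1 v2 (b : bool) x : guess v1 v2 (8 * x + (if b then 0 else 1)) = true.
Proof. unfold guess. rewrite mod8 by (destruct b; lia). destruct b; auto. Qed.

Lemma guess_gs v1 v2 (c b : bool) (x : nat) :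
  guess v1 v2 (8 * x + (if c then 4 else 2) + (if b then 0 else 1))
  = Bool.eqb b ((if c then v2 else v1) x).
Proof.
  unfold guess. rewrite <- Nat.add_assoc, mod8, div8 by (destruct b, c; lia).
  destruct b, c; simpl; try destruct (v1 x); try destruct (v2 x); auto.
Qed.

Lemma guess_tru v1 v2 : guess v1 v2 6 = false.
Proof. reflexivity. Qed.

Definition guess_atom (E : list nat) (a : nat) : Prop :=
  a = 6 \/ exists (x : nat) (c b : bool), In x E /\ a = 8 * x + (if c then 4 else 2) + (if b then 0 else 1).

(** Pairs are ordered and may be diagonal, so conditions on a single record can be part of
    [good]. *)
Definition realizable (E Ad : list nat) (good : form) (S : (nat -> bool) -> Prop) : Prop :=
  (forall s1 s2, S s1 -> S s2 -> pev (gval s1 s2) good) /\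
  (forall v, exists s, S s /\ forall x, In x Ad -> s x = v x).

(** Without [tru] in H the antecedents in [aux] fail: this is immediate for F and U, and the release
    is refuted at a position of [fin], which H keeps. The other conjuncts for R depend on [fin]
    alone. *)
Lemma aux_shrink md H T :
  (forall i, H i 7 = T i 7) -> (forall i, H i 6 = false) -> T 0 6 = true ->
  (md <> ModeFG -> exists i, T i 7 = true) -> sat T T 0 (aux md) -> sat H T 0 (aux md).
Proof.
  intros Hf Ht Tt Tf SA. destruct md.
  - destruct SA as [_ SA]. simpl in *; split; auto.
    intros (j & _ & K). rewrite Ht in K; discriminate.
  - destruct SA as [_ SA]. simpl in *; split; auto.
    intros (j & _ & K & _). rewrite Ht in K; discriminate.
  - destruct SA as (A1 & A2 & A3). split; [|split].
    + cbn [sat tru] in *. split; [|auto]. intros K.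
      destruct (Tf ltac:(discriminate)) as [j Hj].
      destruct (K j (Nat.le_0_l _)) as [[L _]|(k & _ & _ & L)].
      * simpl in L. rewrite Ht in L. rewrite Hf in L; auto. discriminate (L Hj).
      * rewrite Ht in L; discriminate.
    + cbn [sat Neg fin] in *. destruct A2 as [_ A2]; split; auto.
      intros K; apply A2; intros j Hj. destruct (K j Hj) as [[L1 L2]|(k & _ & _ & [])].
      left; split; auto.
    + cbn [sat Neg fin] in *. intros j Hj. rewrite !Hf.
      destruct (A3 j Hj) as [[L|L]|(k & L1 & L2 & L3)]; [auto| |].
      * left; right. tauto.
      * right; exists k. rewrite Hf; auto.
Qed.

(** * From an equilibrium model to compatible records *)

Section Soundness.
Context (md : mode) (E Ad : list nat) (x0 : nat) (good : form) (T : trace).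
Context (HE : In x0 E) (HAd : incl Ad E) (Hgood : pure (guess_atom E) good).
Context (HT : equilibrium_model T (Phi md E Ad x0 good)).

Let H (v1 v2 : nat -> bool) : trace := fun i a => T i a && guess v1 v2 a.

Lemma shrink_below v1 v2 : strictly_below (H v1 v2) T.
Proof.
  destruct HT as [S _]. unfold Phi in S. destruct S as (_ & [N _] & _).
  simpl in N. split.
  - unfold H; intros i p K; apply andb_true_iff in K; tauto.
  - exists 0, 6. unfold H. rewrite guess_tru, andb_false_r.
    destruct (T 0 6); [discriminate|]. exfalso; apply N; split; discriminate.
Qed.

Lemma T_fin : md <> ModeFG -> exists i, T i 7 = true.
Proof.
  destruct HT as [S _]. destruct S as (A & _ & _ & B & _).
  eapply fin_exists; eauto.
Qed.

Lemma H_fin v1 v2 i : H v1 v2 i 7 = T i 7.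
Proof. unfold H. change (guess v1 v2 7) with true. apply andb_true_r. Qed.

Lemma T_tru : T 0 6 = true.
Proof.
  destruct HT as [S _]. destruct S as (_ & [N _] & _). simpl in N.
  destruct (T 0 6); auto. exfalso; apply N; split; discriminate.
Qed.

Lemma box_T a : sat T T 0 (box md a) <-> forall i, region md T i -> sat T T i a.
Proof. apply sat_box; auto. intros Em; apply T_fin; rewrite Em; discriminate. Qed.

Lemma box_H v1 v2 a :
  sat (H v1 v2) T 0 (box md a) <-> forall i, region md T i -> sat (H v1 v2) T i a.
Proof. apply sat_box; [apply H_fin|]. intros Em; apply T_fin; rewrite Em; discriminate. Qed.

Lemma T_guess i a : region md T i -> guess_atom E a -> T i a = true.
Proof.
  intros R Ga. pose proof T_tru as Tt. destruct HT as [S _].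
  destruct S as (_ & _ & [_ S] & _). specialize (S Tt).
  rewrite box_T in S. specialize (S i R). rewrite sat_conj_map in S.
  destruct S as [S1 S2]. destruct Ga as [->|(x & c & b & Hx & ->)]; [exact S2|].
  specialize (S1 x Hx). simpl in S1. destruct c, b; tauto.
Qed.

Lemma H_tru v1 v2 i : H v1 v2 i 6 = false.
Proof. unfold H. rewrite guess_tru. apply andb_false_r. Qed.

Lemma H_gs v1 v2 i c b x : region md T i -> In x E ->
  (sat (H v1 v2) T i (gs c b x) <-> (if c then v2 else v1) x = b).
Proof.
  intros R Hx. unfold gs, H; cbn [sat].
  rewrite T_guess by (auto; right; eauto).
  rewrite guess_gs, andb_true_l, eqb_true_iff. intuition.
Qed.

Lemma T_ext i x : region md T i -> In x E ->
  T i (8 * x + 0) = negb (T i (8 * x + 1)).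
Proof.
  intros R Hx. destruct HT as [S _]. destruct S as (_ & _ & _ & S & _).
  rewrite box_T in S. specialize (S i R). rewrite sat_conj_map in S.
  destruct S as [S _]. specialize (S x Hx).
  cbn [ext_total ext sat Neg] in S. destruct S as [A [B _]].
  destruct (T i (8 * x + 0)), (T i (8 * x + 1)); auto; [exfalso; auto|].
  destruct A; congruence.
Qed.

Lemma H_ext v1 v2 i b x : region md T i -> In x E ->
  (sat (H v1 v2) T i (ext b x) <-> T i (8 * x + 0) = b).
Proof.
  intros R Hx. cbn [ext sat]. unfold H. rewrite guess_ext, andb_true_r.
  pose proof (T_ext i x R Hx).
  destruct b, (T i (8 * x + 0)), (T i (8 * x + 1)); simpl in *; intuition congruence.
Qed.

Lemma H_same_lit v1 v2 i c x : region md T i -> In x E ->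
  (sat (H v1 v2) T i (same_lit c x) <-> T i (8 * x + 0) = (if c then v2 else v1) x).
Proof.
  intros R Hx. unfold same_lit. cbn [sat].
  rewrite !H_ext, !H_gs by auto.
  destruct (T i (8 * x + 0)), ((if c then v2 else v1) x); intuition congruence.
Qed.

Lemma H_tt v1 v2 i : region md T i -> sat (H v1 v2) T i (tt_at x0).
Proof.
  intros R. cbn [sat tt_at]. rewrite !H_gs by auto. destruct (v1 x0); auto.
Qed.

Lemma H_label v1 v2 i (c : bool) F : region md T i -> incl F E ->
  (sat (H v1 v2) T i (label c F x0) <->
   forall x, In x F -> T i (8 * x + 0) = (if c then v2 else v1) x).
Proof.
  intros R HF. unfold label. rewrite sat_conj_map. pose proof (H_tt v1 v2 i R).
  split.
  - intros [K _] x Hx. apply H_same_lit with (v1 := v1) (v2 := v2); auto.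
  - intros K; split; auto. intros x Hx. apply H_same_lit; auto.
Qed.

(** Each such H lies strictly below T and satisfies every other conjunct of [Phi], so minimality of
    T must show in this one. *)
Lemma H_violation v1 v2 : ~ sat (H v1 v2) T 0 (violation md E Ad x0 good).
Proof.
  intros V. destruct HT as [S M]. apply (M (H v1 v2) (shrink_below v1 v2)).
  pose proof T_tru as Tt. pose proof (H_tru v1 v2) as Ht.
  destruct S as (SA & SN & SS & SE & SX & SG).
  assert (HT' : forall i a, H v1 v2 i a = true -> T i a = true)
    by (unfold H; intros i a K; apply andb_true_iff in K; tauto).
  split; [|split; [|split; [|split; [|split]]]].
  - apply aux_shrink; [apply H_fin|exact Ht|exact Tt|exact T_fin|exact SA].
  - split; intros [_ K]; apply K; exact Tt.
  - destruct SS as [_ SS]; split; auto. simpl; rewrite Ht; discriminate.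
  - rewrite box_H. intros i R. apply sat_conj_map; split; [|split; simpl; auto].
    intros x Hx. cbn [ext_total sat Neg]. rewrite !H_ext by auto.
    rewrite box_T in SE. specialize (SE i R). rewrite sat_conj_map in SE.
    destruct SE as [SE _]. specialize (SE x Hx).
    cbn [ext_total sat Neg] in SE. destruct SE as [A B].
    repeat split; [destruct (T i (8 * x + 0)); auto| |tauto].
    intros []; congruence.
  - rewrite box_H. intros i R. apply sat_conj_map; split; [|split; simpl; auto].
    intros x Hx. rewrite box_T in SX. specialize (SX i R). rewrite sat_conj_map in SX.
    destruct SX as [SX _]. specialize (SX x Hx).
    unfold guess_excl in *. cbn [sat] in *. rewrite !H_gs by auto.
    destruct SX as [[_ X1] [_ X2]].
    repeat split; auto; intros []; congruence.
  - apply sat_conj_map; split; auto.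
    intros x Hx. unfold guess_total. cbn [sat]. rewrite !box_H.
    split; [destruct (v1 x) eqn:V1|destruct (v2 x) eqn:V2];
      [left|right|left|right]; intros i R; rewrite H_gs; auto.
Qed.

Definition labels (s : nat -> bool) : Prop :=
  exists i, region md T i /\ forall x, s x = T i (8 * x + 0).

(** An uncovered address makes the second disjunct of [violation] true. That disjunct reads only the
    first copy, so the second may be guessed alike. *)
Lemma covered v : exists s, labels s /\ forall x, In x Ad -> s x = v x.
Proof.
  apply NNPP; intros N. apply (H_violation v v). right; left.
  apply box_H. intros i R. split.
  - intros K. exfalso; apply N. rewrite H_label in K by auto.
    exists (fun x => T i (8 * x + 0)); split; auto. exists i; auto.
  - intros _. apply (T_guess i 6 R). left; auto.
Qed.

(** In the U-fragment [fin] at 0 would leave no relevant position at all; coverage provides one, and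
    relevance is closed downwards. *)
Lemma region_0 : region md T 0.
Proof.
  destruct (covered (fun _ => true)) as (s & (i & R & _) & _).
  destruct md; simpl in *; auto.
  - intros k Hk; apply R; lia.
  - intros k Hk; lia.
Qed.

(** Guess exactly the two records: both eventualities then hold, so a failure of [good] would
    satisfy the last disjunct of [violation]. *)
Lemma labels_good s1 s2 : labels s1 -> labels s2 -> pev (gval s1 s2) good.
Proof.
  intros (i & Ri & Ei) (j & Rj & Ej). apply NNPP; intros N.
  apply (H_violation s1 s2). right; right.
  pose proof T_tru as Tt.
  assert (L : forall (c : bool) k, region md T k -> (forall x, (if c then s2 else s1) x = T k (8 * x + 0)) ->
    sat (H s1 s2) T 0 (Imp (box md (Imp (label c E x0) tru)) tru)).
  { intros c k R K; split; [|intros _; exact Tt].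
    rewrite box_H. intros B. destruct (B k R) as [B1 _].
    exfalso. assert (sat (H s1 s2) T k tru) as C.
    { apply B1, H_label; [auto|apply incl_refl|]. intros x _; symmetry; auto. }
    simpl in C. rewrite H_tru in C; discriminate. }
  split; [apply (L false i); auto|split; [apply (L true j); auto|]].
  split; [|intros _; exact Tt]. intros K. exfalso; apply N.
  rewrite (sat_pure (guess_atom E)) in K; auto.
  - revert K. apply (pev_ext (guess_atom E)); auto.
    intros a Ga. unfold gval, H. rewrite T_guess by (auto; apply region_0). reflexivity.
  - intros a Ga; apply T_guess; auto. apply region_0.
Qed.

Lemma Phi_sound : exists S, realizable E Ad good S.
Proof. exists labels; split; [apply labels_good|apply covered]. Qed.
End Soundness.

(** * From a finite set of compatible records to an equilibrium model *)

Section Completeness.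
Context (md : mode) (E Ad : list nat) (x0 : nat) (good : form) (S : list (nat -> bool)).
Context (HE : In x0 E) (HAd : incl Ad E) (Hgood : pure (guess_atom E) good).
Context (HS : realizable E Ad good (fun s => In s S)).

Definition live (i : nat) : bool :=
  match md with ModeFG => true | _ => i <? length S end.

(** The off-by-one mirrors [region]: U stops before [fin] and R includes it, so in both fragments
    exactly the positions below [length S] are relevant. *)
Definition end_at (i : nat) : bool :=
  match md with
  | ModeFG => false
  | ModeU => i =? length S
  | ModeR => i =? length S - 1
  end.

(** In the FG-fragment all positions are relevant; those beyond the list repeat its first record and
    thus add no new label. *)
Definition lab (i : nat) : nat -> bool := nth i S (nth 0 S (fun _ => false)).

(* Beyond the live part of the trace no atom may hold: the formula says nothing there, so
   any atom could be dropped from H. *)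
Definition witness : trace := fun i a =>
  let x := a / 8 in
  let inE := existsb (Nat.eqb x) E in
  match a mod 8 with
  | 0 => live i && inE && lab i x
  | 1 => live i && inE && negb (lab i x)
  | 6 => live i && (x =? 0)
  | 7 => end_at i && (x =? 0)
  | _ => live i && inE
  end.

Lemma in_existsb x : existsb (Nat.eqb x) E = true <-> In x E.
Proof.
  rewrite existsb_exists. split.
  - intros (y & Hy & K). apply Nat.eqb_eq in K; subst; auto.
  - intros; exists x; split; auto. apply Nat.eqb_refl.
Qed.

Lemma S_nonempty : 0 < length S.
Proof.
  destruct HS as [_ C]. destruct (C (fun _ => true)) as (s & Hs & _).
  destruct S; [destruct Hs|simpl; lia].
Qed.

Lemma lab_in i : In (lab i) S.
Proof.
  unfold lab. destruct (le_lt_dec (length S) i).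
  - rewrite nth_overflow by auto. apply nth_In, S_nonempty.
  - apply nth_In; auto.
Qed.

Lemma witness_ext i (b : bool) x : In x E ->
  witness i (8 * x + (if b then 0 else 1)) = live i && Bool.eqb (lab i x) b.
Proof.
  intros Hx. apply in_existsb in Hx. unfold witness.
  rewrite mod8, div8, Hx by (destruct b; lia).
  destruct b, (live i), (lab i x); auto.
Qed.

Lemma witness_guess i a : live i = true -> guess_atom E a -> witness i a = true.
Proof.
  intros L [->|(x & c & b & Hx & ->)]; unfold witness.
  - simpl; rewrite L; auto.
  - apply in_existsb in Hx. rewrite <- Nat.add_assoc, mod8, div8, Hx, L by (destruct c, b; lia).
    destruct c, b; auto.
Qed.

Lemma witness_fin i : witness i 7 = end_at i.
Proof. unfold witness; simpl. apply andb_true_r. Qed.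

Lemma region_live i : region md witness i <-> live i = true.
Proof.
  pose proof S_nonempty. unfold region, live. pose proof witness_fin as W.
  unfold end_at in W. destruct md; [tauto| |].
  - rewrite Nat.ltb_lt. split.
    + intros K. destruct (le_lt_dec (length S) i) as [L|]; auto.
      specialize (K _ L). rewrite W, Nat.eqb_refl in K; discriminate.
    + intros L k Hk. rewrite W. apply Nat.eqb_neq; lia.
  - rewrite Nat.ltb_lt. split.
    + intros K. destruct (le_lt_dec (length S) i) as [L|]; auto.
      specialize (K (length S - 1)). rewrite W, Nat.eqb_refl in K.
      discriminate K; lia.
    + intros L k Hk. rewrite W. apply Nat.eqb_neq; lia.
Qed.

Lemma live_0 : live 0 = true.
Proof. unfold live. destruct md; auto; apply Nat.ltb_lt, S_nonempty. Qed.

Lemma end_exists : md <> ModeFG -> exists i, end_at i = true.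
Proof.
  unfold end_at. destruct md; [congruence| |]; intros _.
  - exists (length S). apply Nat.eqb_refl.
  - exists (length S - 1). apply Nat.eqb_refl.
Qed.

Lemma end_unique i j : end_at i = true -> end_at j = true -> i = j.
Proof.
  unfold end_at. destruct md; [discriminate| |]; rewrite !Nat.eqb_eq; congruence.
Qed.

(** T has at most one [fin]. For U, any satisfied box forces a [fin] in H, which must be that one;
    for R, excluded middle for [fin] in [aux] forces it, since no earlier [fin] can release this
    demand. *)
Lemma fin_stable H a :
  (forall i p, H i p = true -> witness i p = true) ->
  sat H witness 0 (aux md) -> sat H witness 0 (box md a) ->
  forall i, H i 7 = witness i 7.
Proof.
  intros HH A B i. rewrite witness_fin.
  destruct (end_at i) eqn:Ei.
  2: { destruct (H i 7) eqn:Hi; auto. apply HH in Hi. rewrite witness_fin in Hi; congruence. }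
  pose proof end_unique as U. pose proof witness_fin as W.
  unfold end_at in Ei, U, W. destruct md; [discriminate| |].
  - destruct B as (j & _ & Hj & _). cbn [fin sat] in Hj.
    pose proof (HH _ _ Hj) as Wj. rewrite W in Wj. rewrite (U i j); auto.
  - destruct A as (_ & _ & A). cbn [sat Neg fin] in A.
    destruct (A i (Nat.le_0_l _)) as [[K|[_ K]]|(k & _ & Hk & K)]; auto.
    + rewrite W in K. congruence.
    + apply HH in K. rewrite W in K. rewrite (U k i) in Hk; auto. lia.
Qed.

(** A single [tru] at a live position satisfies the antecedent in [aux] and so brings [tru] to 0.
    For R this works because a live position is never after the only [fin]. *)
Lemma tru_free H :
  (forall i p, H i p = true -> witness i p = true) ->
  (forall i, H i 7 = witness i 7) ->
  sat H witness 0 (aux md) -> H 0 6 = false ->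
  forall i, live i = true -> H i 6 = false.
Proof.
  intros HH Hf A H0 i L. destruct (H i 6) eqn:K; auto. exfalso.
  pose proof witness_fin as W. unfold end_at, live in *.
  destruct md; simpl in A.
  - destruct A as [A _]. rewrite A in H0; [discriminate|]. exists i; split; [lia|auto].
  - destruct A as [A _]. rewrite A in H0; [discriminate|]. exists i; split; [lia|].
    split; auto.
  - destruct A as [[A _] _]. rewrite A in H0; [discriminate|].
    apply Nat.ltb_lt in L.
    intros j _. destruct (le_lt_dec (length S - 1) j) as [Lj|Lj].
    + destruct (Nat.eq_dec j i) as [->|]; [left; auto|].
      right. exists i. repeat split; auto; lia.
    + left. split; intros Hj; [rewrite Hf in Hj|]; rewrite W in Hj;
      apply Nat.eqb_eq in Hj; lia.
Qed.

Lemma witness_box H a :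
  (forall i, H i 7 = witness i 7) ->
  (sat H witness 0 (box md a) <-> forall i, live i = true -> sat H witness i a).
Proof.
  intros Hf. rewrite sat_box; auto.
  - split; intros K i R; apply K, region_live; auto.
  - intros Em. destruct end_exists as [i Hi]; [rewrite Em; discriminate|].
    exists i; rewrite witness_fin; auto.
Qed.

Lemma witness_aux : sat witness witness 0 (aux md).
Proof.
  assert (W0 : witness 0 6 = true) by (apply witness_guess; [apply live_0|left; auto]).
  pose proof end_exists as X. pose proof witness_fin as W.
  unfold end_at in *. destruct md.
  - split; intros _; exact W0.
  - split; intros _; exact W0.
  - split; [split; intros _; exact W0|].
    destruct X as [j Hj]; [discriminate|]. rewrite <- W in Hj.
    split.
    + split; intros K; destruct (K j (Nat.le_0_l _)) as [[_ L]|(k & _ & _ & [])]; apply L; exact Hj.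
    + intros k _. left. cbn [sat fin Neg]. destruct (witness k 7); [left; auto|right].
      split; discriminate.
Qed.

Lemma witness_sat : sat witness witness 0 (Phi md E Ad x0 good).
Proof.
  assert (W0 : witness 0 6 = true) by (apply witness_guess; [apply live_0|left; auto]).
  assert (B := fun a => witness_box witness a (fun i => eq_refl)).
  split; [apply witness_aux|]. split; [|split; [|split; [|split]]].
  - split; intros [K _]; exact (K W0).
  - assert (sat witness witness 0 (box md (conjs (map all_guess E) tru))).
    { apply B. intros i L. apply sat_conj_map. split; [|apply witness_guess; auto; left; auto].
      intros x Hx. cbn [all_guess sat gs].
      repeat split; (apply witness_guess; [auto|right]; exists x).
      - exists false, true; auto.
      - exists false, false; auto.
      - exists true, true; auto.
      - exists true, false; auto. }
    split; auto.
  - apply B. intros i L. apply sat_conj_map. split; [|split; auto].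
    intros x Hx. cbn [ext_total sat ext Neg].
    pose proof (witness_ext i true x Hx) as E1. pose proof (witness_ext i false x Hx) as E2.
    cbn beta iota in E1, E2. rewrite E1, E2, L. destruct (lab i x); simpl; intuition discriminate.
  - apply B. intros i L. apply sat_conj_map. split; [|split; auto].
    assert (witness i 6 = true) by (apply witness_guess; [auto|left; auto]).
    intros x Hx. cbn [guess_excl sat tru]. auto.
  - apply sat_conj_map. split; [|left; exact W0].
    intros x Hx. cbn [guess_total sat]. rewrite !B.
    split; left; intros i L; (apply witness_guess; [auto|right]; exists x).
    + exists false, true; auto.
    + exists true, true; auto.
Qed.

(** By residue class: guesses and [tru] return by saturation, [fin] by hypothesis, and a record
    literal because the disjunction in [ext_total] cannot be met by its complement, which the
    witness lacks. *)
Lemma saturated_eq H :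
  (forall i p, H i p = true -> witness i p = true) ->
  (forall i, H i 7 = witness i 7) ->
  (forall i, live i = true -> sat H witness i (conjs (map all_guess E) tru)) ->
  (forall i, live i = true -> sat H witness i (conjs (map ext_total E) (Imp tru tru))) ->
  forall i p, H i p = witness i p.
Proof.
  intros HH Hf G X i p. destruct (witness i p) eqn:Wp.
  2: { destruct (H i p) eqn:Hp; auto. apply HH in Hp; congruence. }
  pose proof (Nat.div_mod_eq p 8) as Dp.
  assert (Lp : p mod 8 < 8) by (apply Nat.mod_upper_bound; lia).
  assert (Wf := Wp). unfold witness in Wp.
  destruct (live i) eqn:L.
  2: { cbn [andb] in Wp. destruct (p mod 8) as [|[|[|[|[|[|[|[|]]]]]]]] eqn:M; try discriminate; try lia.
       apply andb_true_iff in Wp as [_ K]. apply Nat.eqb_eq in K.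
       assert (p = 7) as -> by lia. rewrite Hf; auto. }
  specialize (G i L). specialize (X i L). rewrite sat_conj_map in G, X.
  destruct G as [G G6]. destruct X as [X _].
  destruct (existsb (Nat.eqb (p / 8)) E) eqn:Ep.
  - pose proof (proj1 (in_existsb _) Ep) as Hx.
    specialize (G _ Hx). specialize (X _ Hx).
    cbn [all_guess ext_total sat gs ext Neg] in G, X.
    set (x := p / 8) in *.
    pose proof (witness_ext i true x Hx) as E1. pose proof (witness_ext i false x Hx) as E2.
    cbn beta iota in E1, E2. rewrite L in E1, E2.
    destruct (p mod 8) as [|[|[|[|[|[|[|[|]]]]]]]] eqn:M; try lia.
    + cbn [andb] in Wp. rewrite Wp in E2. destruct X as [[X|X] _].
      * rewrite <- X. f_equal; lia.
      * apply HH in X. rewrite E2 in X. discriminate.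
    + cbn [andb] in Wp. destruct (lab i x) eqn:Lx; [discriminate|]. destruct X as [[X|X] _].
      * apply HH in X. rewrite E1 in X. discriminate.
      * rewrite <- X. f_equal; lia.
    + rewrite Dp. replace (8 * x + 2) with (8 * x + 2 + 0) by lia. apply G.
    + rewrite Dp. replace (8 * x + 3) with (8 * x + 2 + 1) by lia. apply G.
    + rewrite Dp. replace (8 * x + 4) with (8 * x + 4 + 0) by lia. apply G.
    + rewrite Dp. replace (8 * x + 5) with (8 * x + 4 + 1) by lia. apply G.
    + cbn [andb] in Wp. apply Nat.eqb_eq in Wp. assert (p = 6) as -> by lia. exact G6.
    + apply andb_true_iff in Wp as [_ K]. apply Nat.eqb_eq in K.
      assert (p = 7) as -> by lia. rewrite Hf; auto.
  - destruct (p mod 8) as [|[|[|[|[|[|[|[|]]]]]]]] eqn:M; try discriminate; try lia.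
    + cbn [andb] in Wp. apply Nat.eqb_eq in Wp. assert (p = 6) as -> by lia. exact G6.
    + apply andb_true_iff in Wp as [_ K]. apply Nat.eqb_eq in K.
      assert (p = 7) as -> by lia. rewrite Hf; auto.
Qed.

Lemma witness_minimal H : strictly_below H witness -> ~ sat H witness 0 (Phi md E Ad x0 good).
Proof.
  intros [HH (i0 & p0 & Hne)] (SA & _ & SS & SE & SX & SG).
  assert (Hf := fin_stable H _ HH SA SE).
  assert (B := fun a => witness_box H a Hf).
  assert (WT : forall i, live i = true -> witness i 6 = true)
    by (intros; apply witness_guess; [auto|left; auto]).
  rewrite B in SE, SX.
  (* With [tru] at 0, saturation makes H equal to the witness. *)
  destruct (H 0 6) eqn:H0.
  { apply Hne. apply saturated_eq; auto. apply B, SS, H0. }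
  assert (Ht := tru_free H HH Hf SA H0).
  apply sat_conj_map in SG as [SG SV].
  (* From here on H has no live [tru]. [guess_total] supplies one value along the live trace, and
     [guess_excl] forbids the other one. *)
  assert (Gd : forall (c : bool) x, In x E -> exists v : bool, forall i (b : bool), live i = true ->
            (H i (8 * x + (if c then 4 else 2) + (if b then 0 else 1)) = true <-> v = b)).
  { intros c x Hx. specialize (SG x Hx). cbn [guess_total sat] in SG. rewrite !B in SG.
    assert (K : exists v : bool, forall i, live i = true -> sat H witness i (gs c v x)).
    { destruct SG as [[G|G] [G'|G']]; destruct c; eauto. }
    destruct K as [v K]. exists v. intros i b L. specialize (K i L). cbn [gs sat] in K.
    specialize (SX i L). rewrite sat_conj_map in SX. destruct SX as [SX _].
    specialize (SX x Hx). cbn [guess_excl sat gs tru] in SX. rewrite Ht in SX by auto.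
    destruct SX as [[X1 _] [X2 _]].
    split; [|intros ->; exact K]. intros K'.
    destruct v, b, c; try reflexivity; exfalso;
      first [discriminate (X2 (conj K K')) | discriminate (X1 (conj K K'))
            |discriminate (X2 (conj K' K)) | discriminate (X1 (conj K' K))]. }
  set (v := fun (c : bool) x => H 0 (8 * x + (if c then 4 else 2) + (if true then 0 else 1))).
  assert (Gv : forall (c : bool) x i (b : bool), In x E -> live i = true ->
            (H i (8 * x + (if c then 4 else 2) + (if b then 0 else 1)) = true <-> v c x = b)).
  { intros c x i b Hx L. destruct (Gd c x Hx) as [w Hw].
    assert (v c x = w) as ->; [|apply Hw; auto].
    unfold v. destruct w.
    - apply (Hw 0 true live_0); reflexivity.
    - apply not_true_iff_false. intros K. apply (Hw 0 true live_0) in K; discriminate. }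
  assert (Ex : forall i b x, In x E -> live i = true ->
            (sat H witness i (ext b x) <-> lab i x = b)).
  { intros i b x Hx L. specialize (SE i L). rewrite sat_conj_map in SE. destruct SE as [SE _].
    specialize (SE x Hx). cbn [ext_total ext sat] in *. destruct SE as [SE _].
    pose proof (witness_ext i true x Hx) as E1. pose proof (witness_ext i false x Hx) as E2.
    cbn beta iota in E1, E2. rewrite L in E1, E2.
    pose proof (HH i (8 * x + 0)). pose proof (HH i (8 * x + 1)).
    destruct b, (lab i x), (H i (8 * x + 0)), (H i (8 * x + 1)); simpl in *;
      intuition congruence. }
  assert (Lb : forall i c F, incl F E -> live i = true ->
            (sat H witness i (label c F x0) <-> forall x, In x F -> lab i x = v c x)).
  { intros i c F HF L. unfold label. rewrite sat_conj_map.
    assert (TT : sat H witness i (tt_at x0)).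
    { cbn [tt_at sat gs]. destruct (v false x0) eqn:V;
        [left; apply (Gv false x0 i true)|right; apply (Gv false x0 i false)]; auto. }
    assert (Q : forall x, In x F -> (sat H witness i (same_lit c x) <-> lab i x = v c x)).
    { intros x Hx. unfold same_lit. cbn [sat]. rewrite !Ex by auto.
      unfold gs. cbn [sat]. rewrite (Gv c x i true), (Gv c x i false) by auto. destruct (lab i x), (v c x); intuition congruence. }
    split; [intros [K _] x Hx; apply Q; auto|].
    intros K; split; auto. intros x Hx; apply Q; auto. }
  destruct HS as [HG HC].
  (* If no live label equalled the guess, the box would hold vacuously and yield [tru] at 0. *)
  assert (Fd : forall c, sat H witness 0 (Imp (box md (Imp (label c E x0) tru)) tru) ->
            exists s, In s S /\ forall x, In x E -> s x = v c x).
  { intros c [K _]. apply NNPP; intros N.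
    assert (C : sat H witness 0 tru); [|simpl in C; congruence].
    apply K, B. intros i L. split; [|intros _; apply WT; auto].
    intros K'. exfalso. apply N. exists (lab i). split; [apply lab_in|].
    apply Lb; auto. apply incl_refl. }
  destruct SV as [SV|[SV|(V1 & V2 & V3)]].
  - simpl in SV; congruence.
  (* Some record of [S] has the guessed address, and the box would put [tru] at its position. *)
  - destruct (HC (v false)) as (s & Hs & Ks).
    apply In_nth with (d := nth 0 S (fun _ => false)) in Hs as (i & Li & Es).
    rewrite B in SV.
    assert (L : live i = true) by (unfold live; destruct md; auto; apply Nat.ltb_lt; auto).
    destruct (SV i L) as [K _]. simpl in K. rewrite Ht in K by auto.
    assert (false = true); [|discriminate]. apply K, Lb; auto.
    unfold lab. rewrite Es; auto.
  - destruct (Fd _ V1) as (s1 & I1 & K1). destruct (Fd _ V2) as (s2 & I2 & K2).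
    specialize (HG s1 s2 I1 I2). destruct V3 as [V3 _]. simpl in V3.
    rewrite H0 in V3. assert (false = true); [|discriminate]. apply V3.
    apply (sat_pure (guess_atom E)); auto.
    + intros a; apply witness_guess, live_0.
    + revert HG. apply (pev_ext (guess_atom E)); auto.
      intros a [->|(x & c & b & Hx & ->)].
      * rewrite H0. unfold gval. rewrite guess_tru. tauto.
      * unfold gval. rewrite guess_gs, eqb_true_iff, (Gv c x 0 b) by (auto; apply live_0).
        destruct c; rewrite ?K1, ?K2 by auto; split; congruence.
Qed.

Lemma Phi_complete : has_equilibrium_model (Phi md E Ad x0 good).
Proof. exists witness. split; [apply witness_sat|apply witness_minimal]. Qed.
End Completeness.

(** * Membership of the formula in the fragments *)

Lemma pure_shape Q al f : pure Q f -> uses_only al f /\ temp_height f = 0.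
Proof.
  induction f; simpl; try tauto; intros [P1 P2];
    destruct (IHf1 P1) as [U1 H1], (IHf2 P2) as [U2 H2]; rewrite H1, H2; auto.
Qed.

Lemma THT_And k m al f g : THT k m al f -> THT k m al g -> THT k m al (And f g).
Proof. unfold THT; simpl; intuition; apply Nat.max_lub; auto. Qed.
Lemma THT_Or k m al f g : THT k m al f -> THT k m al g -> THT k m al (Or f g).
Proof. unfold THT; simpl; intuition; apply Nat.max_lub; auto. Qed.
Lemma THT_Imp k m al f g : THT k m al f -> THT k m al g -> THT (S k) m al (Imp f g).
Proof.
  unfold THT; simpl; intuition; [apply Nat.max_lub; auto|apply le_n_S, Nat.max_lub; auto].
Qed.
Lemma THT_Atom k m al a : THT k m al (Atom a).
Proof. unfold THT; simpl; intuition lia. Qed.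
Lemma THT_Bot k m al : THT k m al Bot.
Proof. unfold THT; simpl; intuition lia. Qed.
Lemma THT_conjs {A} k m al (F : A -> form) l z :
  (forall x, THT k m al (F x)) -> THT k m al z -> THT k m al (conjs (map F l) z).
Proof. intros. induction l; simpl; auto using THT_And. Qed.
Lemma THT_box k md a : THT k 0 (ops md) a -> THT k 1 (ops md) (box md a).
Proof.
  intros (U & T & I). destruct md; unfold THT; simpl in *; repeat split; auto; lia.
Qed.
Lemma THT_mono k m k' m' al f : k <= k' -> m <= m' -> THT k m al f -> THT k' m' al f.
Proof. unfold THT; intuition lia. Qed.

(** The budget is exact: labels have implication height 0 and stand below two implications, while
    [good] has height one and stands below one. No box contains another. *)
Lemma THT_Phi md E Ad x0 good Q :
  pure Q good -> imp_height good <= 1 -> THT 2 1 (ops md) (Phi md E Ad x0 good).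
Proof.
  intros P I.
  assert (G : THT 1 1 (ops md) good).
  { destruct (pure_shape Q (ops md) good P) as [U T]. unfold THT; rewrite T; auto. }
  assert (L : forall c F, THT 0 0 (ops md) (label c F x0)).
  { intros. apply THT_conjs; [intros; unfold same_lit, ext, gs|unfold tt_at, gs];
      auto using THT_And, THT_Or, THT_Atom. }
  assert (B : forall k a, k <= 2 -> THT k 0 (ops md) a -> THT 2 1 (ops md) (box md a)).
  { intros k a Hk Ha. eapply THT_mono; [..|apply THT_box, Ha]; auto. }
  assert (At : forall k m a, THT k m (ops md) (Atom a)) by (intros; apply THT_Atom).
  unfold Phi, tru, Neg. repeat apply THT_And.
  - destruct md; unfold THT; simpl; intuition.
  - auto using THT_Imp, THT_Bot.
  - apply THT_Imp; auto. apply THT_box, THT_conjs; auto.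
    intros; unfold all_guess, gs; auto using THT_And.
  - apply (B 1); auto. apply THT_conjs; auto using THT_Imp.
    intros; unfold ext_total, ext, Neg; auto 7 using THT_And, THT_Or, THT_Imp, THT_Bot.
  - apply (B 1); auto. apply THT_conjs; auto using THT_Imp.
    intros; unfold guess_excl, gs, tru; auto 7 using THT_And, THT_Imp.
  - apply THT_conjs.
    + intros; unfold guess_total, gs.
      apply THT_And; apply THT_Or; apply (B 0); auto.
    + unfold violation, tru.
      apply THT_Or; auto. apply THT_Or; [apply (B 1); auto; apply THT_Imp; auto|].
      repeat apply THT_And; apply THT_Imp; auto;
        apply THT_box, THT_Imp; auto.
Qed.

(** * Space-time diagrams *)

Definition trans := (nat * nat * nat * nat * dir)%type.

(* A cell content: the symbol, and, if the head is here, the transition about to be fired. *)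
Definition content := (nat * option trans)%type.

Definition dir_eqb (d e : dir) : bool :=
  match d, e with DL, DL | DR, DR | DS, DS => true | _, _ => false end.

Definition is_head (c : content) : bool := match snd c with Some _ => true | None => false end.
Definition starts_in (q0 : nat) (c : content) : bool :=
  match snd c with Some (q, _, _, _, _) => q =? q0 | None => false end.
Definition leads_to (q0 : nat) (c : content) : bool :=
  match snd c with Some (_, _, q, _, _) => q =? q0 | None => false end.
Definition moves (d : dir) (c : content) : bool :=
  match snd c with Some (_, _, _, _, e) => dir_eqb d e | None => false end.
Definition next_sym (c : content) : nat :=
  match snd c with Some (_, _, _, b, _) => b | None => fst c end.
Definition linked (c c' : content) : bool :=
  match snd c with Some (_, _, q, _, _) => starts_in q c' | None => false end.

(** The blank and the input symbols are listed even if no transition mentions them, since every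
    symbol of a reachable tape needs a content. *)
Definition alphabet (M : TM) : list nat :=
  [0; 1; 2] ++ flat_map (fun tr : trans => let '(_, a, _, b, _) := tr in [a; b]) (tm_delta M).

(* Idling in the accepting state makes every accepting run extensible to the exact time bound. *)
Definition idle_delta (M : TM) : list trans :=
  tm_delta M ++ map (fun a => (tm_accept M, a, tm_accept M, a, DS)) (alphabet M).

Definition contents (M : TM) : list content :=
  map (fun a => (a, None)) (alphabet M) ++
  map (fun tr : trans => let '(_, a, _, _, _) := tr in (a, Some tr)) (idle_delta M).

Definition content_at (M : TM) (k : nat) : content := nth k (contents M) (0, None).

(** * The compatibility formula *)

Section Formula.
Context (M : TM).

Let Q := length (contents M).
(** There are [Q + 5] kinds of fields, and [k < 2 ^ k] leaves room for each of them below the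
    leading bit of [vid]. *)
Definition width := Q + 5.

Definition vid (k i : nat) : nat := k + 2 ^ (width + i).

(* Record fields.  Indexed by the cells of [arr]: bits of the time (0) and of the cell address (1),
   their increment carries (2, 3), and a one-hot flag (4) saying that the address equals the index.
   Field 5+k, at index 0, says that the content is the k-th one. *)
Definition fields (arr : list nat) : list nat :=
  ([vid 4 0; vid 2 0; vid 3 0] ++ map (fun k => vid (5 + k) 0) (seq 0 Q)) ++
  flat_map (fun i => [vid 0 i; vid 1 i; vid 2 (S i); vid 3 (S i); vid 4 (S i)])
    (seq 0 (length arr)).

(* In [arr], the bits of the input come as symbols 1 and 2, followed by a 3 for each address bit. *)
Definition is_bit (arr : list nat) (i : nat) : bool := nth i arr 0 =? 3.

Definition address (arr : list nat) : list nat :=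
  flat_map (fun i => if is_bit arr i then [vid 0 i; vid 1 i] else []) (seq 0 (length arr)).

Definition lit (c b : bool) (k i : nat) : form := gs c b (vid k i).
Definition tt : form := tt_at (vid 4 0).
Definition ff : form := tru.

Definition eq_lit (c : bool) (k i : nat) (c' : bool) (k' i' : nat) : form :=
  Or (And (lit c true k i) (lit c' true k' i')) (And (lit c false k i) (lit c' false k' i')).

Definition all_cells (arr : list nat) (F : nat -> form) : form :=
  conjs (map F (seq 0 (length arr))) tt.
Definition any_cell (arr : list nat) (F : nat -> form) : form :=
  disjs (map F (seq 0 (length arr))) ff.

Definition has (P : content -> bool) (c : bool) : form :=
  disjs (map (fun k => lit c true (5 + k) 0)
             (filter (fun k => P (content_at M k)) (seq 0 Q))) ff.

Definition has_pair (R : content -> content -> bool) : form :=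
  disjs (map (fun k => And (lit false true (5 + k) 0) (has (R (content_at M k)) true)) (seq 0 Q)) ff.

Definition one_content : form :=
  And (has (fun _ => true) false)
      (conjs (map (fun kl => if fst kl =? snd kl then tt
                            else Or (lit false false (5 + fst kl) 0) (lit false false (5 + snd kl) 0))
                 (list_prod (seq 0 Q) (seq 0 Q))) tt).

Definition zero (arr : list nat) (c : bool) (k : nat) : form :=
  all_cells arr (fun i => if is_bit arr i then lit c false k i else tt).

(** The chain starts at index 0 of the array and passes the input cells unchanged, because a loop
    over the array has no direct access to the first address bit. *)
Definition carry (arr : list nat) (k kc : nat) : form :=
  And (lit false true kc 0)
      (all_cells arr (fun i =>
         if is_bit arr i then
           Or (And (lit false true kc (S i)) (And (lit false true kc i) (lit false true k i)))
              (And (lit false false kc (S i)) (Or (lit false false kc i) (lit false false k i)))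
         else eq_lit false kc (S i) false kc i)).

(* The number in copy [c'] is the successor of the one in copy [c]. *)
Definition succ (arr : list nat) (c c' : bool) (k kc : nat) : form :=
  And (lit c false kc (length arr))
      (all_cells arr (fun i =>
         if is_bit arr i then
           Or (And (lit c' true k i)
                   (Or (And (lit c true k i) (lit c false kc i)) (And (lit c false k i) (lit c true kc i))))
              (And (lit c' false k i)
                   (Or (And (lit c true k i) (lit c true kc i)) (And (lit c false k i) (lit c false kc i))))
         else tt)).

Definition same_cell (arr : list nat) : form :=
  all_cells arr (fun i => if is_bit arr i then eq_lit false 1 i true 1 i else tt).

Definition tick arr := succ arr false true 0 2.
Definition right arr := succ arr false true 1 3.
Definition left arr := succ arr true false 1 3.
Definition both_zero arr := And (zero arr false 1) (zero arr true 1).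

(** Flags are initialised at address 0 and shifted from a cell to its right neighbour, at any two
    times. Every implication has sides free of implications, so each clause has height at most one.
    The clause with [both_zero] is the left edge of the tape, where a left move leaves the head in
    place. *)
Definition clauses (arr : list nat) : list form :=
  [ one_content;
    carry arr 0 2;
    carry arr 1 3;
    Imp (zero arr false 1)
        (And (lit false true 4 0)
             (all_cells arr (fun i => if is_bit arr i then tt else lit false false 4 (S i))));
    Imp (right arr)
        (And (lit true false 4 0)
             (all_cells arr (fun i => if is_bit arr i then tt else eq_lit true 4 (S i) false 4 i)));
    Imp (zero arr false 0)
        (all_cells arr (fun i =>
           if is_bit arr i then tt
           else Or (lit false false 4 i)
                   (if nth i arr 0 =? 1 then has (fun c => fst c =? 1) false
                    else has (fun c => fst c =? 2) false)));
    Imp (zero arr false 0)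
        (Or (any_cell arr (fun i => if is_bit arr i then ff else lit false true 4 i))
            (has (fun c => fst c =? 0) false));
    Imp (zero arr false 0)
        (Or (And (zero arr false 1) (has (starts_in (tm_start M)) false))
            (has (fun c => negb (is_head c)) false));
    Imp (And (zero arr false 0) (zero arr false 1)) (has is_head false);
    Imp (lit false true 2 (length arr))
        (has (fun c => negb (is_head c) || leads_to (tm_accept M) c) false);
    Imp (And (tick arr) (same_cell arr))
        (has_pair (fun c c' => (fst c' =? next_sym c) && (negb (moves DS c) || is_head c')));
    Imp (And (tick arr) (right arr)) (has_pair (fun c c' => negb (moves DR c) || is_head c'));
    Imp (And (tick arr) (left arr)) (has_pair (fun c c' => negb (moves DL c) || is_head c'));
    Imp (And (tick arr) (both_zero arr)) (has_pair (fun c c' => negb (moves DL c) || is_head c'));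
    Imp (tick arr)
        (Or (has_pair (fun c c' => negb (is_head c && is_head c')))
        (Or (And (has_pair (fun c c' => moves DR c && linked c c')) (right arr))
        (Or (And (has_pair (fun c c' => moves DS c && linked c c')) (same_cell arr))
            (And (has_pair (fun c c' => moves DL c && linked c c'))
                 (Or (left arr) (both_zero arr)))))) ].

Definition Good (arr : list nat) : form := conjs (clauses arr) tt.
End Formula.

Lemma pev_conjs {A} v (F : A -> form) l z :
  pev v (conjs (map F l) z) <-> (forall x, In x l -> pev v (F x)) /\ pev v z.
Proof.
  induction l as [|a l IH]; simpl; [tauto|]. rewrite IH. firstorder (subst; auto).
Qed.

Lemma pev_disjs {A} v (F : A -> form) l z :
  pev v (disjs (map F l) z) <-> (exists x, In x l /\ pev v (F x)) \/ pev v z.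
Proof.
  induction l as [|a l IH]; simpl; [firstorder|]. rewrite IH. firstorder (subst; auto).
Qed.

(** * Binary increment by carries *)

Fixpoint carryb (v j : nat) : bool :=
  match j with 0 => true | S j => carryb v j && Nat.testbit v j end.

(** The recursion peels off the highest bit; inductions that halve [v] need the lowest. *)
Lemma carryb_shift v j : carryb v (S j) = Nat.odd v && carryb (Nat.div2 v) j.
Proof.
  induction j as [|j IH]; [simpl; rewrite andb_true_r; auto|].
  change (carryb v (S (S j))) with (carryb v (S j) && Nat.testbit v (S j)).
  rewrite IH. simpl. apply eq_sym, andb_assoc.
Qed.

Lemma div2_odd_succ v : Nat.div2 (S v) = if Nat.odd v then S (Nat.div2 v) else Nat.div2 v.
Proof.
  pose proof (Nat.div2_odd v) as E. pose proof (Nat.div2_odd (S v)) as E'.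
  rewrite Nat.odd_succ, <- Nat.negb_odd in E'. destruct (Nat.odd v); simpl in *; lia.
Qed.

Lemma testbit_succ v j : Nat.testbit (S v) j = xorb (Nat.testbit v j) (carryb v j).
Proof.
  revert v; induction j as [|j IH]; intros v.
  - simpl carryb. rewrite !Nat.bit0_odd, Nat.odd_succ, <- Nat.negb_odd.
    destruct (Nat.odd v); auto.
  - rewrite carryb_shift. cbn [Nat.testbit]. rewrite div2_odd_succ.
    destruct (Nat.odd v); [apply IH|]. rewrite andb_false_l, xorb_false_r; auto.
Qed.

Lemma carryb_top v N : v < 2 ^ N -> (carryb v N = true <-> S v = 2 ^ N).
Proof.
  revert v; induction N as [|N IH]; intros v Hv.
  - simpl in *; split; auto; lia.
  - rewrite carryb_shift, andb_true_iff, IH.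
    + pose proof (Nat.div2_odd v). simpl. destruct (Nat.odd v); simpl in *; split; intros; intuition lia.
    + pose proof (Nat.div2_odd v). simpl in Hv. destruct (Nat.odd v); simpl in *; lia.
Qed.

Lemma bits_inj v v' N : v < 2 ^ N -> v' < 2 ^ N ->
  (forall j, j < N -> Nat.testbit v j = Nat.testbit v' j) -> v = v'.
Proof.
  revert v v'; induction N as [|N IH]; intros v v' Hv Hv' E.
  - simpl in *; lia.
  - pose proof (Nat.div2_odd v) as D. pose proof (Nat.div2_odd v') as D'.
    pose proof (E 0 ltac:(lia)) as E0. rewrite !Nat.bit0_odd in E0.
    assert (Nat.div2 v = Nat.div2 v').
    { simpl in Hv, Hv'. apply IH; [destruct (Nat.odd v); simpl in *; lia..|].
      intros j Hj. apply (E (S j)); lia. }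
    rewrite D, D', E0; congruence.
Qed.

Lemma bits_exist (f : nat -> bool) N :
  exists v, v < 2 ^ N /\ forall j, j < N -> Nat.testbit v j = f j.
Proof.
  revert f; induction N as [|N IH]; intros f.
  - exists 0; simpl; split; [auto|lia].
  - destruct (IH (fun j => f (S j))) as (v & Hv & E).
    exists (Nat.b2n (f 0) + 2 * v). split; [simpl; destruct (f 0); simpl; lia|].
    intros [|j] Hj.
    + apply Nat.add_b2n_double_bit0.
    + cbn [Nat.testbit]. rewrite Nat.div2_div, Nat.add_b2n_double_div2. apply E; lia.
Qed.

(** The condition on the top carry prevents overflow: without it 0 would count as successor of
    [2 ^ N - 1]. *)
Lemma succ_bits v v' N : v < 2 ^ N -> v' < 2 ^ N ->
  ((carryb v N = false /\
    forall j, j < N -> Nat.testbit v' j = xorb (Nat.testbit v j) (carryb v j)) <-> v' = S v).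
Proof.
  intros Hv Hv'. split.
  - intros [C E]. assert (S v <> 2 ^ N) by (rewrite <- carryb_top by auto; congruence).
    apply bits_inj with N; [auto|lia|]. intros j Hj. rewrite testbit_succ; auto.
  - intros ->. split.
    + apply not_true_iff_false. rewrite carryb_top by auto. lia.
    + intros; apply testbit_succ.
Qed.

(** * The compatibility formula evaluated on records *)

Section Semantics.
Context (M : TM) (w : list bool) (N : nat).

Notation n := (length w).
Notation Q := (length (contents M)).
Notation vd := (vid M).

Definition layout : list nat := map sym w ++ repeat 3 N.

Lemma layout_length : length layout = n + N.
Proof. unfold layout. rewrite length_app, length_map, repeat_length; auto. Qed.

Lemma layout_bit j : j < N -> is_bit layout (n + j) = true.
Proof.
  intros. unfold is_bit, layout. rewrite app_nth2; rewrite length_map; [|lia].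
  rewrite nth_indep with (d' := 3) by (rewrite repeat_length; lia).
  rewrite nth_repeat. auto.
Qed.

Lemma layout_sym i : i < n -> nth i layout 0 = sym (nth i w false).
Proof.
  intros. unfold layout. rewrite app_nth1 by (rewrite length_map; auto).
  rewrite nth_indep with (d' := sym false) by (rewrite length_map; auto). apply map_nth.
Qed.

Lemma layout_flag i : i < n -> is_bit layout i = false.
Proof. intros. unfold is_bit. rewrite layout_sym by auto. destruct (nth i w false); auto. Qed.

Lemma layout_split (P : nat -> Prop) :
  (forall i, i < n + N -> P i) <-> (forall i, i < n -> P i) /\ (forall j, j < N -> P (n + j)).
Proof.
  split; [intros; split; intros; apply H; lia|]. intros [A B] i Hi.
  destruct (le_lt_dec n i); [|auto]. replace i with (n + (i - n)) by lia. apply B; lia.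
Qed.

Definition bits (s : nat -> bool) (k v : nat) : Prop :=
  forall j, j < N -> s (vd k (n + j)) = Nat.testbit v j.
Definition carries (s : nat -> bool) (k v : nat) : Prop :=
  (forall i, i <= n -> s (vd k i) = true) /\
  forall j, j <= N -> s (vd k (n + j)) = carryb v j.
Definition holds (s : nat -> bool) (x : content) : Prop :=
  (exists k, k < Q /\ s (vd (5 + k) 0) = true /\ content_at M k = x) /\
  forall k l, k < Q -> l < Q -> s (vd (5 + k) 0) = true -> s (vd (5 + l) 0) = true -> k = l.
(** The range includes [length w], because the loops over input cells set the flag at the following
    index. *)
Definition flags (s : nat -> bool) (p : nat) : Prop :=
  forall k, k <= n -> s (vd 4 k) = (p =? k).

Section Pair.
Context (s1 s2 : nat -> bool).
Notation ev := (pev (gval s1 s2)).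
Notation sel c := (if (c : bool) then s2 else s1).

Lemma ev_lit c b k i : ev (lit M c b k i) <-> sel c (vd k i) = b.
Proof.
  unfold lit, gs. cbn [pev]. unfold gval. rewrite guess_gs, eqb_true_iff. intuition.
Qed.

Lemma ev_tt : ev (tt M).
Proof.
  change (ev (lit M false true 4 0) \/ ev (lit M false false 4 0)).
  rewrite !ev_lit. destruct (s1 (vd 4 0)); auto.
Qed.

Lemma ev_ff : ~ ev ff.
Proof. simpl. unfold gval. rewrite guess_tru. discriminate. Qed.

Lemma ev_all F : ev (all_cells M layout F) <->
  (forall i, i < n -> ev (F i)) /\ (forall j, j < N -> ev (F (n + j))).
Proof.
  unfold all_cells. rewrite pev_conjs, layout_length, <- layout_split.
  pose proof ev_tt. split.
  - intros [K _] i Hi. apply K, in_seq; lia.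
  - intros K; split; auto. intros i Hi. apply in_seq in Hi. apply K; lia.
Qed.

Lemma ev_any F : ev (any_cell layout F) <-> exists i, i < n + N /\ ev (F i).
Proof.
  unfold any_cell. rewrite pev_disjs, layout_length.
  pose proof ev_ff. split.
  - intros [(i & Hi & K)|]; [|tauto]. apply in_seq in Hi. exists i; split; [lia|auto].
  - intros (i & Hi & K). left; exists i; split; [apply in_seq; lia|auto].
Qed.

Lemma ev_eq_lit c k i c' k' i' :
  ev (eq_lit M c k i c' k' i') <-> sel c (vd k i) = sel c' (vd k' i').
Proof.
  clear w N.
  change (ev (lit M c true k i) /\ ev (lit M c' true k' i') \/
          ev (lit M c false k i) /\ ev (lit M c' false k' i') <-> sel c (vd k i) = sel c' (vd k' i')).
  rewrite !ev_lit. destruct (sel c (vd k i)), (sel c' (vd k' i')); intuition congruence.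
Qed.

Lemma ev_has P c : ev (has M P c) <->
  exists k, k < Q /\ sel c (vd (5 + k) 0) = true /\ P (content_at M k) = true.
Proof.
  unfold has. rewrite pev_disjs. pose proof ev_ff. split.
  - intros [(k & Hk & K)|]; [|tauto]. apply filter_In in Hk as [Hk Pk]. apply in_seq in Hk.
    rewrite ev_lit in K. exists k; repeat split; auto; lia.
  - intros (k & Hk & K & Pk). left; exists k. rewrite ev_lit, filter_In, in_seq.
    repeat split; auto; lia.
Qed.

Lemma ev_has_holds P c x : holds (sel c) x -> (ev (has M P c) <-> P x = true).
Proof.
  intros [(k & Hk & E & X) U]. rewrite ev_has. split.
  - intros (l & Hl & El & Pl). rewrite (U l k) in Pl; auto. rewrite X in Pl; auto.
  - intros Px. exists k; rewrite X; auto.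
Qed.

Lemma ev_has_pair R x y : holds s1 x -> holds s2 y ->
  (ev (has_pair M R) <-> R x y = true).
Proof.
  intros [(k & Hk & E & X) U] Hy. unfold has_pair. rewrite pev_disjs. pose proof ev_ff. split.
  - intros [(l & Hl & K1 & K2)|]; [|tauto]. apply in_seq in Hl.
    rewrite ev_lit in K1. rewrite (ev_has_holds _ true y) in K2 by auto.
    rewrite (U l k) in K2 by (auto; lia). rewrite X in K2; auto.
  - intros Rxy. left; exists k. rewrite in_seq. split; [lia|]. split.
    + apply ev_lit; auto.
    + apply (ev_has_holds _ true y); auto. rewrite X; auto.
Qed.

Lemma ev_one_content : ev (one_content M) <-> exists x, holds s1 x.
Proof.
  unfold one_content. cbn [pev]. rewrite pev_conjs, ev_has. pose proof ev_tt. split.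
  - intros [(k & Hk & E & _) [K _]]. exists (content_at M k). split; [eauto|].
    intros a b Ha Hb Ea Eb. destruct (Nat.eq_dec a b) as [|D]; auto.
    specialize (K (a, b)). simpl fst in K; simpl snd in K.
    apply Nat.eqb_neq in D. rewrite D in K. cbn [pev] in K. rewrite !ev_lit in K.
    rewrite Ea, Eb in K. destruct K as [K|K]; try discriminate.
    apply in_prod; apply in_seq; lia.
  - intros (x & (k & Hk & E & X) & U). split; [exists k; auto|split; auto].
    intros [a b] Hab. apply in_prod_iff in Hab as [Ha Hb]. apply in_seq in Ha, Hb. simpl fst; simpl snd.
    destruct (Nat.eqb_spec a b) as [|D]; auto. cbn [pev]. rewrite !ev_lit.
    destruct (s1 (vd (5 + a) 0)) eqn:Ea; auto. destruct (s1 (vd (5 + b) 0)) eqn:Eb; auto.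
    exfalso; apply D, U; auto; lia.
Qed.

Lemma ev_zero c k v : bits (sel c) k v -> v < 2 ^ N -> (ev (zero M layout c k) <-> v = 0).
Proof.
  intros B Hv. unfold zero. rewrite ev_all. split.
  - intros [_ K]. apply bits_inj with N; auto; [lia|]. intros j Hj.
    specialize (K j Hj). rewrite layout_bit, ev_lit in K by auto.
    rewrite Nat.bits_0, <- K. symmetry. apply B; auto.
  - intros ->. split; intros i Hi.
    + rewrite layout_flag by auto. apply ev_tt.
    + rewrite layout_bit, ev_lit, B, Nat.bits_0 by auto. auto.
Qed.

Lemma ev_carry k kc v : bits s1 k v -> (ev (carry M layout k kc) <-> carries s1 kc v).
Proof.
  intros B. unfold carry. cbn [pev]. rewrite ev_lit, ev_all. split.
  - intros (C0 & CF & CB).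
    assert (A : forall i, i <= n -> s1 (vd kc i) = true).
    { induction i as [|i IH]; intros Hi; auto.
      specialize (CF i ltac:(lia)). rewrite layout_flag, ev_eq_lit in CF by lia.
      rewrite CF. apply IH; lia. }
    split; auto. induction j as [|j IH]; intros Hj; [rewrite Nat.add_0_r; apply A; auto|].
    specialize (CB j ltac:(lia)). rewrite layout_bit in CB by lia. cbn [pev] in CB.
    rewrite !ev_lit, B, IH in CB by lia. rewrite Nat.add_succ_r. cbn [carryb].
    destruct (carryb v j), (Nat.testbit v j); simpl; intuition congruence.
  - intros [A C]. split; [apply (A 0); lia|split; intros i Hi].
    + rewrite layout_flag, ev_eq_lit by auto. rewrite !A by lia; auto.
    + rewrite layout_bit by auto. cbn [pev]. rewrite !ev_lit, B by auto.
      rewrite (C i) by lia. rewrite <- Nat.add_succ_r, C by lia. cbn [carryb].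
      destruct (carryb v i), (Nat.testbit v i); simpl; auto.
Qed.

Lemma ev_succ (c c' : bool) k kc v v' :
  bits (sel c) k v -> carries (sel c) kc v -> bits (sel c') k v' -> v < 2 ^ N -> v' < 2 ^ N ->
  (ev (succ M layout c c' k kc) <-> v' = S v).
Proof.
  intros B [_ C] B' Hv Hv'. rewrite <- (succ_bits v v' N) by auto.
  unfold succ. cbn [pev]. rewrite ev_lit, ev_all, layout_length, C by auto.
  assert (E : forall j, j < N ->
    (ev (Or (And (lit M c' true k (n + j))
                   (Or (And (lit M c true k (n + j)) (lit M c false kc (n + j))) (And (lit M c false k (n + j)) (lit M c true kc (n + j)))))
              (And (lit M c' false k (n + j))
                   (Or (And (lit M c true k (n + j)) (lit M c true kc (n + j))) (And (lit M c false k (n + j)) (lit M c false kc (n + j))))))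
     <-> Nat.testbit v' j = xorb (Nat.testbit v j) (carryb v j))).
  { intros j Hj. cbn [pev]. rewrite !ev_lit, B, B', C by lia.
    destruct (Nat.testbit v' j), (Nat.testbit v j), (carryb v j); simpl; intuition discriminate. }
  split; intros [K1 K2]; split; auto.
  - intros j Hj. apply E; auto. destruct K2 as [_ K2]. specialize (K2 j Hj).
    rewrite layout_bit in K2 by auto. exact K2.
  - split; intros i Hi; [rewrite layout_flag by auto; apply ev_tt|].
    rewrite layout_bit by auto. apply E; auto.
Qed.

Lemma ev_same v v' : bits s1 1 v -> bits s2 1 v' -> v < 2 ^ N -> v' < 2 ^ N ->
  (ev (same_cell M layout) <-> v' = v).
Proof.
  intros B B' Hv Hv'. unfold same_cell. rewrite ev_all. split.
  - intros [_ K]. apply bits_inj with N; auto. intros j Hj. specialize (K j Hj).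
    rewrite layout_bit, ev_eq_lit in K by auto. rewrite <- B, <- B' by auto. auto.
  - intros ->. split; intros i Hi; [rewrite layout_flag by auto; apply ev_tt|].
    rewrite layout_bit, ev_eq_lit, B, B' by auto. auto.
Qed.

Definition init_sym (p : nat) : nat := nth p (map sym w) 0.

Definition moved (x : content) (p p' : nat) : Prop :=
  match snd x with Some (_, _, _, _, d) => p' = move d p | None => False end.

(** Each row contains the transition fired from it, so the transition in row [2 ^ N - 1] is step
    number [2 ^ N] and its target state must accept. *)
Definition local_ok (t p : nat) (x : content) : Prop :=
  (t = 0 -> fst x = init_sym p /\
     (if p =? 0 then starts_in (tm_start M) x else negb (is_head x)) = true) /\
  (S t = 2 ^ N -> is_head x = true -> leads_to (tm_accept M) x = true).

(** The last condition excludes stray heads: a head in the next row must be where the current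
    transition moves it. *)
Definition step_ok (x : content) (p : nat) (y : content) (p' : nat) : Prop :=
  (p' = p -> fst y = next_sym x) /\
  (moved x p p' -> is_head y = true) /\
  (is_head x = true -> is_head y = true -> linked x y = true /\ moved x p p').

Definition record (s : nat -> bool) (t p : nat) (x : content) : Prop :=
  t < 2 ^ N /\ p < 2 ^ N /\ bits s 0 t /\ bits s 1 p /\ carries s 2 t /\ carries s 3 p /\
  flags s p /\ holds s x.

Lemma init_sym_in p : p < n -> init_sym p = sym (nth p w false).
Proof.
  intros. unfold init_sym. rewrite nth_indep with (d' := sym false) by (rewrite length_map; auto).
  apply map_nth.
Qed.

Lemma starts_head q x : starts_in q x = true -> is_head x = true.
Proof. destruct x as [a [[[[[q' b] q''] c] d]|]]; simpl; auto. Qed.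

Lemma ev_flags F :
  ev (all_cells M layout (fun i => if is_bit layout i then tt M else F i)) <->
  forall i, i < n -> ev (F i).
Proof.
  rewrite ev_all. split.
  - intros [K _] i Hi. specialize (K i Hi). rewrite layout_flag in K; auto.
  - intros K; split; intros i Hi; [rewrite layout_flag by auto; auto|].
    rewrite layout_bit by auto. apply ev_tt.
Qed.

(** The clauses are split by the relation between the two addresses, whereas [move] is uniform; a
    left move needs two cases because [pred 0 = 0]. *)
Lemma step_ok_iff x p y p' :
  step_ok x p y p' <->
  (p' = p -> (fst y =? next_sym x) && (negb (moves DS x) || is_head y) = true) /\
  (p' = S p -> negb (moves DR x) || is_head y = true) /\
  (p = S p' -> negb (moves DL x) || is_head y = true) /\
  (p = 0 /\ p' = 0 -> negb (moves DL x) || is_head y = true) /\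
  (negb (is_head x && is_head y) = true \/
   moves DR x && linked x y = true /\ p' = S p \/
   moves DS x && linked x y = true /\ p' = p \/
   moves DL x && linked x y = true /\ (p = S p' \/ p = 0 /\ p' = 0)).
Proof.
  unfold step_ok. split.
  - intros (S1 & S2 & S3).
    split; [|split; [|split; [|split]]].
    + intros P. rewrite (S1 P), Nat.eqb_refl. clear S1 S3.
      unfold moves, moved in *. destruct x as [a [[[[[q b] q'] c] []]|]]; simpl in *; auto.
    + intros P. clear S1 S3.
      unfold moves, moved in *. destruct x as [a [[[[[q b] q'] c] []]|]]; simpl in *; auto.
    + intros ->. clear S1 S3.
      unfold moves, moved in *. destruct x as [a [[[[[q b] q'] c] []]|]]; simpl in *; auto.
    + intros [-> ->]. clear S1 S3.
      unfold moves, moved in *. destruct x as [a [[[[[q b] q'] c] []]|]]; simpl in *; auto.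
    + clear S1 S2. destruct (is_head x) eqn:Hx; [|left; auto].
      destruct (is_head y) eqn:Hy; [|left; auto].
      right. destruct (S3 eq_refl eq_refl) as [L P]. clear S3.
      rewrite !andb_true_iff. unfold moves, moved in *.
      destruct x as [a [[[[[q b] q'] c] []]|]]; simpl in *; [|auto|auto|tauto].
      right; right. split; auto. destruct p; simpl in P; auto.
  - intros (K6 & K7 & K8 & K9 & K10). split; [|split].
    + intros P. specialize (K6 P). apply andb_true_iff in K6 as [K6 _]. apply Nat.eqb_eq; auto.
    + clear K10. intros P. unfold moved, moves in *.
      destruct x as [a [[[[[q b] q'] c] d]|]]; simpl in *; [|tauto].
      destruct d; simpl in *.
      * destruct p; simpl in P; [apply K9|apply K8]; auto.
      * apply K7; auto.
      * specialize (K6 P). apply andb_true_iff in K6; tauto.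
    + clear K6 K7 K8 K9. intros Hx Hy. rewrite Hx, Hy in K10. simpl in K10.
      rewrite !andb_true_iff in K10. unfold moved, moves in *.
      destruct x as [a [[[[[q b] q'] c] d]|]]; simpl in *; [|discriminate].
      destruct d; simpl; destruct K10 as [K|[[[? K] ?]|[[[? K] ?]|[[? K] ?]]]]; try discriminate;
        split; auto; lia.
Qed.

(** On genuine records the clauses about carries, flags and uniqueness of the content hold by
    themselves, which leaves the conditions on the run. *)
Lemma Good_iff t p x t' p' y :
  record s1 t p x -> record s2 t' p' y ->
  (ev (Good M layout) <-> local_ok t p x /\ (t' = S t -> step_ok x p y p')).
Proof.
  intros (Ht & Hp & Bt & Bp & Ct & Cp & F & X) (Ht' & Hp' & Bt' & Bp' & Ct' & Cp' & F' & Y).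
  assert (Zt : ev (zero M layout false 0) <-> t = 0) by (apply ev_zero; auto).
  assert (Zp : ev (zero M layout false 1) <-> p = 0) by (apply ev_zero; auto).
  assert (Zp' : ev (zero M layout true 1) <-> p' = 0) by (apply ev_zero; auto).
  assert (TK : ev (tick M layout) <-> t' = S t) by (apply ev_succ; auto).
  assert (RT : ev (right M layout) <-> p' = S p) by (apply ev_succ; auto).
  assert (LT : ev (left M layout) <-> p = S p') by (apply ev_succ; auto).
  assert (SM : ev (same_cell M layout) <-> p' = p) by (apply ev_same; auto).
  assert (HX : forall P, ev (has M P false) <-> P x = true) by (intros; apply ev_has_holds; auto).
  assert (HP : forall R, ev (has_pair M R) <-> R x y = true) by (intros; apply ev_has_pair; auto).
  assert (TM : s1 (vd 2 (n + N)) = true <-> S t = 2 ^ N).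
  { rewrite (proj2 Ct) by auto. apply carryb_top; auto. }
  assert (AN : ev (any_cell layout (fun i => if is_bit layout i then ff else lit M false true 4 i)) <-> p < n).
  { rewrite ev_any. split.
    - intros (i & Hi & K). destruct (le_lt_dec n i) as [L|L].
      + replace i with (n + (i - n)) in K by lia. rewrite layout_bit in K by lia.
        apply ev_ff in K; destruct K.
      + rewrite layout_flag, ev_lit, F in K by lia. apply Nat.eqb_eq in K; lia.
    - intros L. exists p. rewrite layout_flag, ev_lit, F by lia. split; [lia|apply Nat.eqb_refl]. }
  assert (SY : (forall i, i < n -> ev (Or (lit M false false 4 i)
                   (if nth i layout 0 =? 1 then has M (fun c => fst c =? 1) false
                    else has M (fun c => fst c =? 2) false))) <->
               (p < n -> fst x = init_sym p)).
  { split.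
    - intros K L. specialize (K p L). rewrite init_sym_in, layout_sym in * by auto.
      cbn [pev] in K. rewrite ev_lit, F, Nat.eqb_refl in K by lia.
      destruct K as [K|K]; [discriminate|].
      destruct (nth p w false); cbn [sym Nat.eqb] in *; rewrite HX in K; apply Nat.eqb_eq; auto.
    - intros K i Hi. cbn [pev]. rewrite ev_lit, F by lia.
      destruct (Nat.eqb_spec p i) as [->|]; auto. right.
      specialize (K Hi). rewrite init_sym_in in K by auto. rewrite layout_sym by auto.
      destruct (nth i w false); cbn [sym Nat.eqb] in *; rewrite HX; apply Nat.eqb_eq; auto. }
  unfold Good, clauses, both_zero. cbn [conjs fold_right pev].
  rewrite Zt, Zp, Zp', TK, RT, LT, SM, !HX, !HP, ev_one_content, !ev_flags, AN, SY, !ev_lit,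
    layout_length, TM.
  rewrite (ev_carry 0 2 t), (ev_carry 1 3 p) by auto.
  assert (F0 : p = 0 -> forall i, i < n -> ev (lit M false false 4 (S i))).
  { intros -> i Hi. rewrite ev_lit, F by lia. auto. }
  assert (F1 : p' = S p -> forall i, i < n -> ev (eq_lit M true 4 (S i) false 4 i)).
  { intros -> i Hi. rewrite ev_eq_lit, F, F' by lia. auto. }
  assert (F2 : p = 0 -> s1 (vd 4 0) = true) by (intros ->; rewrite F; auto; lia).
  assert (F3 : p' = S p -> s2 (vd 4 0) = false) by (intros ->; rewrite F'; auto; lia).
  pose proof ev_tt as Tt.
  split.
  - intros (_ & _ & _ & _ & _ & K1 & K2 & K3 & K4 & K5 & K6 & K7 & K8 & K9 & K10 & _).
    split; [split|].
    + intros E. split.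
      * destruct (le_lt_dec n p) as [L|L]; [|auto].
        destruct (K2 E) as [K|K]; [lia|]. apply Nat.eqb_eq in K. rewrite K.
        unfold init_sym. rewrite nth_overflow; auto. rewrite length_map; auto.
      * destruct (Nat.eqb_spec p 0) as [P0|P0].
        -- destruct (K3 E) as [[_ K]|K]; auto. rewrite K4 in K by auto. discriminate.
        -- destruct (K3 E) as [[K _]|K]; [contradiction|auto].
    + intros E Hx. specialize (K5 E). rewrite Hx in K5; auto.
    + intros E. apply step_ok_iff. repeat split; auto.
  - intros [[K1 K2] K3].
    split; [eauto|]. split; [auto|]. split; [auto|]. split; [auto|]. split; [auto|].
    split; [intros E _; apply (K1 E)|].
    split; [|split; [|split; [|split]]].
    + intros E. destruct (le_lt_dec n p); auto. right.
      destruct (K1 E) as [K _]. rewrite K. unfold init_sym.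
      rewrite nth_overflow by (rewrite length_map; auto). auto.
    + intros E. destruct (K1 E) as [_ K]. destruct (Nat.eqb_spec p 0); auto.
    + intros [E ->]. destruct (K1 E) as [_ K]. simpl in K. eapply starts_head; eauto.
    + intros E. specialize (K2 E). destruct (is_head x); simpl; auto.
    + split; [|split; [|split; [|split; [|split; [|exact Tt]]]]];
        [intros [E P]..|intros E]; specialize (K3 E); apply step_ok_iff in K3;
        destruct K3 as (S1 & S2 & S3 & S4 & S5); auto.
Qed.
End Pair.
End Semantics.

(** Inverse of [vid]: the leading bit gives the index, the remainder the kind. *)
Definition field_val (M : TM) (f : nat -> nat -> bool) (x : nat) : bool :=
  f (x - 2 ^ Nat.log2 x) (Nat.log2 x - width M).

Lemma kind_small M k : k < length (contents M) + 5 -> k < 2 ^ width M.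
Proof. intros. eapply Nat.lt_trans; eauto. apply Nat.pow_gt_lin_r; lia. Qed.

Lemma log2_vid M k i : k < length (contents M) + 5 -> Nat.log2 (vid M k i) = width M + i.
Proof.
  intros Hk. apply kind_small in Hk. unfold vid. apply Nat.log2_unique; [lia|].
  rewrite Nat.pow_succ_r', Nat.pow_add_r. pose proof (Nat.pow_nonzero 2 i).
  split; [lia|]. nia.
Qed.

Lemma field_val_vid M f k i :
  k < length (contents M) + 5 -> field_val M f (vid M k i) = f k i.
Proof.
  intros Hk. unfold field_val. rewrite log2_vid by auto.
  f_equal; [unfold vid|]; lia.
Qed.

(** * Runs that idle after acceptance *)

Definition idle_machine (M : TM) : TM := mkTM (idle_delta M) (tm_start M) (tm_accept M).

Lemma nreach_snoc M k c c1 c2 : nreach M k c c1 -> nstep M c1 c2 -> nreach M (S k) c c2.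
Proof.
  induction 1; intros; [eapply nreachS; eauto; constructor|eapply nreachS; eauto].
Qed.

(** An idle transition fires only in the accepting state, so up to the first visit of that state the
    run is one of [M]. *)
Lemma idle_sound M k c c' : nreach (idle_machine M) k c c' -> c_state c' = tm_accept M ->
  exists j d, j <= k /\ nreach M j c d /\ c_state d = tm_accept M.
Proof.
  induction 1 as [c|k c c1 c2 Hs Hr IH]; intros A.
  - exists 0, c; repeat split; auto. constructor.
  - destruct (Nat.eq_dec (c_state c) (tm_accept M)) as [E|E].
    + exists 0, c; repeat split; auto; [lia|constructor].
    + destruct (IH A) as (j & d & Hj & R & Ad). exists (S j), d. repeat split; auto; [lia|].
      eapply nreachS; eauto.
      destruct Hs as (q & a & q' & a' & dd & I & Eq & Ea & ->).
      exists q, a, q', a', dd. repeat split; auto.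
      cbn [tm_delta idle_machine] in I. unfold idle_delta in I. apply in_app_or in I as [I|I]; auto.
      apply in_map_iff in I as (b & K & _). exfalso; apply E. congruence.
Qed.

Lemma in_contents M x : In x (contents M) ->
  In (fst x) (alphabet M) /\ snd x = None \/
  exists q q' a' d, x = (fst x, Some (q, fst x, q', a', d)) /\ In (q, fst x, q', a', d) (idle_delta M).
Proof.
  unfold contents. rewrite in_app_iff, !in_map_iff. intros [(a & <- & I)|(tr & K & I)].
  - left; auto.
  - right. destruct tr as [[[[q a] q'] a'] d]. subst x. exists q, q', a', d; auto.
Qed.

(** * From compatible records to an accepting run *)

Section Decode.
Context (M : TM) (w : list bool) (N : nat).
Notation n := (length w).
Notation Q := (length (contents M)).
Notation vd := (vid M).
Notation arr := (layout w N).
Context (S : (nat -> bool) -> Prop).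
Context (HS : realizable (fields M arr) (address M arr) (Good M arr) S).

Lemma address_in j : j < N -> In (vd 0 (n + j)) (address M arr) /\ In (vd 1 (n + j)) (address M arr).
Proof.
  intros Hj. unfold address. rewrite !in_flat_map.
  split; exists (n + j); (split; [apply in_seq; rewrite layout_length; lia|]);
    rewrite layout_bit by auto; simpl; auto.
Qed.

Lemma cover t p : exists s, S s /\ bits M w N s 0 t /\ bits M w N s 1 p.
Proof.
  destruct HS as [_ C].
  destruct (C (field_val M (fun k i => Nat.testbit (match k with 0 => t | _ => p end) (i - n))))
    as (s & Hs & E).
  exists s. split; auto.
  split; intros j Hj; destruct (address_in j Hj) as [I0 I1];
    rewrite E by auto; rewrite field_val_vid by lia; f_equal; lia.
Qed.

Lemma good_carries s t p : S s -> bits M w N s 0 t -> bits M w N s 1 p ->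
  carries M w N s 2 t /\ carries M w N s 3 p /\ exists x, holds M s x.
Proof.
  intros Hs Bt Bp. destruct HS as [G _]. specialize (G s s Hs Hs).
  unfold Good, clauses in G. cbn [conjs fold_right] in G.
  destruct G as (G1 & G2 & G3 & _).
  apply ev_one_content in G1. apply ev_carry with (v := t) in G2; auto.
  apply ev_carry with (v := p) in G3; auto.
Qed.

(** Induction along the tape. The flag clauses do not mention time, so the record of the left
    neighbour can be taken at time 0, where coverage provides one. *)
Lemma good_flags p : p < 2 ^ N -> forall s t, S s -> t < 2 ^ N ->
  bits M w N s 0 t -> bits M w N s 1 p -> flags M w s p.
Proof.
  induction p as [|p IH]; intros Hp s t Hs Ht Bt Bp.
  - destruct HS as [G _]. specialize (G s s Hs Hs).
    unfold Good, clauses in G. cbn [conjs fold_right] in G.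
    destruct G as (_ & _ & _ & G & _). cbn [pev] in G.
    rewrite ev_flags, ev_lit in G.
    destruct G as [G0 G1]; [apply (ev_zero M w N s s false 1 0); auto|].
    intros [|k] Hk; [auto|]. specialize (G1 k ltac:(lia)). rewrite ev_lit in G1. auto.
  - destruct (cover 0 p) as (s' & Hs' & Bt' & Bp').
    assert (F' := IH ltac:(lia) s' 0 Hs' ltac:(lia) Bt' Bp').
    destruct (good_carries s' 0 p Hs' Bt' Bp') as (_ & C & _).
    destruct HS as [G _]. specialize (G s' s Hs' Hs).
    unfold Good, clauses in G. cbn [conjs fold_right] in G.
    destruct G as (_ & _ & _ & _ & G & _). cbn [pev] in G.
    rewrite ev_flags, ev_lit in G.
    destruct G as [G0 G1]; [apply (ev_succ M w N s' s false true 1 3 p (Datatypes.S p)); auto; lia|].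
    intros [|k] Hk; [auto|]. specialize (G1 k ltac:(lia)). rewrite ev_eq_lit in G1.
    rewrite G1. rewrite F' by lia. auto.
Qed.

Definition at_cell (t p : nat) (x : content) : Prop := exists s, S s /\ record M w N s t p x.

Lemma cell_total t p : t < 2 ^ N -> p < 2 ^ N -> exists x, at_cell t p x.
Proof.
  intros Ht Hp. destruct (cover t p) as (s & Hs & Bt & Bp).
  destruct (good_carries s t p Hs Bt Bp) as (C & C' & x & Hx).
  exists x, s. split; [exact Hs|].
  split; [exact Ht|]. split; [exact Hp|]. split; [exact Bt|]. split; [exact Bp|].
  split; [exact C|]. split; [exact C'|]. split; [exact (good_flags p Hp s t Hs Ht Bt Bp)|exact Hx].
Qed.

Lemma cell_in t p x : at_cell t p x -> In x (contents M).
Proof.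
  intros (s & _ & _ & _ & _ & _ & _ & _ & _ & [(k & Hk & _ & <-) _]). apply nth_In; auto.
Qed.

Lemma cell_ok t p x t' p' y : at_cell t p x -> at_cell t' p' y ->
  local_ok M w N t p x /\ (t' = Datatypes.S t -> step_ok x p y p').
Proof.
  intros (s & Hs & R) (s' & Hs' & R'). destruct HS as [G _].
  eapply Good_iff; eauto.
Qed.

(** Several records with different transitions may share an address, hence the quantification over
    all of them. One record of the head cell is chosen; its transition gives the next configuration,
    and compatibility with it binds every record of the next row. The bound on the head keeps it
    below [2 ^ N]. *)
Lemma cells_run t : t < 2 ^ N -> exists c, nreach (idle_machine M) t (init M w) c /\ c_head c <= t /\
  forall p x, at_cell t p x -> fst x = c_tape c p /\ (is_head x = true <-> p = c_head c) /\
    (is_head x = true -> starts_in (c_state c) x = true).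
Proof.
  induction t as [|t IH]; intros Ht.
  - exists (init M w). split; [constructor|]. split; [simpl; auto|].
    intros p x Hx. destruct (cell_ok _ _ _ _ _ _ Hx Hx) as [[L _] _].
    destruct (L eq_refl) as [L1 L2]. split; [exact L1|]. cbn [init c_head c_state].
    destruct (Nat.eqb_spec p 0) as [P|P].
    + split; auto. split; auto. intros _; eapply starts_head; eauto.
    + destruct (is_head x); [discriminate|]. split; [split; [discriminate|lia]|discriminate].
  - destruct IH as (c & R & Hh & I); [lia|].
    destruct (cell_total t (c_head c)) as [x Hx]; [lia|lia|].
    destruct (I _ _ Hx) as (I1 & I2 & I3).
    assert (Hd : is_head x = true) by (apply I2; auto). specialize (I3 Hd).
    destruct (in_contents M x (cell_in _ _ _ Hx)) as [[_ N0]|(q & q' & a' & d & Ex & Itr)].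
    { unfold is_head in Hd. rewrite N0 in Hd; discriminate. }
    rewrite Ex in I3. simpl in I3. apply Nat.eqb_eq in I3.
    exists (apply_trans c q' a' d). split; [|split].
    + eapply nreach_snoc; eauto. exists q, (fst x), q', a', d. repeat split; auto.
    + simpl. destruct d; simpl; lia.
    + intros p' y Hy.
      destruct (cell_ok _ _ _ _ _ _ Hx Hy) as [_ K]. destruct (K eq_refl) as (K1 & K2 & K3).
      simpl c_tape. simpl c_head. simpl c_state.
      split; [|split].
      * destruct (Nat.eqb_spec p' (c_head c)) as [E|E].
        -- rewrite K1 by auto. rewrite Ex; auto.
        (* Away from the head, a record of the same cell in the previous row has no head and passes
           its symbol on. *)
        -- assert (Hp' : p' < 2 ^ N) by (destruct Hy as (s & _ & _ & ? & _); auto).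
           destruct (cell_total t p') as [z Hz]; [lia|auto|].
           destruct (cell_ok _ _ _ _ _ _ Hz Hy) as [_ J]. destruct (J eq_refl) as (J1 & _).
           destruct (I _ _ Hz) as (Z1 & Z2 & _). rewrite J1, <- Z1 by auto.
           unfold next_sym. unfold is_head in Z2. destruct (snd z); auto. exfalso; tauto.
      * rewrite Ex in K2, K3. unfold moved in K2, K3. cbn [snd] in K2, K3.
        split; [intros Hy2; apply K3; auto|auto].
      * intros Hy2. rewrite Ex in K3. destruct K3 as [K3 _]; auto.
Qed.

Lemma cells_accept : accepts_within M w (2 ^ N).
Proof.
  pose proof (Nat.pow_nonzero 2 N ltac:(lia)) as P.
  destruct (cells_run (2 ^ N - 1)) as (c & R & Hh & I); [lia|].
  destruct (cell_total (2 ^ N - 1) (c_head c)) as [x Hx]; [lia|lia|].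
  destruct (I _ _ Hx) as (I1 & I2 & I3).
  assert (Hd : is_head x = true) by (apply I2; auto). specialize (I3 Hd).
  destruct (cell_ok _ _ _ _ _ _ Hx Hx) as [[_ L] _]. specialize (L ltac:(lia) Hd).
  destruct (in_contents M x (cell_in _ _ _ Hx)) as [[_ N0]|(q & q' & a' & d & Ex & Itr)].
  { unfold is_head in Hd. rewrite N0 in Hd; discriminate. }
  rewrite Ex in I3, L. simpl in I3, L. apply Nat.eqb_eq in I3, L.
  destruct (idle_sound M (Datatypes.S (2 ^ N - 1)) (init M w) (apply_trans c q' a' d))
    as (j & e & Hj & Re & Ae).
  - eapply nreach_snoc; eauto. exists q, (fst x), q', a', d. repeat split; auto.
  - exact L.
  - exists j, e. repeat split; auto. lia.
Qed.
End Decode.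

(** * From an accepting run to compatible records *)

Definition fires (c : config) (tr : trans) (c' : config) : Prop :=
  let '(q, a, q', a', d) := tr in
  c_state c = q /\ c_tape c (c_head c) = a /\ c' = apply_trans c q' a' d.

Definition content_eq_dec (x y : content) : {x = y} + {x <> y}.
Proof. repeat decide equality. Defined.

Fixpoint index_of (x : content) (l : list content) : nat :=
  match l with
  | [] => 0
  | y :: l => if content_eq_dec y x then 0 else S (index_of x l)
  end.

Lemma index_of_spec x l : In x l ->
  index_of x l < length l /\ nth (index_of x l) l (0, None) = x.
Proof.
  induction l as [|y l IH]; simpl; [tauto|]. intros Hx.
  destruct (content_eq_dec y x); [split; [lia|auto]|].
  destruct IH; [tauto|]. split; [lia|auto].
Qed.

Lemma alphabet_delta M q a q' b d : In (q, a, q', b, d) (idle_delta M) ->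
  In a (alphabet M) /\ In b (alphabet M).
Proof.
  unfold idle_delta. rewrite in_app_iff, in_map_iff. intros [I|(x & E & I)].
  - unfold alphabet. rewrite !in_app_iff, !in_flat_map.
    split; right; exists (q, a, q', b, d); simpl; auto.
  - injection E as <- <- <- <- <-; auto.
Qed.

Lemma init_alphabet M w p : In (c_tape (init M w) p) (alphabet M).
Proof.
  simpl c_tape. unfold alphabet. apply in_or_app; left.
  destruct (nth_in_or_default p (map sym w) 0) as [I| ->]; [|simpl; auto].
  apply in_map_iff in I as ([] & <- & _); simpl; auto.
Qed.

Lemma nstep_alphabet M c c' : nstep (idle_machine M) c c' ->
  (forall p, In (c_tape c p) (alphabet M)) -> forall p, In (c_tape c' p) (alphabet M).
Proof.
  intros (q & a & q' & a' & d & I & _ & _ & ->) A p.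
  destruct (alphabet_delta M _ _ _ _ _ I).
  cbn [apply_trans c_tape]. destruct (p =? c_head c); auto.
Qed.

(** Idle transitions exist only for symbols of the alphabet, whence the condition on the tape. *)
Lemma idle_extend M m c :
  (forall p, In (c_tape c p) (alphabet M)) -> c_state c = tm_accept M ->
  exists c', nreach (idle_machine M) m c c' /\ c_state c' = tm_accept M.
Proof.
  revert c; induction m as [|m IH]; intros c A E.
  - exists c; split; [constructor|auto].
  - set (a := c_tape c (c_head c)).
    assert (St : nstep (idle_machine M) c (apply_trans c (tm_accept M) a DS)).
    { exists (tm_accept M), a, (tm_accept M), a, DS. repeat split; auto.
      cbn [tm_delta idle_machine]. unfold idle_delta. apply in_or_app; right.
      apply in_map_iff. exists a; split; auto. apply A. }
    destruct (IH (apply_trans c (tm_accept M) a DS)) as (c' & R & E').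
    + eapply nstep_alphabet; eauto.
    + reflexivity.
    + exists c'; split; auto. eapply nreachS; eauto.
Qed.

Lemma nreach_idle M k m c c' : k <= m ->
  (forall p, In (c_tape c p) (alphabet M)) ->
  nreach M k c c' -> c_state c' = tm_accept M ->
  exists d, nreach (idle_machine M) m c d /\ c_state d = tm_accept M.
Proof.
  intros Hk A R. revert m Hk A. induction R as [c|k c c1 c2 Hs Hr IH]; intros m Hk A E.
  - apply idle_extend; auto.
  - destruct m as [|m]; [lia|].
    assert (St : nstep (idle_machine M) c c1).
    { destruct Hs as (q & a & q' & a' & d & I & K). exists q, a, q', a', d. split; auto.
      cbn [tm_delta idle_machine]. unfold idle_delta. apply in_or_app; auto. }
    destruct (IH m) as (d & Rd & Ed); [lia|eapply nstep_alphabet; eauto|auto|].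
    exists d; split; auto. eapply nreachS; eauto.
Qed.

Lemma nreach_trace M k c c' : nreach M k c c' ->
  exists (cf : nat -> config) (tf : nat -> trans), cf 0 = c /\ cf k = c' /\
    forall t, t < k -> In (tf t) (tm_delta M) /\ fires (cf t) (tf t) (cf (S t)).
Proof.
  induction 1 as [c|k c c1 c2 Hs Hr IH].
  - exists (fun _ => c), (fun _ => (0, 0, 0, 0, DS)). repeat split; lia.
  - destruct IH as (cf & tf & E0 & Ek & F).
    destruct Hs as (q & a & q' & a' & d & I & Eq & Ea & E1).
    exists (fun t => match t with 0 => c | S t => cf t end),
           (fun t => match t with 0 => (q, a, q', a', d) | S t => tf t end).
    repeat split; auto; destruct t as [|t]; auto; try (apply F; lia).
    simpl. rewrite E0. auto.
Qed.

Section Encode.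
Context (M : TM) (w : list bool) (N : nat) (cf : nat -> config) (tf : nat -> trans).
Context (C0 : cf 0 = init M w) (CB : c_state (cf (2 ^ N)) = tm_accept M).
Context (CF : forall t, t < 2 ^ N ->
          In (tf t) (idle_delta M) /\ fires (cf t) (tf t) (cf (S t))).
Notation n := (length w).
Notation Q := (length (contents M)).
Notation vd := (vid M).
Notation arr := (layout w N).

Definition run_content (t p : nat) : content :=
  (c_tape (cf t) p, if p =? c_head (cf t) then Some (tf t) else None).

(** Truncated subtraction sends all input cells to bit 0, where [carryb] is true, as the carry chain
    demands. *)
Definition run_record (t p : nat) : nat -> bool :=
  field_val M (fun k i =>
    match k with
    | 0 => Nat.testbit t (i - n)
    | 1 => Nat.testbit p (i - n)
    | 2 => carryb t (i - n)
    | 3 => carryb p (i - n)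
    | 4 => p =? i
    | S (S (S (S (S k)))) => k =? index_of (run_content t p) (contents M)
    end).

Lemma run_alphabet t : t <= 2 ^ N -> forall p, In (c_tape (cf t) p) (alphabet M).
Proof.
  induction t as [|t IH]; intros Ht p; [rewrite C0; apply init_alphabet|].
  destruct (CF t ltac:(lia)) as [I F]. unfold fires in F.
  destruct (tf t) as [[[[q a] q'] a'] d]. destruct F as (_ & _ & ->).
  apply alphabet_delta in I. cbn [apply_trans c_tape]. destruct (p =? c_head (cf t)); [tauto|]. apply IH; lia.
Qed.

Lemma run_content_in t p : t < 2 ^ N -> In (run_content t p) (contents M).
Proof.
  intros Ht. destruct (CF t Ht) as [I F]. unfold run_content, contents.
  rewrite in_app_iff, !in_map_iff. destruct (Nat.eqb_spec p (c_head (cf t))) as [->|].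
  - right. exists (tf t). unfold fires in F. destruct (tf t) as [[[[q a] q'] a'] d].
    destruct F as (_ & -> & _); auto.
  - left. exists (c_tape (cf t) p). split; auto. apply run_alphabet; lia.
Qed.

Lemma run_record_ok t p : t < 2 ^ N -> p < 2 ^ N ->
  record M w N (run_record t p) t p (run_content t p).
Proof.
  intros Ht Hp. unfold record, run_record.
  destruct (index_of_spec _ _ (run_content_in t p Ht)) as [Il Ie].
  repeat split; auto; try (intros j Hj; rewrite field_val_vid by lia).
  - f_equal; lia.
  - f_equal; lia.
  - replace (j - n) with 0 by lia; auto.
  - f_equal; lia.
  - replace (j - n) with 0 by lia; auto.
  - f_equal; lia.
  - auto.
  - exists (index_of (run_content t p) (contents M)).
    rewrite field_val_vid by lia. repeat split; auto. apply Nat.eqb_refl.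
  - intros k l Hk Hl. rewrite !field_val_vid by lia. simpl. rewrite !Nat.eqb_eq. lia.
Qed.

Lemma run_local t p : t < 2 ^ N -> local_ok M w N t p (run_content t p).
Proof.
  intros Ht. destruct (CF t Ht) as [I F]. unfold local_ok, run_content. simpl fst. split.
  - intros ->. rewrite C0 in *. split; auto. simpl c_head.
    destruct (Nat.eqb_spec p 0) as [->|]; [|auto]. simpl.
    unfold fires in F. destruct (tf 0) as [[[[q a] q'] a'] d]. simpl in *.
    apply Nat.eqb_eq; symmetry; apply F.
  - intros E. unfold is_head, leads_to. simpl.
    destruct (p =? c_head (cf t)); [|discriminate]. intros _.
    rewrite E in F. unfold fires in F. destruct (tf t) as [[[[q a] q'] a'] d].
    destruct F as (_ & _ & F). rewrite F in CB. apply Nat.eqb_eq. exact CB.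
Qed.

Lemma run_step t p p' : S t < 2 ^ N -> step_ok (run_content t p) p (run_content (S t) p') p'.
Proof.
  intros Ht. destruct (CF t ltac:(lia)) as [_ F]. destruct (CF (S t) Ht) as [_ F'].
  unfold step_ok, run_content, fires in *. cbn [fst snd].
  destruct (tf t) as [[[[q a] q'] a'] d] eqn:Et. destruct F as (F1 & F2 & F3).
  split; [|split].
  - intros ->. unfold next_sym. cbn [fst snd]. rewrite F3. cbn [apply_trans c_tape].
    destruct (Nat.eqb_spec p (c_head (cf t))); auto.
  - unfold moved, is_head. cbn [snd]. destruct (Nat.eqb_spec p (c_head (cf t))) as [->|]; [|tauto].
    intros ->. rewrite F3. cbn [apply_trans c_head]. rewrite Nat.eqb_refl. auto.
  - unfold moved, is_head, linked, starts_in. cbn [snd].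
    destruct (Nat.eqb_spec p (c_head (cf t))) as [->|]; [|discriminate].
    destruct (Nat.eqb_spec p' (c_head (cf (S t)))) as [->|]; [|discriminate].
    intros _ _. rewrite F3 in *. cbn [apply_trans c_head c_state] in *. split; auto.
    destruct (tf (S t)) as [[[[r b] r'] b'] d']. apply Nat.eqb_eq. destruct F' as (<- & _); auto.
Qed.

Definition run_records : list (nat -> bool) :=
  map (fun tp => run_record (fst tp) (snd tp)) (list_prod (seq 0 (2 ^ N)) (seq 0 (2 ^ N))).

Lemma run_records_in s : In s run_records <->
  exists t p, t < 2 ^ N /\ p < 2 ^ N /\ s = run_record t p.
Proof.
  unfold run_records. rewrite in_map_iff. split.
  - intros ([t p] & <- & I). apply in_prod_iff in I as [A B]. apply in_seq in A, B.
    exists t, p; repeat split; auto; lia.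
  - intros (t & p & A & B & ->). exists (t, p). split; auto.
    apply in_prod; apply in_seq; lia.
Qed.

Lemma address_in_inv x : In x (address M arr) ->
  exists j, j < N /\ (x = vd 0 (n + j) \/ x = vd 1 (n + j)).
Proof.
  unfold address. rewrite in_flat_map. intros (i & Hi & Hx).
  apply in_seq in Hi. rewrite layout_length in Hi.
  destruct (le_lt_dec n i).
  - exists (i - n). replace i with (n + (i - n)) in Hx at 1 by lia.
    rewrite layout_bit in Hx by lia. split; [lia|]. replace (n + (i - n)) with i by lia.
    destruct Hx as [<-|[<-|[]]]; auto.
  - rewrite layout_flag in Hx by auto. destruct Hx.
Qed.

Lemma run_realizable :
  realizable (fields M arr) (address M arr) (Good M arr) (fun s => In s run_records).
Proof.
  split.
  - intros s1 s2 H1 H2. apply run_records_in in H1 as (t & p & Ht & Hp & ->).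
    apply run_records_in in H2 as (t' & p' & Ht' & Hp' & ->).
    apply (Good_iff M w N _ _ _ _ _ _ _ _ (run_record_ok t p Ht Hp) (run_record_ok t' p' Ht' Hp')).
    split; [apply run_local; auto|]. intros ->. apply run_step; auto.
  - intros v.
    destruct (bits_exist (fun j => v (vd 0 (n + j))) N) as (t & Ht & Et).
    destruct (bits_exist (fun j => v (vd 1 (n + j))) N) as (p & Hp & Ep).
    exists (run_record t p). split; [apply run_records_in; eauto|].
    intros x Hx. apply address_in_inv in Hx as (j & Hj & [->| ->]);
      unfold run_record; rewrite field_val_vid by lia.
    + rewrite <- Et by auto. f_equal; lia.
    + rewrite <- Ep by auto. f_equal; lia.
Qed.
End Encode.

(** * Atoms and implication height of the compatibility formula *)

Section Shape.
Context (M : TM) (arr : list nat).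
Notation K := (length arr).
Notation Q := (length (contents M)).
Notation GA := (guess_atom (fields M arr)).

Lemma flag0_in : In (vid M 4 0) (fields M arr).
Proof. left; auto. Qed.

Lemma fixed_in k : k < Q -> In (vid M (5 + k) 0) (fields M arr).
Proof.
  intros. unfold fields. rewrite !in_app_iff. left; right.
  apply in_map_iff. exists k; split; auto. apply in_seq; lia.
Qed.

Lemma loop_in x : (exists i, i < K /\
   In x [vid M 0 i; vid M 1 i; vid M 2 (S i); vid M 3 (S i); vid M 4 (S i)]) -> In x (fields M arr).
Proof.
  intros (i & Hi & Hx). unfold fields. rewrite !in_app_iff. right. apply in_flat_map.
  exists i; split; auto. apply in_seq; lia.
Qed.

Lemma bit_in k i : k < 2 -> i < K -> In (vid M k i) (fields M arr).
Proof.
  intros Hk Hi. apply loop_in. exists i; split; auto.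
  destruct k as [|[|]]; [..|lia]; simpl; auto.
Qed.

Lemma ext_in k i : 2 <= k <= 4 -> i <= K -> In (vid M k i) (fields M arr).
Proof.
  intros Hk Hi. destruct i as [|i].
  - unfold fields. rewrite !in_app_iff. left; left.
    destruct k as [|[|[|[|[|]]]]]; simpl; auto; lia.
  - apply loop_in. exists i; split; auto.
    destruct k as [|[|[|[|[|]]]]]; simpl; auto; lia.
Qed.

Lemma address_incl : incl (address M arr) (fields M arr).
Proof.
  intros x Hx. unfold address in Hx. apply in_flat_map in Hx as (i & Hi & Hx). apply in_seq in Hi.
  destruct (is_bit arr i); [|destruct Hx].
  destruct Hx as [<-|[<-|[]]]; apply bit_in; lia.
Qed.

Definition shaped (h : nat) (f : form) : Prop := pure GA f /\ imp_height f <= h.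

Lemma shaped_lit h c b k i : In (vid M k i) (fields M arr) -> shaped h (lit M c b k i).
Proof. intros I. split; [right; exists (vid M k i), c, b; auto|simpl; lia]. Qed.
Lemma shaped_And h f g : shaped h f -> shaped h g -> shaped h (And f g).
Proof. intros [] []. split; [split; auto|simpl; lia]. Qed.
Lemma shaped_Or h f g : shaped h f -> shaped h g -> shaped h (Or f g).
Proof. intros [] []. split; [split; auto|simpl; lia]. Qed.
Lemma shaped_Imp h f g : shaped h f -> shaped h g -> shaped (S h) (Imp f g).
Proof. intros [] []. split; [split; auto|simpl; lia]. Qed.
Lemma shaped_ff h : shaped h ff.
Proof. split; [left; auto|simpl; lia]. Qed.
Lemma shaped_tt h : shaped h (tt M).
Proof. apply shaped_Or; apply (shaped_lit h _ _ 4 0), flag0_in. Qed.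
Lemma shaped_mono h f : shaped 0 f -> shaped h f.
Proof. intros []; split; auto; lia. Qed.

Lemma shaped_conjs h l z : (forall f, In f l -> shaped h f) -> shaped h z -> shaped h (conjs l z).
Proof.
  intros Hl Hz. induction l; simpl; auto. apply shaped_And; [apply Hl|apply IHl; intros; apply Hl];
    simpl; auto.
Qed.
Lemma shaped_disjs h l z : (forall f, In f l -> shaped h f) -> shaped h z -> shaped h (disjs l z).
Proof.
  intros Hl Hz. induction l; simpl; auto. apply shaped_Or; [apply Hl|apply IHl; intros; apply Hl];
    simpl; auto.
Qed.

Lemma shaped_all F : (forall i, i < K -> shaped 0 (F i)) -> shaped 0 (all_cells M arr F).
Proof.
  intros HF. apply shaped_conjs; [|apply shaped_tt]. intros f Hf.
  apply in_map_iff in Hf as (i & <- & Hi). apply in_seq in Hi. apply HF; lia.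
Qed.
Lemma shaped_any F : (forall i, i < K -> shaped 0 (F i)) -> shaped 0 (any_cell arr F).
Proof.
  intros HF. apply shaped_disjs; [|apply shaped_ff]. intros f Hf.
  apply in_map_iff in Hf as (i & <- & Hi). apply in_seq in Hi. apply HF; lia.
Qed.
Lemma shaped_has P c : shaped 0 (has M P c).
Proof.
  apply shaped_disjs; [|apply shaped_ff]. intros f Hf.
  apply in_map_iff in Hf as (k & <- & Hk). apply filter_In in Hk as [Hk _]. apply in_seq in Hk.
  apply shaped_lit, fixed_in; lia.
Qed.
Lemma shaped_has_pair R : shaped 0 (has_pair M R).
Proof.
  apply shaped_disjs; [|apply shaped_ff]. intros f Hf.
  apply in_map_iff in Hf as (k & <- & Hk). apply in_seq in Hk.
  apply shaped_And; [apply shaped_lit, fixed_in; lia|apply shaped_has].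
Qed.
Lemma shaped_one : shaped 0 (one_content M).
Proof.
  apply shaped_And; [apply shaped_has|apply shaped_conjs; [|apply shaped_tt]].
  intros f Hf. apply in_map_iff in Hf as ([a b] & <- & Hk).
  apply in_prod_iff in Hk as [Ha Hb]. apply in_seq in Ha, Hb. simpl fst; simpl snd.
  destruct (a =? b); [apply shaped_tt|].
  apply shaped_Or; apply shaped_lit, fixed_in; lia.
Qed.

Ltac shape :=
  repeat match goal with
  | H : shaped 0 ?f |- shaped 0 ?f => exact H
  | |- shaped _ (And _ _) => apply shaped_And
  | |- shaped _ (Or _ _) => apply shaped_Or
  | |- shaped _ (all_cells _ _ _) => apply shaped_all; intros
  | |- shaped _ (any_cell _ _) => apply shaped_any; intros
  | |- shaped _ (has _ _ _) => apply shaped_has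
  | |- shaped _ (has_pair _ _) => apply shaped_has_pair
  | |- shaped _ (tt _) => apply shaped_tt
  | |- shaped _ ff => apply shaped_ff
  | |- shaped _ (lit _ _ _ _ _) => apply shaped_lit; first [apply bit_in; lia | apply ext_in; lia]
  | |- shaped _ (if ?b then _ else _) => destruct b
  end.

Lemma shaped_zero c k : k < 2 -> shaped 0 (zero M arr c k).
Proof. intros; unfold zero; shape. Qed.
Lemma shaped_carry k kc : k < 2 -> 2 <= kc <= 3 -> shaped 0 (carry M arr k kc).
Proof. intros; unfold carry, eq_lit; shape. Qed.
Lemma shaped_succ c c' k kc : k < 2 -> 2 <= kc <= 3 -> shaped 0 (succ M arr c c' k kc).
Proof. intros; unfold succ; shape. Qed.
Lemma shaped_same : shaped 0 (same_cell M arr).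
Proof. intros; unfold same_cell, eq_lit; shape. Qed.

Lemma shaped_Good : shaped 1 (Good M arr).
Proof.
  apply shaped_conjs; [|apply shaped_tt].
  assert (Z0 : shaped 0 (zero M arr false 0)) by (apply shaped_zero; lia).
  assert (Z1 : shaped 0 (zero M arr false 1)) by (apply shaped_zero; lia).
  assert (T : shaped 0 (tick M arr)) by (apply shaped_succ; lia).
  assert (R : shaped 0 (right M arr)) by (apply shaped_succ; lia).
  assert (L : shaped 0 (left M arr)) by (apply shaped_succ; lia).
  assert (B : shaped 0 (both_zero M arr)) by (apply shaped_And; apply shaped_zero; lia).
  assert (S := shaped_same).
  intros f Hf. unfold clauses, eq_lit in Hf. cbn [In] in Hf.
  repeat (destruct Hf as [<-|Hf];
    [first [apply shaped_mono; apply shaped_one | apply shaped_mono, shaped_carry; lia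
           |apply shaped_Imp; shape]|]).
  destruct Hf.
Qed.
End Shape.

Definition reduction (md : mode) (M : TM) (arr : list nat) : form :=
  Phi md (fields M arr) (address M arr) (vid M 4 0) (Good M arr).

Lemma reduction_correct md M w N :
  accepts_within M w (2 ^ N) <-> has_equilibrium_model (reduction md M (layout w N)).
Proof.
  pose proof (flag0_in M (layout w N)). pose proof (address_incl M (layout w N)).
  destruct (shaped_Good M (layout w N)) as [P _].
  split.
  - intros (k & c & Hk & R & A).
    destruct (nreach_idle M k (2 ^ N) (init M w) c) as (d & Rd & Ad); auto using init_alphabet.
    destruct (nreach_trace _ _ _ _ Rd) as (cf & tf & C0 & Cd & F).
    apply Phi_complete with (S := run_records M w N cf tf); auto.
    apply run_realizable; auto. rewrite Cd; auto.
  - intros (T & HT). apply Phi_sound in HT as (S & HS); auto.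
    eapply cells_accept; eauto.
Qed.

Lemma reduction_THT md M arr : THT 2 1 (ops md) (reduction md M arr).
Proof. destruct (shaped_Good M arr). eapply THT_Phi; eauto. Qed.

(** * A small assembler for Turing machines *)

Definition row := nat -> nat * nat * dir.

(** The greatest tape symbol is 19, an array cell holding 3 with both marks. *)
Definition num_syms := 20.

(** Program lines become states. A state past the last line has no transition, so a program halts by
    running off its end. *)
Definition assemble (rows : list row) : TM :=
  mkTM (flat_map (fun q => map (fun a => let '(q', b, d) := nth q rows (fun _ => (0, 0, DS)) a in
                                         (q, a, q', b, d)) (seq 0 num_syms))
                 (seq 0 (length rows))) 0 0.

Definition rstep (rows : list row) (c : config) : option config :=
  match nth_error rows (c_state c) with
  | Some r => let '(q', b, d) := r (c_tape c (c_head c)) in Some (apply_trans c q' b d)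
  | None => None
  end.

Lemma find_unique {A} (f : A -> bool) l x :
  In x l -> f x = true -> (forall y, In y l -> f y = true -> y = x) -> find f l = Some x.
Proof.
  induction l as [|a l IH]; simpl; [tauto|]. intros Hx Fx U.
  destruct (f a) eqn:Fa; [f_equal; auto|]. apply IH; auto.
  destruct Hx as [->|]; [congruence|auto].
Qed.

Lemma in_assemble rows q a q' b d :
  In (q, a, q', b, d) (tm_delta (assemble rows)) <->
  q < length rows /\ a < num_syms /\ nth q rows (fun _ => (0, 0, DS)) a = (q', b, d).
Proof.
  unfold assemble. cbn [tm_delta]. rewrite in_flat_map. split.
  - intros (q0 & Hq & I). apply in_map_iff in I as (a0 & E & Ha). apply in_seq in Hq, Ha.
    destruct (nth q0 rows _ a0) as [[q1 b1] d1] eqn:En. injection E as <- <- <- <- <-.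
    repeat split; auto; lia.
  - intros (Hq & Ha & E). exists q. split; [apply in_seq; lia|].
    apply in_map_iff. exists a. rewrite E. split; auto. apply in_seq; lia.
Qed.

Lemma dstep_assemble rows c :
  c_tape c (c_head c) < num_syms -> dstep (assemble rows) c = rstep rows c.
Proof.
  intros Ha. unfold dstep, rstep. destruct (nth_error rows (c_state c)) as [r|] eqn:E.
  - assert (Hq : c_state c < length rows) by (apply nth_error_Some; congruence).
    apply nth_error_nth with (d := fun _ => (0, 0, DS)) in E.
    destruct (r (c_tape c (c_head c))) as [[q' b] d] eqn:Er.
    rewrite find_unique with (x := (c_state c, c_tape c (c_head c), q', b, d)); auto.
    + apply in_assemble. rewrite E; auto.
    + rewrite !Nat.eqb_refl; auto.
    + intros [[[[q a] q1] b1] d1] I F. apply in_assemble in I as (_ & _ & I).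
      apply andb_true_iff in F as [F1 F2]. apply Nat.eqb_eq in F1, F2. subst q a.
      rewrite E, Er in I. congruence.
  - apply nth_error_None in E.
    destruct (find _ _) as [[[[[q a] q1] b1] d1]|] eqn:F; auto.
    apply find_some in F as [I F]. apply in_assemble in I as (I & _).
    apply andb_true_iff in F as [F1 F2]. apply Nat.eqb_eq in F1. lia.
Qed.

Inductive runs (rows : list row) : nat -> config -> config -> Prop :=
| runs_refl c : runs rows 0 c c
| runs_step k c c1 c2 : c_tape c (c_head c) < num_syms -> rstep rows c = Some c1 ->
    runs rows k c1 c2 -> runs rows (S k) c c2.

Lemma runs_trans rows k l c c1 c2 :
  runs rows k c c1 -> runs rows l c1 c2 -> runs rows (k + l) c c2.
Proof. induction 1; simpl; auto. intros; eapply runs_step; eauto. Qed.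

Lemma drun_runs rows k m c c' : runs rows k c c' -> k <= m ->
  c_tape c' (c_head c') < num_syms -> length rows <= c_state c' ->
  drun (assemble rows) m c = Some c'.
Proof.
  intros R Hk Ha Hq. revert m Hk. induction R as [c|k c c1 c2 Hs Hr R IH]; intros m Hk.
  - assert (D : dstep (assemble rows) c = None).
    { rewrite dstep_assemble by auto. unfold rstep.
      rewrite (proj2 (nth_error_None _ _)) by auto. auto. }
    destruct m; simpl; rewrite D; auto.
  - destruct m as [|m]; [lia|]. simpl. rewrite dstep_assemble, Hr by auto. apply IH; auto; lia.
Qed.

Definition scan (stop : nat -> bool) (f : nat -> nat) (d : dir) (pc : nat) : row :=
  fun a => if stop a then (S pc, a, DS) else (pc, f a, d).
Definition write (f : nat -> nat) (d : dir) (pc : nat) : row := fun a => (S pc, f a, d).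
Definition jump (cond : nat -> bool) (target pc : nat) : row :=
  fun a => (if cond a then target else S pc, a, DS).

Definition code_at (rows : list row) (pc : nat) (l : list row) : Prop :=
  forall i r, nth_error l i = Some r -> nth_error rows (pc + i) = Some r.

Lemma code_at_app rows pc l1 l2 :
  code_at rows pc (l1 ++ l2) <-> code_at rows pc l1 /\ code_at rows (pc + length l1) l2.
Proof.
  unfold code_at. split.
  - intros H; split; intros i r E.
    + apply H. rewrite nth_error_app1; auto. apply nth_error_Some; congruence.
    + rewrite <- Nat.add_assoc. apply H. rewrite nth_error_app2 by lia. rewrite <- E. f_equal; lia.
  - intros [H1 H2] i r E. destruct (le_lt_dec (length l1) i) as [L|L].
    + rewrite nth_error_app2 in E by auto. apply H2 in E. rewrite <- E. f_equal; lia.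
    + rewrite nth_error_app1 in E by auto. auto.
Qed.

Lemma code_at_cons rows pc r l :
  code_at rows pc (r :: l) <-> nth_error rows pc = Some r /\ code_at rows (S pc) l.
Proof.
  change (r :: l) with ([r] ++ l). rewrite code_at_app. simpl length. rewrite Nat.add_1_r.
  unfold code_at at 1. split; intros [H1 H2]; split; auto.
  - specialize (H1 0 r eq_refl). rewrite Nat.add_0_r in H1; auto.
  - intros [|i] r' E; [|destruct i; discriminate]. simpl in E. rewrite Nat.add_0_r. congruence.
Qed.

Definition at_pc (pc h : nat) (t : nat -> nat) : config := mkConfig pc h t.

Definition upd (t : nat -> nat) (p a : nat) : nat -> nat := fun j => if j =? p then a else t j.

Lemma upd_id t p : upd t p (t p) = t.
Proof. apply functional_extensionality; intros j. unfold upd. destruct (Nat.eqb_spec j p); subst; auto. Qed.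

Lemma run_row (rows : list row) pc h t (r : row) q' b d : nth_error rows pc = Some r -> t h < num_syms ->
  r (t h) = (q', b, d) -> runs rows 1 (at_pc pc h t) (at_pc q' (move d h) (upd t h b)).
Proof.
  intros E A R. eapply runs_step; [exact A| |apply runs_refl].
  unfold rstep, at_pc. cbn [c_state c_tape c_head]. rewrite E, R. reflexivity.
Qed.

Lemma run_stay (rows : list row) pc h t (r : row) q' :
  nth_error rows pc = Some r -> t h < num_syms -> r (t h) = (q', t h, DS) ->
  runs rows 1 (at_pc pc h t) (at_pc q' h t).
Proof.
  intros E A R. pose proof (run_row rows pc h t r q' (t h) DS E A R) as K.
  rewrite upd_id in K. exact K.
Qed.

Lemma run_write (rows : list row) pc h t f d : nth_error rows pc = Some (write f d pc) -> t h < num_syms ->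
  runs rows 1 (at_pc pc h t) (at_pc (S pc) (move d h) (upd t h (f (t h)))).
Proof. intros E A. eapply run_row; eauto. Qed.

Lemma run_jump (rows : list row) pc h t cond target : nth_error rows pc = Some (jump cond target pc) ->
  t h < num_syms ->
  runs rows 1 (at_pc pc h t) (at_pc (if cond (t h) then target else S pc) h t).
Proof.
  intros E A. eapply run_stay; eauto.
Qed.

Lemma run_scan_right (rows : list row) pc stop f m : forall h t,
  nth_error rows pc = Some (scan stop f DR pc) ->
  (forall j, h <= j <= h + m -> t j < num_syms) ->
  (forall j, h <= j < h + m -> stop (t j) = false) -> stop (t (h + m)) = true ->
  runs rows (S m) (at_pc pc h t)
    (at_pc (S pc) (h + m) (fun j => if (h <=? j) && (j <? h + m) then f (t j) else t j)).
Proof.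
  induction m as [|m IH]; intros h t E A F St.
  - rewrite Nat.add_0_r in *.
    replace (fun j => if (h <=? j) && (j <? h) then f (t j) else t j) with t.
    + eapply run_stay; [eauto|apply A; lia|]. unfold scan. rewrite St; auto.
    + apply functional_extensionality; intros j.
      destruct (Nat.leb_spec h j), (Nat.ltb_spec j h); simpl; auto; lia.
  - change (S (S m)) with (1 + S m). eapply runs_trans.
    + eapply run_row; [eauto|apply A; lia|]. unfold scan. rewrite F by lia. reflexivity.
    + simpl move. specialize (IH (S h) (upd t h (f (t h))) E).
      replace (h + S m) with (S h + m) by lia.
      assert (U : forall j, S h <= j -> upd t h (f (t h)) j = t j).
      { intros j Hj. unfold upd. destruct (Nat.eqb_spec j h); auto; lia. }
      replace (fun j => if (h <=? j) && (j <? S h + m) then f (t j) else t j) with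
        (fun j => if (S h <=? j) && (j <? S h + m) then f (upd t h (f (t h)) j) else upd t h (f (t h)) j).
      * apply IH; intros; rewrite U by lia; [apply A|apply F|rewrite <- St; do 2 f_equal]; lia.
      * apply functional_extensionality; intros j. unfold upd.
        destruct (Nat.eqb_spec j h); destruct (Nat.leb_spec (S h) j), (Nat.leb_spec h j),
          (Nat.ltb_spec j (S h + m)); simpl; subst; auto; lia.
Qed.

Lemma run_find_right (rows : list row) pc stop h q t :
  nth_error rows pc = Some (scan stop (fun a => a) DR pc) -> h <= q ->
  (forall j, h <= j <= q -> t j < num_syms) ->
  (forall j, h <= j < q -> stop (t j) = false) -> stop (t q) = true ->
  runs rows (S (q - h)) (at_pc pc h t) (at_pc (S pc) q t).
Proof.
  intros E L A F St.
  pose proof (run_scan_right rows pc stop (fun a => a) (q - h) h t E) as R.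
  replace (h + (q - h)) with q in R by lia.
  replace (fun j => if (h <=? j) && (j <? q) then t j else t j) with t in R; auto.
  apply functional_extensionality; intros j. destruct (_ && _); auto.
Qed.

Lemma run_find_left (rows : list row) pc stop m : forall q t,
  nth_error rows pc = Some (scan stop (fun a => a) DL pc) ->
  (forall j, q <= j <= q + m -> t j < num_syms) ->
  (forall j, q < j <= q + m -> stop (t j) = false) -> stop (t q) = true ->
  runs rows (S m) (at_pc pc (q + m) t) (at_pc (S pc) q t).
Proof.
  induction m as [|m IH]; intros q t E A F St.
  - rewrite Nat.add_0_r in *. eapply run_stay; [eauto|apply A; lia|]. unfold scan. rewrite St; auto.
  - change (S (S m)) with (1 + S m). eapply runs_trans.
    + eapply run_row; [eauto|apply A; lia|]. unfold scan. rewrite F by lia. reflexivity.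
    + rewrite upd_id. replace (move DL (q + S m)) with (q + m) by (simpl; lia).
      apply IH; auto; intros; [apply A|apply F]; lia.
Qed.

(** * Loop programs over a marked array *)

(* Tape symbols: 0 blank; 1, 2 raw bits; 3 left end; 4 erased; 4 + b output of b;
   4 + 4b, ..., 7 + 4b an array cell holding b, with its two cursor marks (1 <= b <= 3). *)
Definition cell (b : nat) (outer inner : bool) : nat :=
  4 + 4 * b + (if outer then 2 else 0) + (if inner then 1 else 0).
Definition is_cell (a : nat) : bool := 8 <=? a.
Definition marked (l : bool) (a : nat) : bool := is_cell a && Nat.testbit a (if l then 0 else 1).
Definition set_mark (l : bool) (a : nat) : nat := a + (if l then 1 else 2).
Definition clear_mark (l : bool) (a : nat) : nat := a - (if l then 1 else 2).
Definition base (a : nat) : nat := a / 4 - 1.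

Definition valid (l : list nat) : Prop := Forall (fun b => 1 <= b <= 3) l.

Lemma valid_nth l k : valid l -> k < length l -> 1 <= nth k l 0 <= 3.
Proof. intros V H. apply (proj1 (Forall_forall _ l) V). apply nth_In; auto. Qed.

Lemma cell_spec b m0 m1 : 1 <= b <= 3 ->
  is_cell (cell b m0 m1) = true /\ cell b m0 m1 < num_syms /\
  marked false (cell b m0 m1) = m0 /\ marked true (cell b m0 m1) = m1 /\
  base (cell b m0 m1) = b /\
  set_mark false (cell b false m1) = cell b true m1 /\ set_mark true (cell b m0 false) = cell b m0 true /\
  clear_mark false (cell b true m1) = cell b false m1 /\ clear_mark true (cell b m0 true) = cell b m0 false.
Proof.
  intros H. unfold num_syms. assert (b = 1 \/ b = 2 \/ b = 3) as [->|[->| ->]] by lia;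
    destruct m0, m1; cbv; repeat split; lia.
Qed.

(** [false] is the cursor of the outer loop, [true] that of the inner one. *)
Definition cursors := bool -> option nat.
Definition points (o : option nat) (k : nat) : bool :=
  match o with Some i => i =? k | None => false end.

(** From left to right: end marker, [D] cells erased by earlier stages, the array, the output
    written so far, blanks. *)
Definition frame (D : nat) (arr : list nat) (o : cursors) (out : list nat) : nat -> nat :=
  fun j =>
    if j =? 0 then 3
    else if j <=? D then 4
    else if j <=? D + length arr then
      let k := j - D - 1 in cell (nth k arr 0) (points (o false) k) (points (o true) k)
    else if j <=? D + length arr + length out then 4 + nth (j - D - length arr - 1) out 0
    else 0.

Section Frame.
Context (D : nat) (arr : list nat) (o : cursors) (out : list nat).
Context (Va : valid arr) (Vo : valid out).
Notation t := (frame D arr o out).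

Ltac cases j :=
  unfold frame; destruct (Nat.eqb_spec j 0); [try lia|destruct (Nat.leb_spec j D); [try lia|
    destruct (Nat.leb_spec j (D + length arr)); [try lia|
    destruct (Nat.leb_spec j (D + length arr + length out)); try lia]]].

Lemma frame_end : t 0 = 3.
Proof. reflexivity. Qed.

Lemma frame_erased j : 1 <= j <= D -> t j = 4.
Proof. intros. cases j; auto. Qed.

Lemma frame_cell k : k < length arr ->
  t (1 + D + k) = cell (nth k arr 0) (points (o false) k) (points (o true) k).
Proof.
  intros. remember (1 + D + k) as j eqn:E. cases j.
  replace (j - D - 1) with k by lia. auto.
Qed.

Lemma frame_out i : i < length out -> t (1 + D + length arr + i) = 4 + nth i out 0.
Proof.
  intros. remember (1 + D + length arr + i) as j eqn:E. cases j.
  replace (j - D - length arr - 1) with i by lia. auto.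
Qed.

Lemma frame_blank j : 1 + D + length arr + length out <= j -> t j = 0.
Proof. intros. cases j; auto. Qed.

Lemma frame_cases (P : nat -> Prop) j :
  (j = 0 -> P 3) -> (1 <= j <= D -> P 4) ->
  (forall k, k < length arr -> j = 1 + D + k ->
     P (cell (nth k arr 0) (points (o false) k) (points (o true) k))) ->
  (forall i, i < length out -> j = 1 + D + length arr + i -> P (4 + nth i out 0)) ->
  (1 + D + length arr + length out <= j -> P 0) -> P (t j).
Proof.
  intros H0 H1 H2 H3 H4. cases j;
    first [apply H0; lia|apply H1; lia|apply H2; lia|apply H3; lia|apply H4; lia].
Qed.

Lemma frame_bound j : t j < num_syms.
Proof.
  apply frame_cases; intros; unfold num_syms in *; try lia.
  - apply cell_spec, valid_nth; auto.
  - pose proof (valid_nth out i Vo). lia.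
Qed.

Lemma frame_inner j : 0 < j -> (t j =? 3) = false.
Proof.
  intros Hj. apply Nat.eqb_neq. apply (frame_cases (fun a => a <> 3)); intros; try lia.
  unfold cell. lia.
Qed.

Lemma frame_nonblank j : j < 1 + D + length arr + length out -> (t j =? 0) = false.
Proof.
  intros Hj. apply Nat.eqb_neq. apply (frame_cases (fun a => a <> 0)); intros; try lia.
  unfold cell. lia.
Qed.

Lemma frame_unmarked l j :
  (forall k, o l = Some k -> j <> 1 + D + k) -> marked l (t j) = false.
Proof.
  intros N. apply (frame_cases (fun a => marked l a = false)); auto.
  - intros k Hk ->. destruct (cell_spec _ (points (o false) k) (points (o true) k) (valid_nth arr k Va Hk))
      as (_ & _ & M0 & M1 & _).
    assert (points (o l) k = false).
    { unfold points. destruct (o l) eqn:E; auto. apply Nat.eqb_neq. intros ->. eapply N; eauto. }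
    destruct l; congruence.
  - intros i Hi _. pose proof (valid_nth out i Vo Hi). unfold marked, is_cell.
    destruct (Nat.leb_spec 8 (4 + nth i out 0)); auto. lia.
Qed.

Lemma frame_marked l k : o l = Some k -> k < length arr -> marked l (t (1 + D + k)) = true.
Proof.
  intros E Hk. rewrite frame_cell by auto.
  destruct (cell_spec _ (points (o false) k) (points (o true) k) (valid_nth arr k Va Hk))
      as (_ & _ & M0 & M1 & _).
  destruct l; [rewrite M1|rewrite M0]; unfold points; rewrite E; apply Nat.eqb_refl.
Qed.

Lemma frame_push b : upd t (1 + D + length arr + length out) (4 + b) = frame D arr o (out ++ [b]).
Proof.
  apply functional_extensionality; intros j. unfold upd, frame. rewrite length_app. simpl length.
  destruct (Nat.eqb_spec j (1 + D + length arr + length out)) as [E|E].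
  - destruct (Nat.eqb_spec j 0); [lia|]. destruct (Nat.leb_spec j D); [lia|].
    destruct (Nat.leb_spec j (D + length arr)); [lia|].
    destruct (Nat.leb_spec j (D + length arr + (length out + 1))); [|lia].
    rewrite app_nth2 by lia. replace (j - D - length arr - 1 - length out) with 0 by lia. auto.
  - destruct (j =? 0); auto. destruct (j <=? D); auto. destruct (Nat.leb_spec j (D + length arr)); auto.
    destruct (Nat.leb_spec j (D + length arr + length out)),
      (Nat.leb_spec j (D + length arr + (length out + 1))); auto; try lia.
    rewrite app_nth1; auto; lia.
Qed.
End Frame.

Definition point_at (l : bool) (k : nat) (o : cursors) : cursors :=
  fun m => if Bool.eqb m l then Some k else o m.

Lemma frame_set D arr o out l k : valid arr -> o l = None -> k < length arr ->
  upd (frame D arr o out) (1 + D + k) (set_mark l (frame D arr o out (1 + D + k))) =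
  frame D arr (point_at l k o) out.
Proof.
  intros Va E Hk. apply functional_extensionality; intros j. unfold upd.
  destruct (Nat.eqb_spec j (1 + D + k)) as [->|N].
  - rewrite !frame_cell by auto.
    destruct (cell_spec _ (points (o false) k) (points (o true) k) (valid_nth arr k Va Hk))
      as (_ & _ & M0 & M1 & _ & S0 & S1 & _).
    unfold point_at. destruct l; simpl; rewrite E, Nat.eqb_refl in *.
    + destruct (cell_spec _ (points (o false) k) false (valid_nth arr k Va Hk)); simpl points; tauto.
    + destruct (cell_spec _ false (points (o true) k) (valid_nth arr k Va Hk)); simpl points; tauto.
  - unfold frame. destruct (Nat.eqb_spec j 0); auto. destruct (Nat.leb_spec j D); auto.
    destruct (j <=? D + length arr); auto. cbv zeta.
    assert (Hj : k =? j - D - 1 = false) by (apply Nat.eqb_neq; lia).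
    unfold point_at. destruct l; simpl; rewrite E, Hj; auto.
Qed.

Lemma frame_clear D arr o out l k : valid arr -> o l = None -> k < length arr ->
  upd (frame D arr (point_at l k o) out) (1 + D + k)
      (clear_mark l (frame D arr (point_at l k o) out (1 + D + k))) =
  frame D arr o out.
Proof.
  intros Va E Hk. rewrite <- frame_set by auto. unfold upd.
  apply functional_extensionality; intros j. rewrite Nat.eqb_refl.
  destruct (Nat.eqb_spec j (1 + D + k)) as [->|N]; auto.
  rewrite !frame_cell by auto.
  destruct l; simpl; rewrite E; simpl points.
  - destruct (cell_spec _ (points (o false) k) false (valid_nth arr k Va Hk)) as (_&_&_&_&_&_& -> &_&_).
    destruct (cell_spec _ (points (o false) k) true (valid_nth arr k Va Hk)) as (_&_&_&_&_&_&_&_& ->). auto.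
  - destruct (cell_spec _ false (points (o true) k) (valid_nth arr k Va Hk)) as (_&_&_&_&_& -> &_&_&_).
    destruct (cell_spec _ true (points (o true) k) (valid_nth arr k Va Hk)) as (_&_&_&_&_&_&_& -> &_). auto.
Qed.

(** Running times stay single powers of one base under sequencing. *)
Lemma pow_add_le X a b : 2 <= X -> X ^ a + X ^ b <= X ^ (a + b + 1).
Proof.
  intros HX. rewrite Nat.add_1_r, Nat.pow_succ_r', Nat.pow_add_r.
  pose proof (Nat.pow_nonzero X a ltac:(lia)). pose proof (Nat.pow_nonzero X b ltac:(lia)).
  generalize dependent (X ^ a); generalize dependent (X ^ b); intros B HB A HA.
  assert (A + B <= 2 * (A * B)) by nia. nia.
Qed.

Lemma pow_le_mono X a b : 2 <= X -> a <= b -> X ^ a <= X ^ b.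
Proof. intros; apply Nat.pow_le_mono_r; lia. Qed.

(** * Program fragments that append to the output *)

Record frag := { code : nat -> list row; size : nat; code_length : forall pc, length (code pc) = size }.

Definition condition := list nat -> cursors -> Prop.

(** [X] bounds the tape including the output still to come, so one [X] serves all parts of a
    sequence and all rounds of a loop. The head starts and ends at the left end, which lets
    fragments compose. *)
Definition emits (ok : condition) (fr : frag) (G : list nat -> cursors -> list nat) (c : nat) : Prop :=
  forall rows pc, code_at rows pc (code fr pc) ->
  forall D arr o out X, valid arr -> valid out -> ok arr o ->
  D + length arr + length out + length (G arr o) + 2 <= X ->
  exists k, k <= X ^ c /\
    runs rows k (at_pc pc 0 (frame D arr o out)) (at_pc (pc + size fr) 0 (frame D arr o (out ++ G arr o))).

Definition gen (ok : condition) (G : list nat -> cursors -> list nat) : Prop :=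
  exists fr c, emits ok fr G c /\
    forall arr o, valid arr -> ok arr o ->
      valid (G arr o) /\ length (G arr o) <= (length arr + 2) ^ c.

Definition top : condition := fun arr o => o false = None /\ o true = None.
Definition within : condition := fun arr o =>
  (exists i, o false = Some i /\ i < length arr) /\ o true = None.
Definition nested : condition := fun arr o =>
  (exists i, o false = Some i /\ i < length arr) /\ (exists j, o true = Some j /\ j < length arr).

Definition cur (l : bool) (o : cursors) : nat := match o l with Some i => i | None => 0 end.

Lemma gen_ext (ok : condition) G G' :
  (forall arr o, ok arr o -> G arr o = G' arr o) -> gen ok G -> gen ok G'.
Proof.
  intros E (fr & c & H & L). exists fr, c. split.
  - intros rows pc Hc D arr o out X Va Vo K HX. rewrite <- E in * by auto. apply H; auto.
  - intros arr o Va K. rewrite <- E by auto. auto.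
Qed.

Lemma gen_nil ok : gen ok (fun _ _ => []).
Proof.
  exists {| code := fun _ => []; size := 0; code_length := fun _ => eq_refl |}, 0. split.
  - intros rows pc _ D arr o out X _ _ _ _. exists 0. split; [lia|].
    rewrite Nat.add_0_r, app_nil_r. constructor.
  - intros; split; [constructor|simpl; lia].
Qed.

Definition emit_code (b pc : nat) : list row :=
  [ scan (fun a => a =? 0) (fun a => a) DR pc;
    write (fun _ => 4 + b) DL (1 + pc);
    scan (fun a => a =? 3) (fun a => a) DL (2 + pc) ].

Lemma gen_emit ok b : 1 <= b <= 3 -> gen ok (fun _ _ => [b]).
Proof.
  intros Hb. exists {| code := emit_code b; size := 3; code_length := fun _ => eq_refl |}, 2. split.
  - intros rows pc Hc D arr o out X Va Vo _ HX. simpl length in HX.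
    cbn [code size] in *. unfold emit_code in Hc. rewrite !code_at_cons in Hc.
    destruct Hc as (R0 & R1 & R2 & _).
    set (e := 1 + D + length arr + length out).
    pose proof (frame_bound D arr o out Va Vo) as Bd.
    assert (Vo' : valid (out ++ [b])) by (apply Forall_app; split; auto; constructor; auto).
    pose proof (frame_bound D arr o (out ++ [b]) Va Vo') as Bd'.
    exists (S (e - 0) + (1 + S (e - 1))). split; [change (X ^ 2) with (X * (X * 1)); nia|].
    eapply runs_trans; [apply (run_find_right rows pc (fun a => a =? 0) 0 e); auto; try lia|].
    { intros j Hj. apply frame_nonblank; auto; lia. }
    { rewrite frame_blank; auto. }
    eapply runs_trans; [apply run_write; eauto|].
    pose proof (frame_push D arr o out b) as Fp. fold e in Fp. cbv beta. rewrite Fp.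
    replace (move DL e) with (e - 1) by (simpl; lia).
    replace (pc + 3) with (S (2 + pc)) by lia.
    replace (e - 1) with (0 + (e - 1)) at 2 by lia.
    apply (run_find_left rows (2 + pc) (fun a => a =? 3) (e - 1) 0); auto.
    intros j Hj. apply frame_inner; auto; lia.
  - intros arr o _ _. split; [constructor; auto|]. simpl length.
    rewrite <- (Nat.pow_1_l 2) at 1. apply Nat.pow_le_mono_l; lia.
Qed.

Definition seq_frag (f g : frag) : frag.
Proof.
  refine {| code := fun pc => code f pc ++ code g (pc + size f); size := size f + size g |}.
  intros pc. rewrite length_app, !code_length; auto.
Defined.

Lemma gen_app ok G G' : gen ok G -> gen ok G' -> gen ok (fun arr o => G arr o ++ G' arr o).
Proof.
  intros (f & c & E & L) (g & d & E' & L'). exists (seq_frag f g), (c + d + 1). split.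
  - intros rows pc Hc D arr o out X Va Vo K HX. cbn [code size seq_frag] in *.
    rewrite code_at_app, code_length in Hc. destruct Hc as [Hc Hc'].
    rewrite length_app in HX.
    destruct (L arr o Va K) as [V1 _]. destruct (L' arr o Va K) as [V2 _].
    destruct (E rows pc Hc D arr o out X Va Vo K) as (k & Hk & R); [lia|].
    destruct (E' rows _ Hc' D arr o (out ++ G arr o) X Va) as (k' & Hk' & R'); auto.
    { apply Forall_app; auto. } { rewrite length_app; lia. }
    exists (k + k'). split; [eapply Nat.le_trans; [|apply pow_add_le]; lia|].
    eapply runs_trans; eauto. rewrite app_assoc, Nat.add_assoc. exact R'.
  - intros arr o Va K. destruct (L arr o Va K) as [V1 L1]. destruct (L' arr o Va K) as [V2 L2].
    split; [apply Forall_app; auto|]. rewrite length_app.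
    eapply Nat.le_trans; [|apply pow_add_le; lia]. lia.
Qed.

Lemma gen_const ok l : valid l -> gen ok (fun _ _ => l).
Proof.
  induction 1 as [|b l Hb Hl IH]; [apply gen_nil|].
  apply (gen_app ok (fun _ _ => [b]) (fun _ _ => l)); auto. apply gen_emit; auto.
Qed.

(** The test is made at the mark, but the body must start at the left end; hence one return scan for
    each outcome, the second of which is skipped after the body. *)
Definition if_frag (l : bool) (test : nat -> bool) (f : frag) : frag.
Proof.
  refine {| code := fun pc =>
    [ scan (marked l) (fun a => a) DR pc;
      jump (fun a => negb (test (base a))) (pc + (4 + size f)) (1 + pc);
      scan (fun a => a =? 3) (fun a => a) DL (2 + pc) ] ++ code f (pc + 3) ++
    [ jump (fun _ => true) (pc + (5 + size f)) (pc + (3 + size f));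
      scan (fun a => a =? 3) (fun a => a) DL (pc + (4 + size f)) ]; size := 5 + size f |}.
  intros pc. rewrite !length_app, code_length. simpl. lia.
Defined.

Lemma gen_if (ok : condition) l (test : nat -> bool) G :
  (forall arr o, ok arr o -> exists i, o l = Some i /\ i < length arr) ->
  gen ok G ->
  gen ok (fun arr o => if test (nth (cur l o) arr 0) then G arr o else []).
Proof.
  intros Hok (f & c & E & L). exists (if_frag l test f), (3 + c + 1). split.
  - intros rows pc Hc D arr o out X Va Vo K HX. cbn [code size if_frag] in *.
    rewrite !code_at_app, !code_at_cons, code_length in Hc. simpl length in Hc.
    destruct Hc as ((R0 & R1 & R2 & _) & Hc & R3 & R4 & _).
    replace (pc + 3 + size f) with (pc + (3 + size f)) in R3, R4 by lia.
    replace (S (pc + (3 + size f))) with (pc + (4 + size f)) in R4 by lia.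
    destruct (Hok arr o K) as (i & Ei & Hi).
    assert (Ec : cur l o = i) by (unfold cur; rewrite Ei; auto). rewrite Ec in *.
    pose proof (frame_bound D arr o out Va Vo) as Bd.
    set (t := frame D arr o out) in *. set (p := 1 + D + i).
    assert (Bs : base (t p) = nth i arr 0).
    { unfold t, p. rewrite frame_cell by auto. apply cell_spec, valid_nth; auto. }
    assert (Rm : runs rows (S p + 1) (at_pc pc 0 t)
             (at_pc (if negb (test (nth i arr 0)) then pc + (4 + size f) else S (1 + pc)) p t)).
    { eapply runs_trans.
      - replace p with (p - 0) at 1 by lia.
        apply (run_find_right rows pc (marked l) 0 p t R0); auto; [lia|..].
        + intros j Hj. apply frame_unmarked; auto. intros k Hk. unfold p in *.
          rewrite Ei in Hk. injection Hk as <-. lia.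
        + apply frame_marked; auto.
      - rewrite <- Bs. apply (run_jump rows (S pc) p t _ _ R1); auto. }
    assert (Rl : forall q, nth_error rows q = Some (scan (fun a => a =? 3) (fun a => a) DL q) ->
              runs rows (S p) (at_pc q p t) (at_pc (S q) 0 t)).
    { intros q Rq. apply (run_find_left rows q (fun a => a =? 3) p 0 t Rq); auto.
      intros j Hj. apply frame_inner; auto; lia. }
    assert (Hp : 3 + (p + p + 1) <= X ^ 3 + (if test (nth i arr 0) then 0 else X ^ c)).
    { assert (2 <= X) by lia. pose proof (Nat.pow_nonzero X c).
      assert (p + 1 <= X). { unfold p. destruct (test (nth i arr 0)); lia. }
      change (X ^ 3) with (X * (X * (X * 1))). nia. }
    assert (HX2 : 2 <= X) by lia.
    destruct (test (nth i arr 0)).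
    + destruct (E rows (pc + 3) Hc D arr o out X Va Vo K HX) as (k & Hk & Rb).
      exists (S p + 1 + (S p + (k + 1))). split.
      { eapply Nat.le_trans; [|apply pow_add_le; lia]. lia. }
      simpl negb in Rm. eapply runs_trans; [exact Rm|].
      eapply runs_trans; [apply (Rl _ R2)|]. replace (S (S (S pc))) with (pc + 3) by lia.
      eapply runs_trans; [exact Rb|].
      replace (pc + 3 + size f) with (pc + (3 + size f)) by lia.
      apply (run_jump rows _ 0 _ _ _ R3). rewrite frame_end. unfold num_syms; lia.
    + exists (S p + 1 + S p). split.
      { eapply Nat.le_trans; [|apply pow_add_le; lia]. lia. }
      rewrite app_nil_r. eapply runs_trans; [exact Rm|]. simpl negb.
      replace (pc + (5 + size f)) with (S (pc + (4 + size f))) by lia. apply (Rl _ R4).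
  - intros arr o Va K. destruct (L arr o Va K) as [V1 L1].
    destruct (test _); [|split; [constructor|simpl; lia]].
    split; auto. eapply Nat.le_trans; [exact L1|]. apply pow_le_mono; lia.
Qed.

(** A loop ends right of the array or, with [upto], at the outer mark, after having visited only the
    cells strictly before it. *)
Definition loop_stop (upto : bool) (a : nat) : bool := negb (is_cell a) || (upto && marked false a).

(** The mark remembers the current cell while the body moves the head; it is cleared when stepping
    to the next cell, where the stop test is made. *)
Definition loop_frag (l upto : bool) (f : frag) : frag.
Proof.
  refine {| code := fun pc =>
    [ scan (fun a => negb ((a =? 3) || (a =? 4))) (fun a => a) DR pc;
      jump (loop_stop upto) (pc + (7 + size f)) (1 + pc);
      write (set_mark l) DS (2 + pc);
      scan (fun a => a =? 3) (fun a => a) DL (3 + pc) ] ++ code f (pc + 4) ++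
    [ scan (marked l) (fun a => a) DR (pc + (4 + size f));
      write (clear_mark l) DR (pc + (5 + size f));
      jump (fun _ => true) (1 + pc) (pc + (6 + size f));
      scan (fun a => a =? 3) (fun a => a) DL (pc + (7 + size f)) ]; size := 8 + size f |}.
  intros pc. rewrite !length_app, code_length. simpl. lia.
Defined.

Definition limit (upto : bool) (arr : list nat) (o : cursors) : nat :=
  if upto then cur false o else length arr.

Lemma gen_loop (ok ok' : condition) l (upto : bool) G :
  (forall arr o, ok arr o -> o l = None /\ limit upto arr o <= length arr /\
                 (upto = true -> l = true /\ o false = Some (limit upto arr o) /\ limit upto arr o < length arr)) ->
  (forall arr o k, ok arr o -> k < limit upto arr o -> ok' arr (point_at l k o)) ->
  gen ok' G ->
  gen ok (fun arr o => flat_map (fun k => G arr (point_at l k o)) (seq 0 (limit upto arr o))).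
Proof.
  intros Hok Hok' (f & c & E & L). exists (loop_frag l upto f), (c + 9). split.
  - intros rows pc Hc D arr o out X Va Vo K HX. cbn [code size loop_frag] in *.
    rewrite !code_at_app, !code_at_cons, code_length in Hc. simpl length in Hc.
    destruct Hc as ((R0 & R1 & R2 & R3 & _) & Hc & R4 & R5 & R6 & R7 & _).
    replace (pc + 4 + size f) with (pc + (4 + size f)) in * by lia.
    replace (S (pc + (4 + size f))) with (pc + (5 + size f)) in * by lia.
    replace (S (pc + (5 + size f))) with (pc + (6 + size f)) in * by lia.
    replace (S (pc + (6 + size f))) with (pc + (7 + size f)) in * by lia.
    destruct (Hok arr o K) as (El & Hm & Hu). specialize (Hok' arr o).
    set (m := limit upto arr o) in *.
    set (outk := fun k => out ++ flat_map (fun k => G arr (point_at l k o)) (seq 0 k)).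
    assert (HX2 : 2 <= X) by lia.
    assert (Vk : forall k, k <= m -> valid (outk k)).
    { intros k Hk. unfold outk. apply Forall_app; split; auto. apply Forall_flat_map, Forall_forall.
      intros j Hj. apply in_seq in Hj. apply L; auto. apply Hok'; auto; lia. }
    (* The output of the first [k] rounds is a prefix of the whole output, so [X] bounds every
       intermediate tape. *)
    assert (Lk : forall k, k <= m -> D + length arr + length (outk k) + 2 <= X).
    { intros k Hk. unfold outk. rewrite length_app.
      replace m with (k + (m - k)) in HX by lia. rewrite seq_app, flat_map_app, length_app in HX. lia. }
    assert (Step : forall k, k < m -> exists s, s <= X ^ (c + 4) /\
      runs rows s (at_pc (1 + pc) (1 + D + k) (frame D arr o (outk k)))
                  (at_pc (1 + pc) (1 + D + S k) (frame D arr o (outk (S k))))).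
    { intros k Hk. pose proof (Vk k ltac:(lia)) as V. pose proof (Vk (S k) ltac:(lia)) as V'.
      assert (OS : outk (S k) = outk k ++ G arr (point_at l k o)).
      { unfold outk. rewrite seq_S, flat_map_app. simpl. rewrite app_nil_r, app_assoc. auto. }
      destruct (E rows (pc + 4) Hc D arr (point_at l k o) (outk k) X Va V (Hok' k K Hk))
        as (b & Hb & Rb).
      { pose proof (Lk (S k) ltac:(lia)). rewrite OS, length_app in H. lia. }
      set (p := 1 + D + k) in *.
      exists (1 + (1 + (S p + (b + (S (p - 0) + (1 + 1)))))). split.
      { assert (p + 1 <= X) by (pose proof (Lk k ltac:(lia)); unfold p; lia).
        pose proof (pow_add_le X c 3 HX2). replace (c + 3 + 1) with (c + 4) in * by lia.
        eapply Nat.le_trans; [|exact H0]. change (X ^ 3) with (X * (X * (X * 1))).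
        destruct (Nat.eq_dec p 1) as [Ep|].
        - rewrite Ep. assert (3 <= X) by (pose proof (Lk k ltac:(lia)); unfold p in *; lia). nia.
        - assert (3 <= X) by lia. nia. }
      assert (Ct : frame D arr o (outk k) p = cell (nth k arr 0) (points (o false) k) (points (o true) k))
        by (apply frame_cell; lia).
      pose proof (cell_spec (nth k arr 0) (points (o false) k) (points (o true) k)) as CS.
      destruct CS as (C1 & C2 & C3 & _); [apply valid_nth; auto; lia|].
      eapply runs_trans. { apply (run_jump rows _ p _ _ _ R1). apply frame_bound; auto. }
      rewrite Ct. unfold loop_stop. rewrite C1, C3. simpl negb. rewrite orb_false_l.
      replace (upto && points (o false) k) with false.
      2: { destruct upto; auto. destruct (Hu eq_refl) as (_ & Eo & _). rewrite Eo. simpl.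
           symmetry; apply Nat.eqb_neq; lia. }
      eapply runs_trans. { apply (run_write rows _ p _ _ _ R2). apply frame_bound; auto. }
      pose proof (frame_set D arr o (outk k) l k Va El ltac:(lia)) as Fs. fold p in Fs.
      change (move DS p) with p. rewrite Fs.
      set (o' := point_at l k o) in *.
      eapply runs_trans.
      { apply (run_find_left rows (3 + pc) (fun a => a =? 3) p 0); auto.
        - intros j _. apply frame_bound; auto.
        - intros j Hj. apply frame_inner; auto; lia. }
      replace (S (3 + pc)) with (pc + 4) by lia.
      eapply runs_trans; [exact Rb|]. rewrite <- OS.
      replace (pc + 4 + size f) with (pc + (4 + size f)) by lia.
      assert (Eo' : o' l = Some k) by (unfold o', point_at; rewrite eqb_reflx; auto).
      eapply runs_trans.
      { apply (run_find_right rows _ (marked l) 0 p _ R4); [lia|..].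
        - intros j _. apply frame_bound; auto.
        - intros j Hj. apply frame_unmarked; auto. intros k' Hk'.
          rewrite Eo' in Hk'. injection Hk' as <-. unfold p in Hj; lia.
        - apply frame_marked; auto; lia. }
      replace (S (pc + (4 + size f))) with (pc + (5 + size f)) by lia.
      eapply runs_trans. { apply (run_write rows _ p _ _ _ R5). apply frame_bound; auto. }
      pose proof (frame_clear D arr o (outk (S k)) l k Va El ltac:(lia)) as Fc. fold p o' in Fc.
      change (move DR p) with (S p). rewrite Fc.
      replace (S (pc + (5 + size f))) with (pc + (6 + size f)) by lia.
      replace (1 + D + S k) with (S p) by (unfold p; lia).
      apply (run_jump rows _ (S p) _ _ _ R6). apply frame_bound; auto. }
    assert (Iter : forall k, k <= m -> exists s, s <= k * X ^ (c + 4) /\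
      runs rows s (at_pc (1 + pc) (1 + D + 0) (frame D arr o out))
                  (at_pc (1 + pc) (1 + D + k) (frame D arr o (outk k)))).
    { induction k as [|k IH]; intros Hk.
      - exists 0. split; [lia|]. unfold outk. simpl flat_map. rewrite app_nil_r. constructor.
      - destruct IH as (s & Hs & Rs); [lia|]. destruct (Step k) as (s' & Hs' & Rs'); [lia|].
        exists (s + s'). split; [simpl; lia|]. eapply runs_trans; eauto. }
    destruct (Iter m) as (s & Hs & Rs); auto.
    pose proof (Vk m ltac:(lia)) as Vm. pose proof (Lk m ltac:(lia)) as Lm.
    exists (S (1 + D + 0 - 0) + (s + (1 + S (1 + D + m)))). split.
    { assert (m <= X) by lia.
      assert (s <= X ^ (c + 5)).
      { eapply Nat.le_trans; [exact Hs|]. replace (c + 5) with (S (c + 4)) by lia. simpl. nia. }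
      (* At most [X] rounds of cost [X ^ (c + 4)] give the exponent [c + 5]; entering and leaving
         the loop cost at most [X ^ 3]. *)
      replace (c + 9) with ((c + 5) + 3 + 1) by lia.
      eapply Nat.le_trans; [|apply pow_add_le; auto].
      change (X ^ 3) with (X * (X * (X * 1))). nia. }
    eapply runs_trans.
    { apply (run_find_right rows pc _ 0 (1 + D + 0) _ R0); [lia|..].
      - intros j _. apply frame_bound; auto.
      - intros j Hj. destruct j; [reflexivity|]. rewrite frame_erased; [auto|lia].
      - apply (frame_cases D arr o out (fun a => negb ((a =? 3) || (a =? 4)) = true)); auto; try lia.
        + intros k Hk _. pose proof (valid_nth arr k Va Hk). unfold cell.
          replace (_ =? 3) with false by (symmetry; apply Nat.eqb_neq; lia).
          replace (_ =? 4) with false by (symmetry; apply Nat.eqb_neq; lia). auto.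
        + intros k Hk _. pose proof (valid_nth out k Vo Hk).
          replace (_ =? 3) with false by (symmetry; apply Nat.eqb_neq; lia).
          replace (_ =? 4) with false by (symmetry; apply Nat.eqb_neq; lia). auto. }
    eapply runs_trans; [exact Rs|]. fold (outk m).
    eapply runs_trans. { apply (run_jump rows _ _ _ _ _ R1). apply frame_bound; auto. }
    replace (loop_stop upto (frame D arr o (outk m) (1 + D + m))) with true.
    + replace (pc + (8 + size f)) with (S (pc + (7 + size f))) by lia.
      apply (run_find_left rows _ (fun a => a =? 3) (1 + D + m) 0); auto.
      * intros j _. apply frame_bound; auto.
      * intros j Hj. apply frame_inner; auto; lia.
    + symmetry. unfold loop_stop. destruct upto.
      * destruct (Hu eq_refl) as (_ & Eo & Hl). rewrite frame_marked; auto. apply orb_true_r.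
      * assert (Em : m = length arr) by reflexivity.
        apply orb_true_intro; left.
        apply (frame_cases D arr o (outk m) (fun a => negb (is_cell a) = true)); auto.
        -- intros k Hk Ek. lia.
        -- intros k Hk _. pose proof (valid_nth _ k Vm Hk). unfold is_cell.
           replace (8 <=? _) with false; auto. symmetry; apply Nat.leb_gt; lia.
  - intros arr o Va K. destruct (Hok arr o K) as (_ & Hm & _). specialize (Hok' arr o).
    set (m := limit upto arr o) in *. clearbody m. split.
    + apply Forall_flat_map, Forall_forall. intros j Hj. apply in_seq in Hj. apply L; auto.
      apply Hok'; auto; lia.
    + assert (B : length (flat_map (fun k => G arr (point_at l k o)) (seq 0 m)) <= m * (length arr + 2) ^ c).
      { clear Hm. induction m as [|m IH]; [simpl; lia|].
        rewrite seq_S, flat_map_app, length_app. simpl flat_map. rewrite app_nil_r. simpl.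
        destruct (L arr (point_at l m o)) as [_ B]; auto.
        assert (B' := IH ltac:(intros; apply Hok'; auto; lia)). simpl "+" in *. lia. }
      eapply Nat.le_trans; [exact B|]. replace (c + 9) with (1 + (c + 8)) by lia.
      rewrite Nat.pow_add_r, Nat.pow_1_r. apply Nat.mul_le_mono; [lia|]. apply pow_le_mono; lia.
Qed.

(** * Composable transformations of the array *)

Definition none : cursors := fun _ => None.

(** A stage erases its input but leaves the cells in place, so any number [D] of erased cells must
    be tolerated; bounding [D'] keeps the tape polynomial under composition. *)
Definition transduces (F : list nat -> list nat) : Prop :=
  exists fr c, forall rows pc, code_at rows pc (code fr pc) ->
  forall D arr, valid arr -> exists k D',
    k <= (D + length arr + 2) ^ c /\ D' + length (F arr) + 2 <= (D + length arr + 2) ^ c /\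
    valid (F arr) /\
    runs rows k (at_pc pc 0 (frame D arr none [])) (at_pc (pc + size fr) 0 (frame D' (F arr) none [])).

(** In one sweep output symbols become unmarked array cells and old array cells become erased
    ones. *)
Definition relabel (a : nat) : nat :=
  if a <=? 4 then a else if a <=? 7 then 4 + 4 * (a - 4) else 4.

Lemma frame_relabel D arr out : valid arr -> valid out ->
  (fun j => if (0 <=? j) && (j <? 1 + D + length arr + length out)
            then relabel (frame D arr none out j) else frame D arr none out j) =
  frame (D + length arr) out none [].
Proof.
  intros Va Vo. apply functional_extensionality; intros j. simpl (0 <=? j). rewrite andb_true_l.
  destruct (Nat.ltb_spec j (1 + D + length arr + length out)) as [L|L].
  - destruct (Nat.eq_dec j 0) as [->|N0]; auto.
    destruct (le_lt_dec j D); [rewrite !frame_erased by lia; auto|].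
    destruct (le_lt_dec j (D + length arr)).
    + rewrite (frame_erased (D + length arr)) by lia.
      replace j with (1 + D + (j - D - 1)) by lia. rewrite frame_cell by lia. simpl points.
      pose proof (valid_nth arr (j - D - 1) Va ltac:(lia)). unfold relabel, cell.
      replace (_ <=? 4) with false by (symmetry; apply Nat.leb_gt; lia).
      replace (_ <=? 7) with false by (symmetry; apply Nat.leb_gt; lia). auto.
    + replace j with (1 + D + length arr + (j - D - length arr - 1)) at 1 by lia.
      rewrite frame_out by lia.
      replace j with (1 + (D + length arr) + (j - D - length arr - 1)) at 2 by lia.
      rewrite frame_cell by lia. set (i := j - D - length arr - 1).
      pose proof (valid_nth out i Vo ltac:(unfold i; lia)). simpl points. unfold relabel, cell.
      replace (_ <=? 4) with false by (symmetry; apply Nat.leb_gt; lia).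
      replace (_ <=? 7) with true by (symmetry; apply Nat.leb_le; lia). lia.
  - rewrite !frame_blank; auto; simpl; lia.
Qed.

Definition relabel_frag : frag.
Proof.
  refine {| code := fun pc => [ scan (fun a => a =? 0) relabel DR pc;
                                write (fun a => a) DL (1 + pc);
                                scan (fun a => a =? 3) (fun a => a) DL (2 + pc) ]; size := 3 |}.
  reflexivity.
Defined.

Lemma transduces_gen G : gen top G -> transduces (fun arr => G arr none).
Proof.
  (* [c + 2] bounds the tape in terms of the initial size, [c + 3] the time in terms of the tape. *)
  intros (fr & c & E & L). exists (seq_frag fr relabel_frag), ((c + 2) * (c + 3)).
  intros rows pc Hc D arr Va. cbn [code size seq_frag relabel_frag] in *.
  rewrite code_at_app, code_length, !code_at_cons in Hc. destruct Hc as (Hc & R0 & R1 & R2 & _).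
  assert (K : top arr none) by (split; reflexivity).
  destruct (L arr none Va K) as [Vo Lo]. set (out := G arr none) in *.
  set (Y := D + length arr + 2). set (X := D + length arr + length out + 2).
  assert (HX : X <= Y ^ (c + 2)).
  { assert (length out <= Y ^ c).
    { eapply Nat.le_trans; [exact Lo|]. apply Nat.pow_le_mono_l. unfold Y; lia. }
    pose proof (pow_add_le Y 1 c ltac:(unfold Y; lia)) as P. rewrite Nat.pow_1_r in P.
    replace (1 + c + 1) with (c + 2) in P by lia. unfold X, Y in *. lia. }
  assert (HX2 : 2 <= X) by (unfold X; lia).
  assert (HP : X ^ (c + 3) <= Y ^ ((c + 2) * (c + 3))).
  { rewrite Nat.pow_mul_r. apply Nat.pow_le_mono_l. auto. }
  destruct (E rows pc Hc D arr none [] X Va) as (k & Hk & R); auto.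
  { constructor. } { unfold X. simpl; fold out; lia. }
  simpl app in R. fold out in R.
  set (e := 1 + D + length arr + length out).
  exists (k + (S e + (1 + S (e - 1)))), (D + length arr). split; [|split; [|split; [exact Vo|]]].
  - eapply Nat.le_trans; [|exact HP]. replace (X ^ (c + 3)) with (X ^ (c + 2 + 1)) by (f_equal; lia).
    eapply Nat.le_trans; [|apply (pow_add_le X c 2); auto].
    apply Nat.add_le_mono; auto. change (X ^ 2) with (X * (X * 1)). unfold e, X in *. nia.
  - eapply Nat.le_trans; [|exact HP]. fold X. rewrite <- (Nat.pow_1_r X) at 1.
    apply Nat.pow_le_mono_r; lia.
  - eapply runs_trans; [exact R|].
    pose proof (frame_bound D arr none out Va Vo) as Bd.
    eapply runs_trans.
    { apply (run_scan_right rows _ _ relabel e 0 _ R0); auto; simpl Nat.add.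
      - intros j Hj. apply frame_nonblank; auto; unfold e in Hj; lia.
      - rewrite frame_blank; auto. }
    pose proof (frame_relabel D arr out Va Vo) as Fr. fold e in Fr.
    change (0 + e) with e. rewrite Fr.
    assert (Bd' : forall j, frame (D + length arr) out none [] j < num_syms)
      by (apply frame_bound; auto; constructor).
    eapply runs_trans. { apply (run_write rows _ _ _ _ _ R1). auto. }
    cbv beta. rewrite upd_id.
    replace (move DL e) with (0 + (e - 1)) by (simpl; lia).
    replace (pc + (size fr + 3)) with (S (S (S (pc + size fr)))) by lia.
    apply (run_find_left rows _ _ (e - 1) 0 _ R2); auto.
    intros j Hj. apply frame_inner; lia.
Qed.

Lemma transduces_comp F G : transduces F -> transduces G -> transduces (fun arr => G (F arr)).
Proof.
  intros (f & c & HF) (g & d & HG). exists (seq_frag f g), (c + c * d + 1).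
  intros rows pc Hc D arr Va. cbn [code size seq_frag] in *.
  rewrite code_at_app, code_length in Hc. destruct Hc as [Hc Hc'].
  destruct (HF rows pc Hc D arr Va) as (k & D1 & Hk & B1 & V1 & R1).
  destruct (HG rows _ Hc' D1 (F arr) V1) as (l & D2 & Hl & B2 & V2 & R2).
  set (Y := D + length arr + 2) in *. set (Z := D1 + length (F arr) + 2) in *.
  assert (ZY : Z ^ d <= Y ^ (c * d)) by (rewrite Nat.pow_mul_r; apply Nat.pow_le_mono_l; auto).
  pose proof (pow_add_le Y c (c * d) ltac:(unfold Y; lia)).
  exists (k + l), D2. repeat split; auto; [lia|lia|].
  eapply runs_trans; eauto. rewrite Nat.add_assoc. exact R2.
Qed.

(** * Moving the result to the left end of the tape *)

Definition packed (r : list nat) (g : nat) (rest : list nat) : nat -> nat :=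
  fun j => if j <? length r then nth j r 0
           else if j <? length r + g then (if j =? 0 then 3 else 4)
           else if j <? length r + g + length rest then 4 + 4 * nth (j - length r - g) rest 0
           else 0.

Definition raw (l : list nat) : Prop := Forall (fun b => b = 1 \/ b = 2) l.

Lemma raw_nth l k : raw l -> k < length l -> nth k l 0 = 1 \/ nth k l 0 = 2.
Proof. intros V H. apply (proj1 (Forall_forall _ l) V). apply nth_In; auto. Qed.

Section Packed.
Context (r : list nat) (g : nat) (rest : list nat).

Lemma packed_raw j : j < length r -> packed r g rest j = nth j r 0.
Proof. intros. unfold packed. destruct (Nat.ltb_spec j (length r)); auto; lia. Qed.

Lemma packed_gap i : i < g ->
  packed r g rest (length r + i) = if length r + i =? 0 then 3 else 4.
Proof.
  intros. unfold packed. destruct (Nat.ltb_spec (length r + i) (length r)); [lia|].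
  destruct (Nat.ltb_spec (length r + i) (length r + g)); auto; lia.
Qed.

Lemma packed_rest i : i < length rest ->
  packed r g rest (length r + g + i) = 4 + 4 * nth i rest 0.
Proof.
  intros. unfold packed. destruct (Nat.ltb_spec (length r + g + i) (length r)); [lia|].
  destruct (Nat.ltb_spec (length r + g + i) (length r + g)); [lia|].
  destruct (Nat.ltb_spec (length r + g + i) (length r + g + length rest)); [|lia].
  do 3 f_equal. lia.
Qed.

Lemma packed_blank j : length r + g + length rest <= j -> packed r g rest j = 0.
Proof.
  intros. unfold packed. destruct (Nat.ltb_spec j (length r)); [lia|].
  destruct (Nat.ltb_spec j (length r + g)); [lia|].
  destruct (Nat.ltb_spec j (length r + g + length rest)); auto; lia.
Qed.

Lemma packed_bound j : raw r -> raw rest -> packed r g rest j < num_syms.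
Proof.
  intros Vr Vs. unfold num_syms, packed.
  destruct (Nat.ltb_spec j (length r)); [destruct (raw_nth r j); auto; lia|].
  destruct (Nat.ltb_spec j (length r + g)); [destruct (j =? 0); lia|].
  destruct (Nat.ltb_spec j (length r + g + length rest)); [|lia].
  destruct (raw_nth rest (j - length r - g)); auto; lia.
Qed.
End Packed.

Lemma packed_take r g b rest :
  0 < g -> upd (packed r g (b :: rest)) (length r + g) 4 = packed r (S g) rest.
Proof.
  intros N.
  apply functional_extensionality; intros j. unfold upd, packed. simpl length.
  destruct (Nat.eqb_spec j (length r + g)) as [->|Nj].
  - destruct (Nat.ltb_spec (length r + g) (length r)); [lia|].
    destruct (Nat.ltb_spec (length r + g) (length r + S g)); [|lia].
    destruct (Nat.eqb_spec (length r + g) 0); auto; lia.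
  - destruct (Nat.ltb_spec j (length r)); auto.
    destruct (Nat.ltb_spec j (length r + g)), (Nat.ltb_spec j (length r + S g)); try lia; auto.
    destruct (Nat.ltb_spec j (length r + g + S (length rest))),
      (Nat.ltb_spec j (length r + S g + length rest)); try lia; auto.
    replace (j - length r - g) with (S (j - length r - S g)) by lia. auto.
Qed.

Lemma packed_put r g b rest :
  0 < g -> upd (packed r (S g) rest) (length r) b = packed (r ++ [b]) g rest.
Proof.
  intros Hg. apply functional_extensionality; intros j. unfold upd, packed.
  rewrite length_app. simpl length.
  destruct (Nat.eqb_spec j (length r)) as [->|Nj].
  - destruct (Nat.ltb_spec (length r) (length r + 1)); [|lia]. rewrite nth_middle; auto.
  - destruct (Nat.ltb_spec j (length r)), (Nat.ltb_spec j (length r + 1)); try lia.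
    { rewrite app_nth1; auto. }
    replace (length r + 1 + g) with (length r + S g) by lia.
    replace (j - (length r + 1) - g) with (j - length r - S g) by lia. auto.
Qed.

Definition raw_or_end (a : nat) : bool := (a =? 1) || (a =? 2) || (a =? 3).

(** While nothing has been packed, the end marker occupies cell 0 and is itself overwritten;
    afterwards the target is the cell behind the last raw symbol. *)
Definition put_rows (b next : nat) (d : dir) (pc : nat) : list row :=
  [ scan raw_or_end (fun a => a) DL pc;
    (fun a => if a =? 3 then (next, b, d) else (2 + pc, a, DR));
    (fun _ => (next, b, d)) ].

Lemma run_put rows pc b next d r g rest i :
  code_at rows pc (put_rows b next d pc) -> raw r -> raw rest -> i < g ->
  exists k, k <= g + 3 /\
    runs rows k (at_pc pc (length r + i) (packed r g rest))
                (at_pc next (move d (length r)) (upd (packed r g rest) (length r) b)).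
Proof.
  intros Hc Vr Vs Hi. unfold put_rows in Hc. rewrite !code_at_cons in Hc.
  destruct Hc as (R0 & R1 & R2 & _).
  pose proof (fun j => packed_bound r g rest j Vr Vs) as Bd.
  assert (Gap : forall j, length r <= j -> j < length r + g -> 0 < j ->
                raw_or_end (packed r g rest j) = false).
  { intros j H1 H2 H3. replace j with (length r + (j - length r)) by lia.
    rewrite packed_gap by lia. destruct (Nat.eqb_spec (length r + (j - length r)) 0); [lia|auto]. }
  destruct (Nat.eq_dec (length r) 0) as [E0|N0].
  - exists (S i + 1). split; [lia|]. rewrite E0.
    pose proof (packed_gap r g rest 0 ltac:(lia)) as P0. rewrite E0 in P0. simpl in P0.
    eapply runs_trans.
    { apply (run_find_left rows pc raw_or_end i 0 _ R0); auto.
      - intros j Hj. apply Gap; lia.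
      - rewrite P0; auto. }
    eapply run_row; [exact R1|auto|]. rewrite P0; reflexivity.
  - exists (S (S i) + (1 + 1)). split; [lia|].
    pose proof (packed_raw r g rest (length r - 1) ltac:(lia)) as P0.
    assert (P1 : packed r g rest (length r - 1) = 1 \/ packed r g rest (length r - 1) = 2)
      by (rewrite P0; apply raw_nth; auto; lia).
    eapply runs_trans.
    { replace (length r + i) with ((length r - 1) + S i) by lia.
      apply (run_find_left rows pc raw_or_end (S i) (length r - 1) _ R0); auto.
      - intros j Hj. apply Gap; lia.
      - destruct P1 as [-> | ->]; auto. }
    eapply runs_trans.
    { apply (run_row rows _ _ _ _ (2 + pc) (packed r g rest (length r - 1)) DR R1); auto.
      destruct P1 as [-> | ->]; reflexivity. }
    rewrite upd_id.
    simpl move. replace (S (length r - 1)) with (length r) by lia.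
    eapply run_row; [exact R2|auto|reflexivity].
Qed.

Definition pack_rows (pc : nat) : list row :=
  [ scan (fun a => is_cell a || (a =? 0)) (fun a => a) DR pc;
    (fun a => if a =? 8 then (2 + pc, 4, DL) else if a =? 12 then (5 + pc, 4, DL)
              else (8 + pc, a, DL)) ] ++
  put_rows 1 pc DR (2 + pc) ++ put_rows 2 pc DR (5 + pc) ++ put_rows 0 (11 + pc) DS (8 + pc).

(** Each round erases the first remaining cell, widening the gap, and appends its bit to the raw
    part, narrowing it again; so [g] is invariant. The blank written last is the terminator that
    [tape_holds] requires. *)
Lemma run_pack rows pc g : code_at rows pc (pack_rows pc) -> 0 < g ->
  forall rest r, raw r -> raw rest ->
  exists k, k <= (length rest + 1) * (2 * g + 8) /\
    runs rows k (at_pc pc (length r) (packed r g rest))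
      (at_pc (11 + pc) (length (r ++ rest))
             (upd (packed (r ++ rest) g []) (length (r ++ rest)) 0)).
Proof.
  intros Hc Hg. unfold pack_rows in Hc. rewrite !code_at_app, !code_at_cons in Hc.
  simpl length in Hc. destruct Hc as ((R0 & R1 & _) & C1 & C2 & C0).
  replace (pc + 2) with (2 + pc) in * by lia.
  replace (2 + pc + 3) with (5 + pc) in * by lia. replace (5 + pc + 3) with (8 + pc) in * by lia.
  induction rest as [|b rest IH]; intros r Vr Vs.
  - rewrite app_nil_r.
    pose proof (fun j => packed_bound r g [] j Vr Vs) as Bd.
    destruct (run_put rows _ _ _ _ r g [] (g - 1) C0 Vr Vs) as (k & Hk & R); [lia|].
    set (t := packed r g []) in *. set (p := length r + g).
    assert (Tp : t p = 0) by (apply packed_blank; simpl; unfold p; lia).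
    exists (S g + (1 + k)). split; [simpl length; lia|].
    eapply runs_trans.
    { replace g with (p - length r) at 1 by (unfold p; lia).
      apply (run_find_right rows pc _ (length r) p t R0); [unfold p; lia|auto|..].
      - intros j Hj. replace j with (length r + (j - length r)) by lia. unfold t.
        rewrite packed_gap by (unfold p in *; lia).
        destruct (Nat.eqb_spec (length r + (j - length r)) 0); auto.
      - rewrite Tp; auto. }
    eapply runs_trans.
    { apply (run_row rows _ _ _ _ (8 + pc) (t p) DL R1); auto. rewrite Tp; reflexivity. }
    rewrite upd_id. replace (move DL p) with (length r + (g - 1)) by (unfold p; simpl; lia).
    exact R.
  - inversion Vs as [|? ? Hb Vs']; subst.
    pose proof (fun j => packed_bound r g (b :: rest) j Vr Vs) as Bd.
    assert (Vr' : raw (r ++ [b])) by (apply Forall_app; split; auto).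
    destruct (IH (r ++ [b]) Vr' Vs') as (k & Hk & R).
    rewrite <- app_assoc in R. simpl app in R.
    set (t := packed r g (b :: rest)) in *. set (p := length r + g).
    assert (Tp : t p = 4 + 4 * b).
    { unfold t. replace p with (length r + g + 0) by (unfold p; lia).
      rewrite packed_rest by (simpl; lia). auto. }
    assert (P : exists l, l <= g + 4 /\
       runs rows l (at_pc (if b =? 1 then 2 + pc else 5 + pc) (length r + (g - 1)) (packed r (S g) rest))
                   (at_pc pc (length (r ++ [b])) (packed (r ++ [b]) g rest))).
    { rewrite length_app, Nat.add_1_r, <- (packed_put r g b rest Hg).
      destruct Hb as [-> | ->].
      - destruct (run_put rows _ _ _ _ r (S g) rest (g - 1) C1 Vr Vs') as (l & Hl & Rl); [lia|].
        exists l; split; [lia|]. exact Rl.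
      - destruct (run_put rows _ _ _ _ r (S g) rest (g - 1) C2 Vr Vs') as (l & Hl & Rl); [lia|].
        exists l; split; [lia|]. exact Rl. }
    destruct P as (l & Hl & Rl).
    exists (S g + (1 + (l + k))). split.
    { simpl length. lia. }
    eapply runs_trans.
    { replace g with (p - length r) at 1 by (unfold p; lia).
      apply (run_find_right rows pc _ (length r) p t R0); [unfold p; lia|auto|..].
      - intros j Hj. replace j with (length r + (j - length r)) by lia. unfold t.
        rewrite packed_gap by (unfold p in *; lia).
        destruct (Nat.eqb_spec (length r + (j - length r)) 0); auto.
      - rewrite Tp. destruct Hb as [-> | ->]; auto. }
    eapply runs_trans.
    { apply (run_row rows _ _ _ _ (if b =? 1 then 2 + pc else 5 + pc) 4 DL R1); auto.
      rewrite Tp. destruct Hb as [-> | ->]; reflexivity. }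
    pose proof (packed_take r g b rest Hg) as E. fold p t in E. rewrite E.
    replace (move DL p) with (length r + (g - 1)) by (unfold p; simpl; lia).
    eapply runs_trans; [exact Rl|exact R].
Qed.

Lemma frame_packed D arr : frame D arr none [] = packed [] (1 + D) arr.
Proof.
  apply functional_extensionality; intros j. unfold frame, packed. simpl length.
  rewrite !Nat.add_0_l, !Nat.add_0_r. destruct (Nat.eqb_spec j 0) as [->|N]; auto.
  destruct (Nat.ltb_spec j 0); [lia|].
  destruct (Nat.leb_spec j D), (Nat.ltb_spec j (1 + D)); try lia; auto.
  destruct (Nat.leb_spec j (D + length arr)), (Nat.ltb_spec j (1 + D + length arr)); try lia; auto.
  cbv zeta. unfold cell. simpl points.
  replace (j - 0 - (1 + D)) with (j - D - 1) by lia. lia.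
Qed.

(** * Turning the input word into an array *)

Definition entry (a : nat) : nat := if a =? 1 then 1 else if a =? 2 then 2 else 3.

(* Shifts the input one cell to the right, remembering the pending bit in the state. *)
Definition shift_rows : list row :=
  [ (fun a => (entry a, 3, DR));
    (fun a => (entry a, 8, DR));
    (fun a => (entry a, 12, DR));
    (fun a => (4, a, DL));
    scan (fun a => a =? 3) (fun a => a) DL 4 ].

Definition shifted (arr : list nat) (i : nat) : nat -> nat :=
  fun j => if j =? 0 then 3 else if j <? i then 4 + 4 * nth (j - 1) arr 0 else nth j arr 0.

Lemma run_shift rows arr : code_at rows 0 shift_rows -> raw arr ->
  runs rows (2 * length arr + 3) (at_pc 0 0 (fun k => nth k arr 0)) (at_pc 5 0 (frame 0 arr none [])).
Proof.
  intros Hc V. unfold shift_rows in Hc. rewrite !code_at_cons in Hc.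
  destruct Hc as (R0 & R1 & R2 & R3 & R4 & _).
  assert (Bn : forall j, nth j arr 0 = 0 \/ j < length arr /\ (nth j arr 0 = 1 \/ nth j arr 0 = 2)).
  { intros j. destruct (le_lt_dec (length arr) j); [left; apply nth_overflow; auto|].
    right; split; auto. apply raw_nth; auto. }
  assert (Bd : forall i j, shifted arr i j < num_syms).
  { intros i j. unfold shifted, num_syms. destruct (j =? 0); [lia|].
    destruct (j <? i); [destruct (Bn (j - 1)) as [E|(_ & [E|E])]|destruct (Bn j) as [E|(_ & [E|E])]];
      rewrite E; lia. }
  assert (S0 : runs rows 1 (at_pc 0 0 (fun k => nth k arr 0)) (at_pc (entry (nth 0 arr 0)) 1 (shifted arr 1))).
  { replace (shifted arr 1) with (upd (fun k => nth k arr 0) 0 3).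
    - apply (run_row rows 0 0 _ _ _ 3 DR R0); auto.
      unfold num_syms; destruct (Bn 0) as [E|(_ & [E|E])]; rewrite E; lia.
    - apply functional_extensionality; intros j. unfold upd, shifted.
      destruct (Nat.eqb_spec j 0); auto. destruct (Nat.ltb_spec j 1); auto; lia. }
  assert (St : forall i, i < length arr ->
    runs rows 1 (at_pc (entry (nth i arr 0)) (S i) (shifted arr (S i)))
                (at_pc (entry (nth (S i) arr 0)) (S (S i)) (shifted arr (S (S i))))).
  { intros i Hi.
    assert (Ei : shifted arr (S i) (S i) = nth (S i) arr 0).
    { unfold shifted. simpl. destruct (Nat.ltb_spec (S i) (S i)); auto; lia. }
    replace (shifted arr (S (S i))) with (upd (shifted arr (S i)) (S i) (4 + 4 * nth i arr 0)).
    - change (S (S i)) with (move DR (S i)).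
      destruct (raw_nth arr i V Hi) as [E|E]; rewrite E.
      + eapply run_row; [exact R1|auto|]. rewrite Ei; reflexivity.
      + eapply run_row; [exact R2|auto|]. rewrite Ei; reflexivity.
    - apply functional_extensionality; intros j. unfold upd, shifted.
      destruct (Nat.eqb_spec j (S i)) as [->|N].
      + simpl (S i =? 0). cbv iota. destruct (Nat.ltb_spec (S i) (S (S i))); [|lia].
        do 3 f_equal. lia.
      + destruct (j =? 0); auto.
        destruct (Nat.ltb_spec j (S i)), (Nat.ltb_spec j (S (S i))); auto; lia. }
  assert (It : forall i, i <= length arr ->
    runs rows (S i) (at_pc 0 0 (fun k => nth k arr 0))
                (at_pc (entry (nth i arr 0)) (S i) (shifted arr (S i)))).
  { induction i as [|i IH]; intros Hi; [exact S0|].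
    replace (S (S i)) with (S i + 1) at 1 by lia.
    eapply runs_trans; [apply IH; lia|apply St; lia]. }
  assert (Sh : shifted arr (S (length arr)) = frame 0 arr none []).
  { rewrite frame_packed. apply functional_extensionality; intros j. unfold shifted, packed.
    simpl length. simpl "+". destruct (Nat.eqb_spec j 0) as [->|N]; auto.
    destruct (Nat.ltb_spec j 0); [lia|]. destruct (Nat.ltb_spec j 1); [lia|].
    destruct (Nat.ltb_spec j (S (length arr))).
    - replace (j - 0 - 1) with (j - 1) by lia; auto.
    - apply nth_overflow; lia. }
  specialize (It (length arr) (le_n _)). rewrite nth_overflow, Sh in It by auto.
  change (entry 0) with 3 in It.
  replace (2 * length arr + 3) with (S (length arr) + (1 + S (length arr))) by lia.
  eapply runs_trans; [exact It|].
  assert (Va : valid arr).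
  { eapply Forall_impl; [|exact V]. simpl; intros; lia. }
  assert (Bf : forall j, frame 0 arr none [] j < num_syms)
    by (apply frame_bound; auto; constructor).
  eapply runs_trans.
  { apply (run_row rows 3 _ _ _ 4 (frame 0 arr none [] (S (length arr))) DL R3); auto. }
  rewrite upd_id. simpl move.
  apply (run_find_left rows 4 _ (length arr) 0 _ R4); auto.
  intros j Hj. apply frame_inner; lia.
Qed.

(** For [n >= 2] one has [n + 2 <= n ^ 2], which doubles the exponent; for 0 and 1 the power of [n]
    does not help and the constant [3 ^ c] takes over. *)
Lemma pow_bound n c : (n + 2) ^ c <= n ^ (2 * c + 3 ^ c) + (2 * c + 3 ^ c).
Proof.
  destruct n as [|[|n]].
  - simpl (0 + 2). pose proof (Nat.pow_le_mono_l 2 3 c ltac:(lia)). lia.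
  - simpl (1 + 2). lia.
  - set (m := S (S n)). assert (H : m + 2 <= m ^ 2) by (simpl; unfold m; nia).
    apply (Nat.pow_le_mono_l _ _ c) in H. rewrite <- Nat.pow_mul_r in H.
    pose proof (Nat.pow_le_mono_r m (2 * c) (2 * c + 3 ^ c) ltac:(unfold m; lia) ltac:(lia)). lia.
Qed.

Lemma transduces_poly_time F f :
  transduces F -> (forall w, F (map sym w) = map sym (f w)) -> poly_time_computable f.
Proof.
  intros (fr & c & H) E.
  set (rows := shift_rows ++ code fr 5 ++ pack_rows (5 + size fr)).
  assert (C : code_at rows 0 rows) by (intros i r Hi; auto).
  unfold rows in C at 2. rewrite !code_at_app, code_length in C.
  destruct C as (C0 & C1 & C2).
  change (0 + length shift_rows) with 5 in *.
  (* Exponent 2 pays for the shift, [c] for the transformation and [5 * c] for packing; each 1 comes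
     from [pow_add_le]. *)
  set (d := 2 + (c + 5 * c + 1) + 1).
  exists (assemble rows), (2 * d + 3 ^ d). intros w.
  assert (Rw : forall u, raw (map sym u)).
  { intros u. apply Forall_forall. intros x Hx. apply in_map_iff in Hx as ([] & <- & _); auto. }
  assert (Va : valid (map sym w)).
  { eapply Forall_impl; [|apply (Rw w)]. simpl; intros; lia. }
  pose proof (run_shift rows (map sym w) C0 (Rw w)) as R0.
  destruct (H rows 5 C1 0 (map sym w) Va) as (k & D & Hk & B & _ & R1).
  rewrite E in *. rewrite !length_map in *. simpl (0 + length w) in *.
  set (Y := length w + 2) in *.
  destruct (run_pack rows (5 + size fr) (1 + D) C2 ltac:(lia) (map sym (f w)) [] ltac:(constructor) (Rw _))
    as (l & Hl & R2).
  simpl app in R2. simpl (length []) in R2. rewrite <- frame_packed, !length_map in *.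
  eexists. split.
  - apply (drun_runs rows (2 * length w + 3 + (k + l))).
    + eapply runs_trans; [exact R0|]. eapply runs_trans; [exact R1|exact R2].
    + eapply Nat.le_trans; [|apply pow_bound]. fold Y. unfold d.
      assert (HY : 2 <= Y) by (unfold Y; lia).
      eapply Nat.le_trans; [|apply pow_add_le; auto].
      apply Nat.add_le_mono; [simpl; unfold Y; nia|].
      eapply Nat.le_trans; [|apply pow_add_le; auto].
      apply Nat.add_le_mono; auto.
      eapply Nat.le_trans; [exact Hl|].
      rewrite (Nat.mul_comm 5), Nat.pow_mul_r.
      set (Z := Y ^ c) in *.
      assert (length (f w) + 1 <= Z) by lia. assert (2 <= Z) by lia.
      assert (2 * (1 + D) + 8 <= 6 * Z) by lia. change (Z ^ 5) with (Z * (Z * (Z * (Z * (Z * 1))))).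
      assert (6 <= Z * (Z * Z)) by nia. nia.
    + cbn [c_tape c_head at_pc]. unfold upd. rewrite Nat.eqb_refl. unfold num_syms; lia.
    + cbn [c_state at_pc]. unfold rows. rewrite !length_app, code_length. simpl. lia.
  - split.
    + intros j Hj. cbn [c_tape at_pc]. unfold upd.
      destruct (Nat.eqb_spec j (length (f w))); [lia|].
      rewrite packed_raw by (rewrite length_map; auto).
      rewrite nth_indep with (d' := sym false) by (rewrite length_map; auto). apply map_nth.
    + cbn [c_tape at_pc]. unfold upd. rewrite Nat.eqb_refl; auto.
Qed.

(** * Emitting the reduction *)

Lemma valid_sym l : valid (map sym l).
Proof. apply Forall_forall. intros x Hx. apply in_map_iff in Hx as ([] & <- & _); simpl; lia. Qed.

Lemma cur_point l k o : cur l (point_at l k o) = k.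
Proof. unfold cur, point_at. rewrite eqb_reflx. auto. Qed.

Lemma gen_for G : gen within G ->
  gen top (fun arr o => flat_map (fun k => G arr (point_at false k o)) (seq 0 (length arr))).
Proof.
  apply (gen_loop top within false false).
  - intros arr o [H _]. repeat split; auto; discriminate.
  - intros arr o k [_ H] Hk. simpl in Hk. split; [exists k; split; auto|exact H].
Qed.

Lemma gen_for_inner G : gen nested G ->
  gen within (fun arr o => flat_map (fun k => G arr (point_at true k o)) (seq 0 (length arr))).
Proof.
  apply (gen_loop within nested true false).
  - intros arr o [_ H]. repeat split; auto; discriminate.
  - intros arr o k [H _] Hk. simpl in Hk. split; [exact H|exists k; split; auto].
Qed.

Lemma gen_before G : gen nested G ->
  gen within (fun arr o => flat_map (fun k => G arr (point_at true k o)) (seq 0 (cur false o))).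
Proof.
  apply (gen_loop within nested true true).
  - intros arr o [(i & Hi & Li) H]. unfold limit, cur. rewrite Hi. repeat split; auto; lia.
  - intros arr o k [(i & Hi & Li) _] Hk. unfold limit, cur in Hk. rewrite Hi in Hk.
    split; [exists i; auto|exists k; split; [auto|lia]].
Qed.

Lemma gen_if_within (test : nat -> bool) G G' : gen within G -> gen within G' ->
  gen within (fun arr o => if test (nth (cur false o) arr 0) then G arr o else G' arr o).
Proof.
  intros H H'.
  assert (Hw : forall arr o, within arr o -> exists i, o false = Some i /\ i < length arr)
    by (intros arr o [K _]; exact K).
  eapply gen_ext; [|apply gen_app;
    [apply (gen_if within false test G Hw H)
    |apply (gen_if within false (fun a => negb (test a)) G' Hw H')]].
  intros arr o _. simpl. destruct (test _); simpl; auto. apply app_nil_r.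
Qed.

Lemma flat_map_nth {A} (f : nat -> list A) l :
  flat_map (fun i => f (nth i l 0)) (seq 0 (length l)) = flat_map f l.
Proof.
  induction l as [|a l IH]; simpl; auto. f_equal.
  rewrite <- seq_shift, <- IH, !flat_map_concat_map, map_map. auto.
Qed.

(** * Computing the number of address bits *)

Definition keep_bits (a : nat) : list nat := if a =? 3 then [] else if a =? 1 then [1] else [2].

Definition copy_input (arr : list nat) : list nat := flat_map keep_bits arr.

Lemma gen_copy : gen top (fun arr _ => copy_input arr).
Proof.
  eapply gen_ext; [|apply gen_for, (gen_if_within (fun a => a =? 3) (fun _ _ => []));
    [apply gen_nil|apply (gen_if_within (fun a => a =? 1) (fun _ _ => [1]) (fun _ _ => [2]));
      apply gen_emit; lia]].
  intros arr o _. unfold copy_input. rewrite <- (flat_map_nth _ arr). apply flat_map_ext. intros i.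
  rewrite cur_point. auto.
Qed.

Lemma copy_layout w a : copy_input (layout w a) = map sym w.
Proof.
  unfold copy_input, layout. rewrite flat_map_app.
  replace (flat_map keep_bits (repeat 3 a)) with (@nil nat) by (induction a; auto).
  rewrite app_nil_r. induction w as [|b w IH]; auto. simpl flat_map. rewrite IH.
  destruct b; auto.
Qed.

Lemma flat_map_sym {A} (f : nat -> list A) w a :
  f 1 = f 2 -> flat_map f (layout w a) =
  concat (repeat (f 1) (length w)) ++ concat (repeat (f 3) a).
Proof.
  intros E. unfold layout. rewrite flat_map_app. f_equal.
  - induction w as [|b w IH]; simpl; auto. rewrite IH. destruct b; simpl; congruence.
  - induction a; simpl; congruence.
Qed.

Lemma concat_repeat_repeat {A} (x : A) a b : concat (repeat (repeat x a) b) = repeat x (b * a).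
Proof. induction b; simpl; auto. rewrite IHb, repeat_app. auto. Qed.

Lemma concat_repeat_nil {A} b : concat (repeat (@nil A) b) = [].
Proof. induction b; auto. Qed.

Definition start_stage (arr : list nat) : list nat := copy_input arr ++ [3].

Lemma transduces_start : transduces start_stage.
Proof.
  apply (transduces_gen (fun arr _ => start_stage arr)).
  apply gen_app; [apply gen_copy|apply gen_emit; lia].
Qed.

Lemma start_layout w : start_stage (map sym w) = layout w 1.
Proof.
  pose proof (copy_layout w 0) as E. unfold layout in E. simpl in E. rewrite app_nil_r in E.
  unfold start_stage. rewrite E. reflexivity.
Qed.

Definition incr_stage (arr : list nat) : list nat :=
  copy_input arr ++ flat_map (fun a => if a =? 3 then [3] else []) arr ++ [3].

Lemma transduces_incr : transduces incr_stage.
Proof.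
  apply (transduces_gen (fun arr _ => incr_stage arr)).
  apply gen_app; [apply gen_copy|]. apply gen_app; [|apply gen_emit; lia].
  eapply gen_ext; [|apply gen_for, (gen_if_within (fun a => a =? 3) (fun _ _ => [3]));
    [apply gen_emit; lia|apply gen_nil]].
  intros arr o _. simpl. rewrite <- (flat_map_nth _ arr). apply flat_map_ext. intros i.
  rewrite cur_point. auto.
Qed.

Lemma incr_layout w a : incr_stage (layout w a) = layout w (S a).
Proof.
  unfold incr_stage. rewrite copy_layout, flat_map_sym by auto. simpl Nat.eqb. cbv iota.
  rewrite concat_repeat_nil. change [3] with (repeat 3 1) at 1.
  rewrite concat_repeat_repeat, Nat.mul_1_r. simpl app. unfold layout.
  replace (S a) with (a + 1) by lia. rewrite repeat_app. auto.
Qed.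

(** A nested loop multiplies the number of address bits by the input length; [e] rounds starting
    from one bit give the power. *)
Definition mult_stage (arr : list nat) : list nat :=
  copy_input arr ++
  flat_map (fun a => if a =? 3 then flat_map (fun b => if b =? 3 then [] else [3]) arr else []) arr.

Lemma transduces_mult : transduces mult_stage.
Proof.
  apply (transduces_gen (fun arr _ => mult_stage arr)).
  apply gen_app; [apply gen_copy|].
  assert (Hn : forall arr o, nested arr o -> exists i, o true = Some i /\ i < length arr)
    by (intros arr o [_ K]; exact K).
  eapply gen_ext; [|apply gen_for, (gen_if_within (fun a => a =? 3));
    [apply gen_for_inner, (gen_if nested true (fun b => negb (b =? 3)) (fun _ _ => [3]) Hn);
       apply gen_emit; lia|apply gen_nil]].
  intros arr o _. simpl. rewrite <- (flat_map_nth _ arr). apply flat_map_ext. intros i.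
  rewrite cur_point. destruct (nth i arr 0 =? 3); auto.
  rewrite <- (flat_map_nth _ arr). apply flat_map_ext. intros j. rewrite cur_point.
  destruct (nth j arr 0 =? 3); auto.
Qed.

Lemma mult_layout w a : mult_stage (layout w a) = layout w (a * length w).
Proof.
  unfold mult_stage. rewrite copy_layout, !flat_map_sym; auto. simpl Nat.eqb. cbv iota.
  rewrite !concat_repeat_nil, app_nil_r. change [3] with (repeat 3 1).
  rewrite !concat_repeat_repeat, Nat.mul_1_r. reflexivity.
Qed.

Fixpoint iterate {A} (f : A -> A) (k : nat) (x : A) : A :=
  match k with 0 => x | S k => f (iterate f k x) end.

Lemma transduces_iterate F G k : transduces F -> transduces G ->
  transduces (fun arr => iterate G k (F arr)).
Proof.
  intros HF HG. induction k; simpl; auto.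
  apply (transduces_comp (fun arr => iterate G k (F arr)) G); auto.
Qed.

Definition prepare (e : nat) (arr : list nat) : list nat :=
  iterate incr_stage e (iterate mult_stage e (start_stage arr)).

Lemma transduces_prepare e : transduces (prepare e).
Proof.
  apply (transduces_iterate (fun arr => iterate mult_stage e (start_stage arr)));
    [apply (transduces_iterate start_stage)|]; auto using transduces_start, transduces_mult, transduces_incr.
Qed.

Lemma prepare_layout e w : prepare e (map sym w) = layout w (length w ^ e + e).
Proof.
  unfold prepare. rewrite start_layout.
  assert (H : forall k, iterate mult_stage k (layout w 1) = layout w (length w ^ k)).
  { induction k; simpl; auto. rewrite IHk, mult_layout. f_equal; lia. }
  rewrite H. clear H. generalize (length w ^ e) as a. intros a.
  induction e; simpl; [f_equal; lia|]. rewrite IHe, incr_layout. f_equal; lia.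
Qed.

(** * Encodings of numbers with one high bit *)

Lemma log2_high c b i : c < 2 ^ b -> Nat.log2 (c + 2 ^ (b + i)) = b + i.
Proof.
  intros Hc. apply Nat.log2_unique; [lia|]. rewrite Nat.pow_succ_r', Nat.pow_add_r.
  pose proof (Nat.pow_nonzero 2 i). split; nia.
Qed.

Lemma testbit_high c b i j : c < 2 ^ b ->
  Nat.testbit (c + 2 ^ (b + i)) j = if j <? b then Nat.testbit c j else j =? b + i.
Proof.
  revert c j; induction b as [|b IH]; intros c j Hc.
  - simpl in Hc. assert (c = 0) as -> by lia. simpl. rewrite Nat.pow2_bits_eqb. apply Nat.eqb_sym.
  - assert (E : c + 2 ^ (S b + i) = Nat.b2n (Nat.odd c) + 2 * (Nat.div2 c + 2 ^ (b + i))).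
    { pose proof (Nat.div2_odd c). change (S b + i) with (S (b + i)). rewrite Nat.pow_succ_r'. lia. }
    rewrite E. destruct j as [|j].
    + rewrite Nat.add_b2n_double_bit0. simpl. auto.
    + cbn [Nat.testbit]. rewrite Nat.div2_div, Nat.add_b2n_double_div2, IH.
      * simpl "+". change (S j <? S b) with (j <? b). change (S j =? S (b + i)) with (j =? b + i). auto.
      * pose proof (Nat.div2_odd c). simpl in Hc. destruct (Nat.odd c); simpl in *; lia.
Qed.

Lemma flat_map_const {A} (s : list A) a b i :
  flat_map (fun _ => s) (seq a i) = flat_map (fun _ => s) (seq b i).
Proof. revert a b; induction i; intros; simpl; auto. f_equal; auto. Qed.

Lemma flat_map_ext_seq {A} (f g : nat -> list A) a n :
  (forall j, a <= j < a + n -> f j = g j) -> flat_map f (seq a n) = flat_map g (seq a n).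
Proof.
  intros H. rewrite !flat_map_concat_map. f_equal. apply map_ext_in.
  intros j Hj. apply in_seq in Hj. auto.
Qed.

Lemma enc_nat_high c b i : c < 2 ^ b ->
  enc_nat (c + 2 ^ (b + i)) =
  flat_map (fun j => [true; Nat.testbit c j]) (seq 0 b) ++
  flat_map (fun _ => [true; false]) (seq 0 i) ++ [true; true; false].
Proof.
  intros Hc. unfold enc_nat. rewrite log2_high by auto.
  replace (S (b + i)) with (b + (i + 1)) by lia. rewrite !seq_app, !flat_map_app.
  rewrite <- !app_assoc. f_equal; [|f_equal].
  - apply flat_map_ext_seq. intros j Hj. rewrite testbit_high by auto.
    destruct (Nat.ltb_spec j b); auto; lia.
  - rewrite (flat_map_const _ 0 b). apply flat_map_ext_seq. intros j Hj.
    rewrite testbit_high by auto. destruct (Nat.ltb_spec j b); [lia|].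
    destruct (Nat.eqb_spec j (b + i)); auto; lia.
  - cbn [seq flat_map app]. rewrite testbit_high by auto.
    destruct (Nat.ltb_spec (0 + b + i) b); [lia|].
    simpl (0 + b + i). rewrite Nat.eqb_refl. auto.
Qed.

(* The last argument of [F] is the cell under the outer cursor. *)
Definition emittable (ok : condition) (F : list nat -> nat -> form) : Prop :=
  gen ok (fun arr o => map sym (enc (F arr (cur false o)))).

(** [[true; false]] encodes one digit 0 of a number; printing an index in unary therefore places the
    leading bit. *)
Definition unary (ok : condition) (idx : list nat -> nat -> nat) : Prop :=
  gen ok (fun arr o => map sym (flat_map (fun _ => [true; false]) (seq 0 (idx arr (cur false o))))).

Lemma map_flat_map {A B C} (f : B -> C) (g : A -> list B) l :
  map f (flat_map g l) = flat_map (fun x => map f (g x)) l.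
Proof. rewrite !flat_map_concat_map, concat_map, map_map. auto. Qed.

(** An inner loop up to the outer cursor prints one block per cell before it, so the index is never
    computed. *)
Lemma unary_cur : unary within (fun _ i => i).
Proof.
  unfold unary. eapply gen_ext; [|apply gen_before, (gen_const nested (map sym [true; false])), valid_sym].
  intros arr o _. simpl. rewrite map_flat_map. auto.
Qed.

Lemma unary_succ ok idx : unary ok idx -> unary ok (fun arr i => S (idx arr i)).
Proof.
  intros H. unfold unary in *. eapply gen_ext;
    [|apply gen_app; [exact H|apply (gen_const ok (map sym [true; false])), valid_sym]].
  intros arr o _. cbv beta. rewrite seq_S, flat_map_app, map_app. reflexivity.
Qed.

Lemma unary_length : unary top (fun arr _ => length arr).
Proof.
  unfold unary. eapply gen_ext; [|apply gen_for, (gen_const within (map sym [true; false])), valid_sym].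
  intros arr o _. simpl. rewrite map_flat_map. auto.
Qed.

Section Emission.
Context (M : TM) (ok : condition).
Notation vd := (vid M).

Lemma emittable_ext F G : (forall arr i, F arr i = G arr i) -> emittable ok F -> emittable ok G.
Proof. intros E. apply gen_ext. intros. rewrite E; auto. Qed.

Lemma emittable_const f : emittable ok (fun _ _ => f).
Proof. exact (gen_const ok (map sym (enc f)) (valid_sym _)). Qed.

Lemma gen_prefix l G : gen ok G -> gen ok (fun arr o => map sym l ++ G arr o).
Proof. intros. apply (gen_app ok (fun _ _ => map sym l)); auto. apply gen_const, valid_sym. Qed.

Lemma emittable_And F G : emittable ok F -> emittable ok G ->
  emittable ok (fun arr i => And (F arr i) (G arr i)).
Proof.
  intros HF HG. eapply gen_ext; [|apply (gen_prefix [false; false; true; true]), gen_app; [exact HF|exact HG]].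
  intros. cbn [enc]. rewrite !map_app. auto.
Qed.

Lemma emittable_Or F G : emittable ok F -> emittable ok G ->
  emittable ok (fun arr i => Or (F arr i) (G arr i)).
Proof.
  intros HF HG. eapply gen_ext; [|apply (gen_prefix [false; false; true; false]), gen_app; [exact HF|exact HG]].
  intros. cbn [enc]. rewrite !map_app. auto.
Qed.

Lemma emittable_Imp F G : emittable ok F -> emittable ok G ->
  emittable ok (fun arr i => Imp (F arr i) (G arr i)).
Proof.
  intros HF HG. eapply gen_ext; [|apply (gen_prefix [false; true; false; false]), gen_app; [exact HF|exact HG]].
  intros. cbn [enc]. rewrite !map_app. auto.
Qed.

Lemma emittable_box md F : emittable ok F -> emittable ok (fun arr i => box md (F arr i)).
Proof.
  intros HF. destruct md.
  - eapply gen_ext; [|apply (gen_prefix [true; false; false; true]); exact HF].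
    intros. cbn [enc box]. rewrite map_app. auto.
  - eapply gen_ext; [|apply (gen_prefix [false; true; true; false]), gen_app;
      [exact HF|apply (gen_const ok (map sym (enc fin))), valid_sym]].
    intros. cbn [enc box]. rewrite !map_app. auto.
  - eapply gen_ext; [|apply (gen_prefix ([false; true; true; true] ++ enc fin)); exact HF].
    intros. cbn [enc box]. rewrite !map_app, app_assoc. auto.
Qed.

(** Multiplication by 8 and the residue [r] affect only the constant low digits, now [3 + width M]
    many and equal to [r + 8 * k]. *)
Lemma emittable_atom r k idx : r < 8 -> k < length (contents M) + 5 -> unary ok idx ->
  emittable ok (fun arr i => Atom (8 * vd k (idx arr i) + r)).
Proof.
  intros Hr Hk Hi. apply kind_small in Hk.
  assert (Hc : r + 8 * k < 2 ^ (3 + width M)).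
  { rewrite Nat.pow_add_r. simpl (2 ^ 3). lia. }
  assert (E : forall i, 8 * vd k i + r = (r + 8 * k) + 2 ^ (3 + width M + i)).
  { intros i. unfold vid. rewrite <- (Nat.add_assoc 3), (Nat.pow_add_r 2 3). change (2 ^ 3) with 8. lia. }
  eapply gen_ext; [|apply (gen_prefix ([false; false; false; false] ++
      flat_map (fun j => [true; Nat.testbit (r + 8 * k) j]) (seq 0 (3 + width M)))),
    gen_app; [exact Hi|apply (gen_const ok (map sym [true; true; false])), valid_sym]].
  intros arr o _. rewrite E. cbn [enc]. rewrite enc_nat_high by auto.
  rewrite !map_app, <- !app_assoc. auto.
Qed.

Lemma emittable_ext_lit b k idx : k < length (contents M) + 5 -> unary ok idx ->
  emittable ok (fun arr i => ext b (vd k (idx arr i))).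
Proof. intros. unfold ext. destruct b; apply emittable_atom; auto; lia. Qed.

Lemma emittable_gs c b k idx : k < length (contents M) + 5 -> unary ok idx ->
  emittable ok (fun arr i => gs c b (vd k (idx arr i))).
Proof.
  intros. unfold gs.
  eapply (emittable_ext (fun arr i => Atom (8 * vd k (idx arr i) + ((if c then 4 else 2) + (if b then 0 else 1))))).
  - intros. f_equal; lia.
  - apply emittable_atom; auto. destruct c, b; lia.
Qed.

Lemma emittable_lit c b k idx : k < length (contents M) + 5 -> unary ok idx ->
  emittable ok (fun arr i => lit M c b k (idx arr i)).
Proof. apply emittable_gs. Qed.
End Emission.

Lemma emittable_if ok c F G : ok = within -> emittable ok F -> emittable ok G ->
  emittable ok (fun arr i => if nth i arr 0 =? c then F arr i else G arr i).
Proof.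
  intros -> HF HG. unfold emittable in *.
  eapply gen_ext; [|apply (gen_if_within (fun a => a =? c)); [exact HF|exact HG]].
  intros arr o _. simpl. destruct (_ =? c); auto.
Qed.

(** In prefix notation a conjunction nested to the right has nothing to close, so a loop can print
    its members one by one. *)
Lemma enc_conjs {A} (F : A -> form) l z :
  enc (conjs (map F l) z) = flat_map (fun x => [false; false; true; true] ++ enc (F x)) l ++ enc z.
Proof.
  induction l as [|a l IH]; [reflexivity|]. cbn [map flat_map].
  change (enc (conjs (F a :: map F l) z)) with ([false; false; true; true] ++ enc (F a) ++ enc (conjs (map F l) z)).
  rewrite IH, <- !app_assoc. reflexivity.
Qed.

Lemma enc_disjs {A} (F : A -> form) l z :
  enc (disjs (map F l) z) = flat_map (fun x => [false; false; true; false] ++ enc (F x)) l ++ enc z.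
Proof.
  induction l as [|a l IH]; [reflexivity|]. cbn [map flat_map].
  change (enc (disjs (F a :: map F l) z)) with ([false; false; true; false] ++ enc (F a) ++ enc (disjs (map F l) z)).
  rewrite IH, <- !app_assoc. reflexivity.
Qed.

Lemma gen_cells F : emittable within F -> forall tag, gen top (fun arr _ =>
  map sym (flat_map (fun i => tag ++ enc (F arr i)) (seq 0 (length arr)))).
Proof.
  intros HF tag. eapply gen_ext; [|apply gen_for, (gen_prefix within tag); exact HF].
  intros arr o _. simpl. rewrite map_flat_map. apply flat_map_ext. intros i.
  rewrite cur_point, map_app. auto.
Qed.

Lemma emittable_conjs_cells F z : emittable within F -> emittable top z ->
  emittable top (fun arr i => conjs (map (F arr) (seq 0 (length arr))) (z arr i)).
Proof.
  intros HF Hz. eapply gen_ext; [|apply gen_app; [apply (gen_cells F HF [false; false; true; true])|exact Hz]].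
  intros. rewrite enc_conjs, map_app. auto.
Qed.

Lemma emittable_disjs_cells F z : emittable within F -> emittable top z ->
  emittable top (fun arr i => disjs (map (F arr) (seq 0 (length arr))) (z arr i)).
Proof.
  intros HF Hz. eapply gen_ext; [|apply gen_app; [apply (gen_cells F HF [false; false; true; false])|exact Hz]].
  intros. rewrite enc_disjs, map_app. auto.
Qed.

Lemma flat_map_flat_map {A B C} (f : B -> list C) (g : A -> list B) l :
  flat_map f (flat_map g l) = flat_map (fun x => flat_map f (g x)) l.
Proof. induction l; simpl; auto. rewrite flat_map_app, IHl. auto. Qed.

(** * Printing the whole formula *)

Section EmitReduction.
Context (M : TM) (md : mode).
Notation vd := (vid M).
Notation Q := (length (contents M)).

Definition emittable_at (F : nat -> form) : Prop :=
  forall ok k idx, k < Q + 5 -> unary ok idx -> emittable ok (fun arr i => F (vd k (idx arr i))).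

Lemma gen_tagged F k idx : emittable_at F -> k < Q + 5 -> unary within idx ->
  gen within (fun arr o => map sym ([false; false; true; true] ++ enc (F (vd k (idx arr (cur false o)))))).
Proof.
  intros HF Hk Hi.
  eapply gen_ext; [|apply (gen_prefix within [false; false; true; true]); exact (HF _ _ _ Hk Hi)].
  intros. rewrite map_app. auto.
Qed.

(** [fields] is a fixed list followed by one block per array cell: the former is printed as a
    constant, the latter by a single loop. *)
Lemma emittable_conjs_fields F z : emittable_at F -> emittable top z ->
  emittable top (fun arr i => conjs (map F (fields M arr)) (z arr i)).
Proof.
  intros HF Hz.
  set (tag := fun x => [false; false; true; true] ++ enc (F x)).
  pose proof (gen_for _ (gen_app _ _ _ (gen_tagged F 0 _ HF ltac:(lia) unary_cur)
    (gen_app _ _ _ (gen_tagged F 1 _ HF ltac:(lia) unary_cur)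
    (gen_app _ _ _ (gen_tagged F 2 _ HF ltac:(lia) (unary_succ _ _ unary_cur))
    (gen_app _ _ _ (gen_tagged F 3 _ HF ltac:(lia) (unary_succ _ _ unary_cur))
                   (gen_tagged F 4 _ HF ltac:(lia) (unary_succ _ _ unary_cur))))))) as B.
  pose proof (gen_const top _ (valid_sym (flat_map tag
    ([vd 4 0; vd 2 0; vd 3 0] ++ map (fun k => vd (5 + k) 0) (seq 0 Q))))) as A.
  eapply gen_ext; [|exact (gen_app _ _ _ (gen_app _ _ _ A B) Hz)].
  intros arr o _. cbv beta. rewrite enc_conjs. unfold fields. fold tag.
  rewrite (flat_map_app tag (_ ++ _)), (flat_map_flat_map tag),
    (map_app sym (_ ++ _) (enc _)), (map_app sym (flat_map tag _)), (map_flat_map sym _ (seq _ _)).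
  f_equal. f_equal. apply flat_map_ext. intros i. rewrite cur_point.
  cbn [flat_map]. unfold tag. rewrite app_nil_r, !map_app. auto.
Qed.

Lemma emittable_conjs_address F z : emittable_at F -> emittable top z ->
  emittable top (fun arr i => conjs (map F (address M arr)) (z arr i)).
Proof.
  intros HF Hz.
  set (tag := fun x => [false; false; true; true] ++ enc (F x)).
  pose proof (gen_for _ (gen_if_within (fun a => a =? 3) _ _
    (gen_app _ _ _ (gen_tagged F 0 _ HF ltac:(lia) unary_cur)
                   (gen_tagged F 1 _ HF ltac:(lia) unary_cur)) (gen_nil within))) as B.
  eapply gen_ext; [|exact (gen_app _ _ _ B Hz)].
  intros arr o _. cbv beta. rewrite enc_conjs. unfold address. fold tag.
  rewrite (flat_map_flat_map tag), (map_app sym _ (enc _)), (map_flat_map sym _ (seq _ _)).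
  f_equal. apply flat_map_ext. intros i. rewrite cur_point. unfold is_bit.
  destruct (_ =? 3); auto.
  cbn [flat_map]. unfold tag. rewrite app_nil_r, !map_app. auto.
Qed.

Ltac emit_at := intros ok k idx Hk Hi;
  repeat match goal with
  | |- emittable _ (fun _ _ => ?f) => apply emittable_const
  | |- emittable _ (fun arr i => ext _ _) => apply emittable_ext_lit; assumption
  | |- emittable _ (fun arr i => gs _ _ _) => apply emittable_gs; assumption
  | |- emittable _ (fun arr i => And _ _) => apply emittable_And
  | |- emittable _ (fun arr i => Or _ _) => apply emittable_Or
  | |- emittable _ (fun arr i => Imp _ _) => apply emittable_Imp
  | |- emittable _ (fun arr i => box _ _) => apply emittable_box
  end.

Lemma emittable_at_all_guess : emittable_at all_guess.
Proof. unfold all_guess. emit_at. Qed.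
Lemma emittable_at_ext_total : emittable_at ext_total.
Proof. unfold ext_total, Neg. emit_at. Qed.
Lemma emittable_at_guess_excl : emittable_at guess_excl.
Proof. unfold guess_excl. emit_at. Qed.
Lemma emittable_at_guess_total : emittable_at (guess_total md).
Proof. unfold guess_total. emit_at. Qed.
Lemma emittable_at_same_lit c : emittable_at (same_lit c).
Proof. unfold same_lit. emit_at. Qed.

Lemma emittable_cell_if F G : emittable within F -> emittable within G ->
  emittable within (fun arr i => if is_bit arr i then F arr i else G arr i).
Proof. apply (emittable_if within 3); auto. Qed.

Lemma unary_succ_cur : unary within (fun _ i => S i).
Proof. exact (unary_succ within (fun _ i => i) unary_cur). Qed.

Lemma emittable_all_cells F : emittable within F ->
  emittable top (fun arr _ => all_cells M arr (F arr)).
Proof.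
  intros HF. apply (emittable_conjs_cells F (fun _ _ => tt M)); auto.
  apply emittable_const.
Qed.

Lemma emittable_any_cell F : emittable within F ->
  emittable top (fun arr _ => any_cell arr (F arr)).
Proof.
  intros HF. apply (emittable_disjs_cells F (fun _ _ => ff)); auto.
  apply emittable_const.
Qed.

Lemma lit_cur c b k : k < Q + 5 -> emittable within (fun _ i => lit M c b k i).
Proof. intros. apply (emittable_lit M within c b k (fun _ i => i)); auto. apply unary_cur. Qed.
Lemma lit_succ c b k : k < Q + 5 -> emittable within (fun _ i => lit M c b k (S i)).
Proof. intros. apply (emittable_lit M within c b k (fun _ i => S i)); auto. apply unary_succ_cur. Qed.
Lemma lit_last c b k : k < Q + 5 -> emittable top (fun arr _ => lit M c b k (length arr)).
Proof. intros. apply (emittable_lit M top c b k (fun arr _ => length arr)); auto. apply unary_length. Qed.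

Ltac emit :=
  repeat match goal with
  | H : emittable _ ?F |- emittable _ ?F => exact H
  | |- emittable _ (fun _ _ => ?f) => apply emittable_const
  | |- emittable _ (fun _ i => lit _ _ _ _ i) => apply lit_cur; lia
  | |- emittable _ (fun _ i => lit _ _ _ _ (S i)) => apply lit_succ; lia
  | |- emittable _ (fun arr _ => lit _ _ _ _ (length arr)) => apply lit_last; lia
  | |- emittable _ (fun arr i => And _ _) => apply emittable_And
  | |- emittable _ (fun arr i => Or _ _) => apply emittable_Or
  | |- emittable _ (fun arr i => Imp _ _) => apply emittable_Imp
  | |- emittable _ (fun arr i => box _ _) => apply emittable_box
  | |- emittable _ (fun arr i => if is_bit _ _ then _ else _) => apply emittable_cell_if
  | |- emittable _ (fun arr i => if nth _ _ _ =? _ then _ else _) => apply emittable_if; [reflexivity|..]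
  | |- emittable _ (fun arr _ => all_cells _ arr _) => apply emittable_all_cells
  | |- emittable _ (fun arr _ => any_cell arr _) => apply emittable_any_cell
  end.

Lemma emittable_zero c k : k < 2 -> emittable top (fun arr _ => zero M arr c k).
Proof. intros. unfold zero. emit. Qed.

Lemma emittable_carry k kc : k < 4 -> kc < 4 -> emittable top (fun arr _ => carry M arr k kc).
Proof. intros. unfold carry, eq_lit. emit. Qed.

Lemma emittable_succ c c' k kc : k < 4 -> kc < 4 ->
  emittable top (fun arr _ => succ M arr c c' k kc).
Proof. intros. unfold succ. emit. Qed.

Lemma emittable_same_cell : emittable top (fun arr _ => same_cell M arr).
Proof. intros. unfold same_cell, eq_lit. emit. Qed.

Lemma emittable_Good : emittable top (fun arr _ => Good M arr).
Proof.
  unfold Good, clauses. cbn [conjs fold_right].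
  assert (Z : forall c k, k < 2 -> emittable top (fun arr _ => zero M arr c k))
    by (apply emittable_zero).
  assert (Z0 := Z false 0 ltac:(lia)). assert (Z1 := Z false 1 ltac:(lia)).
  assert (T : emittable top (fun arr _ => tick M arr)) by (apply emittable_succ; lia).
  assert (R : emittable top (fun arr _ => right M arr)) by (apply emittable_succ; lia).
  assert (L : emittable top (fun arr _ => left M arr)) by (apply emittable_succ; lia).
  assert (C1 := emittable_carry 0 2 ltac:(lia) ltac:(lia)).
  assert (C2 := emittable_carry 1 3 ltac:(lia) ltac:(lia)).
  assert (B : emittable top (fun arr _ => both_zero M arr))
    by (apply emittable_And; apply Z; lia).
  assert (S := emittable_same_cell). unfold eq_lit.
  emit.
Qed.

Lemma emittable_reduction : emittable top (fun arr _ => reduction md M arr).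
Proof.
  assert (G := emittable_Good).
  assert (L : forall c, emittable top (fun arr _ => label c (fields M arr) (vid M 4 0))).
  { intros c. apply (emittable_conjs_fields (same_lit c) (fun _ _ => tt_at (vid M 4 0)));
      [apply emittable_at_same_lit|apply emittable_const]. }
  assert (L0 := L false). assert (L1 := L true).
  assert (A : emittable top (fun arr _ => label false (address M arr) (vid M 4 0))).
  { apply (emittable_conjs_address (same_lit false) (fun _ _ => tt_at (vid M 4 0)));
      [apply emittable_at_same_lit|apply emittable_const]. }
  assert (C1 := emittable_conjs_fields all_guess (fun _ _ => tru) emittable_at_all_guess
                  (emittable_const _ _)).
  assert (C2 := emittable_conjs_fields ext_total (fun _ _ => Imp tru tru) emittable_at_ext_total
                  (emittable_const _ _)).
  assert (C3 := emittable_conjs_fields guess_excl (fun _ _ => Imp tru tru) emittable_at_guess_excl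
                  (emittable_const _ _)).
  cbv beta in C1, C2, C3.
  assert (V : emittable top (fun arr _ =>
            violation md (fields M arr) (address M arr) (vid M 4 0) (Good M arr)))
    by (unfold violation; emit).
  assert (C4 := emittable_conjs_fields (guess_total md) _ emittable_at_guess_total V).
  unfold reduction, Phi. emit.
Qed.
End EmitReduction.

Lemma transduces_reduction md M : transduces (fun arr => map sym (enc (reduction md M arr))).
Proof.
  exact (transduces_gen (fun arr _ => map sym (enc (reduction md M arr))) (emittable_reduction M md)).
Qed.

Lemma reduction_poly_time md M e :
  poly_time_computable (fun w => enc (reduction md M (layout w (length w ^ e + e)))).
Proof.
  apply (transduces_poly_time (fun arr => map sym (enc (reduction md M (prepare e arr))))).
  - apply (transduces_comp (prepare e) (fun arr => map sym (enc (reduction md M arr)))).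
    + apply transduces_prepare.
    + apply transduces_reduction.
  - intros w. rewrite prepare_layout. auto.
Qed.

(** * Unique readability of the encoding, and hardness *)

Lemma bits_prefix (f g : nat -> bool) m : forall n a r r',
  flat_map (fun k => [true; f k]) (seq a m) ++ false :: r =
  flat_map (fun k => [true; g k]) (seq a n) ++ false :: r' ->
  m = n /\ (forall k, a <= k < a + m -> f k = g k) /\ r = r'.
Proof.
  induction m as [|m IH]; intros [|n] a r r' H; simpl in H; try discriminate.
  - injection H as H. repeat split; auto; lia.
  - injection H as Ef H. apply IH in H as (-> & K & ->). repeat split; auto.
    intros k Hk. destruct (Nat.eq_dec k a) as [->|]; auto. apply K; lia.
Qed.

Lemma enc_nat_prefix p q r r' : enc_nat p ++ r = enc_nat q ++ r' -> p = q /\ r = r'.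
Proof.
  unfold enc_nat. rewrite <- !app_assoc. intros H. apply bits_prefix in H as (L & K & ->).
  split; auto. apply Nat.bits_inj. intros k.
  destruct (le_lt_dec k (Nat.log2 p)) as [Hk|Hk]; [apply K; lia|].
  rewrite !Nat.bits_above_log2; auto. lia.
Qed.

(** The arbitrary continuations make the statement inductive: the first subformula must be split off
    from whatever follows it. *)
Lemma enc_prefix f : forall g r r', enc f ++ r = enc g ++ r' -> f = g /\ r = r'.
Proof.
  induction f; intros g r r' H; destruct g; cbn [enc] in H; rewrite <- ?app_assoc in H;
    try discriminate H; apply (f_equal (skipn 4)) in H; cbn [skipn app] in H; auto.
  all: try (apply enc_nat_prefix in H as [-> ->]; auto; fail).
  all: try (apply IHf1 in H as [-> H]; apply IHf2 in H as [-> ->]; auto; fail).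
  all: apply IHf in H as [-> ->]; auto.
Qed.

Lemma enc_inj f g : enc f = enc g -> f = g.
Proof. intros H. apply (enc_prefix f g [] []). rewrite H; auto. Qed.

Lemma CON_hard md : NEXPTIME_hard (CON (THT 2 1 (ops md))).
Proof.
  intros L (M & e & HL).
  exists (fun w => enc (reduction md M (layout w (length w ^ e + e)))).
  split; [apply reduction_poly_time|]. intros w. rewrite HL, (reduction_correct md).
  split.
  - intros H. eexists. split; [reflexivity|]. split; [apply reduction_THT|exact H].
  (* [CON] only provides some formula with this code; injectivity identifies it with the
     reduction. *)
  - intros (f & E & _ & H). apply enc_inj in E. subst. exact H.
Qed.

Theorem mainTheorem3 :
  NEXPTIME_hard (CON (THT 2 1 ops_FG)) /\
  NEXPTIME_hard (CON (THT 2 1 ops_U)) /\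
  NEXPTIME_hard (CON (THT 2 1 ops_R)).
Proof.
  exact (conj (CON_hard ModeFG) (conj (CON_hard ModeU) (CON_hard ModeR))).
Qed.
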